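(* Let $n\ge 2$ be an integer, $k,c_b>0$, $\rho_0>0$, and let $\lambda_{1,0},\dots,\lambda_{n,0}$ be real numbers with $\lambda_{1,0}=\cdots=\lambda_{J,0}<\lambda_{J+1,0}\le\cdots\le\lambda_{n,0}$ for some integer $1\le J\le n$. Consider the system $$\lambda_i'=-\lambda_i^2+\frac{k}{n}(\rho-c_b)\ (i=1,\dots,n),\qquad \rho'=-\rho\lambda,\quad \lambda=\sum_{i=1}^n\lambda_i,\qquad \rho(0)=\rho_0,\ \lambda_i(0)=\lambda_{i,0}.$$ Suppose the maximal interval of existence of its solution is $[0,t_B)$ with $0<t_B<\infty$. Then $1\le J\le \frac n2$, and $$t_B\ \ge\ \frac{1}{\omega}\arctan\Big(\frac{\lambda_{1,0}}{\omega}\Big)+\frac{\pi}{2\omega},\qquad \omega:=\sqrt{kc_b/n}.$$ Moreover $\lim_{t\to t_B^-}\lambda_i(t)=-\infty$ for $1\le i\le J$, $\lim_{t\to t_B^-}\lambda_i(t)=+\infty$ for $J<i\le n$, $\lim_{t\to t_B^-}\rho(t)=+\infty$, and there exist constants $0\le q\le p$ such that $$\lim_{t\to t_B^-}\lambda_1(t)\,e^{\int_0^t(\lambda_1(s)+\lambda_n(s))\,ds}=-p,\qquad \lim_{t\to t_B^-}\lambda_n(t)\,e^{\int_0^t(\lambda_1(s)+\lambda_n(s))\,ds}=q.$$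
   Context: This is the restricted Euler–Poisson (REP) system; $'$ denotes the time derivative, and solutions are real-valued, continuously differentiable functions of $t\in[0,t_B)$. *)

(* Defs.v *)
From Stdlib Require Import Reals Lra Lia.
From Coquelicot Require Import Coquelicot.
Open Scope R_scope.

Definition lam_sum (n : nat) (lam : nat -> R -> R) (t : R) : R :=
  sum_n_m (fun i => lam i t) 1 n.

(* (lam_1..lam_n, rho) is a solution of the REP system on [0,T) with
   initial data (lam0, rho0): continuous at 0 from the right, differentiable
   on (0,T) with the prescribed derivatives (hence C^1 on [0,T)). *)
Definition REP_solution (n : nat) (k cb rho0 : R) (lam0 : nat -> R)
  (T : R) (lam : nat -> R -> R) (rho : R -> R) : Prop :=
  rho 0 = rho0 /\
  (forall i, (1 <= i <= n)%nat -> lam i 0 = lam0 i) /\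
  filterlim rho (at_right 0) (locally rho0) /\
  (forall i, (1 <= i <= n)%nat -> filterlim (lam i) (at_right 0) (locally (lam0 i))) /\
  (forall t, 0 < t < T ->
     (forall i, (1 <= i <= n)%nat ->
        is_derive (lam i) t (- (lam i t)^2 + k / INR n * (rho t - cb))) /\
     is_derive rho t (- rho t * lam_sum n lam t)).

Definition REP_maximal_solution (n : nat) (k cb rho0 : R) (lam0 : nat -> R)
  (T : R) (lam : nat -> R -> R) (rho : R -> R) : Prop :=
  REP_solution n k cb rho0 lam0 T lam rho /\
  ~ (exists (T' : R) (mu : nat -> R -> R) (sigma : R -> R),
        T < T' /\ REP_solution n k cb rho0 lam0 T' mu sigma /\
        (forall t, 0 <= t < T ->
           sigma t = rho t /\ forall i, (1 <= i <= n)%nat -> mu i t = lam i t)).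

(* Main.v *)
(* With u_i = exp (int_0^t lam_i) the system becomes u_i'' = (k/n)(rho - c_b) u_i: all u_i solve
   the same linear equation, so u_i u_j' - u_i' u_j = lam_{j,0} - lam_{i,0} and every u_i is a
   combination of u_1 and u_n. Since u_i'' + omega^2 u_i >= 0, Sturm comparison controls u_i on
   short intervals. If u_1 stayed away from 0, the solution would be bounded and, by
   Cauchy-Lipschitz, could be continued; hence u_1 -> 0, and Sturm comparison gives both
   lam_1 -> -oo and the lower bound on t_B. An energy estimate shows that u_n cannot vanish,
   whence J < n, and then lam_n -> +oo.

   For the rest, put D = lam_n - lam_1 = (lam_{n,0} - lam_{1,0}) / (u_1 u_n),
   M = - (lam_1 + lam_n) / (2 D) and G = (k/n) rho / D^2. In the time s = log (u_n / u_1), which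
   tends to +oo, they satisfy, up to terms integrable in s,
     D' = 2 M D,   M' = 1/4 - M^2 - G,   G' = G ((n - 4) M + J - n/2),
   with |M| < 1/2. The existence of the last two limits of the theorem is that of lim M. It follows
   from the convergence of G, which comes from monotone quantities, except for n > 4 and J < n/2, where
   the system is a damped oscillator and its energy is a Lyapunov function. *)

Require Import Defs.
From Stdlib Require Import Reals Arith Lra Lia Psatz Classical.
From Coquelicot Require Import Coquelicot.
Open Scope R_scope.

(** * Limits from the left and differential inequalities *)

(** The last two limits depend on [M] alone because exp (A_1 + A_n) = d / D, where A_i is the
    integral of lam_i and d = lam_{n,0} - lam_{1,0}: the two products are - d (1/2 + M) and d (1/2 -
    M). Then 0 <= q comes from M < 1/2, and q <= p from lim M >= 0, which is forced by D -> +oo. The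
    bound J <= n/2 holds because otherwise G would tend to +oo and drive M below - 1/2. The analysis
    is carried out in t, with D = ds/dt as a weight. On the bounded interval a remainder bounded in
    t is harmless, whereas a drift of fixed sign times D integrates to infinity. The obstacle is the
    competition between the two terms of the rate (n - 4) M + J - n/2 of G. Subtracting (n - 4)/2
    log D from log G removes M and leaves the drift J - n/2, which suffices unless the coefficients
    n - 4 and J - n/2 have opposite signs. They do for n = 3, J = 2, where M < 1/2 still fixes the
    sign of the rate, and for n > 4, J < n/2. *)

Lemma at_left_iff (b : R) (P : R -> Prop) :
  at_left b P <-> exists T, T < b /\ forall t, T < t < b -> P t.
Proof.
  split.
  - intros [e H]. exists (b - e). split; [destruct e; simpl; lra|].
    intros t Ht. apply H; [|lra].
    change (Rabs (t - b) < e). rewrite Rabs_left; lra.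
  - intros [T [HT H]]. assert (He : 0 < b - T) by lra.
    exists (mkposreal _ He). intros t Ht Htb. apply H. split; [|lra].
    change (Rabs (t - b) < b - T) in Ht. rewrite Rabs_left in Ht; lra.
Qed.

Lemma at_left_intro (b T : R) (P : R -> Prop) :
  T < b -> (forall t, T < t < b -> P t) -> at_left b P.
Proof. intros HT H. apply at_left_iff. now exists T. Qed.

Lemma at_left_ge (b T : R) : T < b -> at_left b (fun t => T < t < b).
Proof. intros HT. now apply (at_left_intro b T). Qed.

Lemma at_left_witness (b T : R) (P : R -> Prop) :
  T < b -> at_left b P -> exists t, T < t < b /\ P t.
Proof.
  intros HT HP. destruct (filter_ex _ (filter_and _ _ (at_left_ge b T HT) HP)) as [t Ht].
  now exists t.
Qed.

Lemma not_at_left (b T : R) (P : R -> Prop) :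
  T < b -> ~ at_left b P -> exists t, T < t < b /\ ~ P t.
Proof.
  intros HT HP. apply NNPP. intros H. apply HP. apply (at_left_intro b T); [easy|].
  intros t Ht. apply NNPP. intros HQ. apply H. now exists t.
Qed.

Definition conv (b : R) (f : R -> R) (l : R) := filterlim f (at_left b) (locally l).
Definition to_pinf (b : R) (f : R -> R) := filterlim f (at_left b) (Rbar_locally p_infty).

Lemma conv_iff (b : R) (f : R -> R) (l : R) :
  conv b f l <-> forall eps, 0 < eps -> at_left b (fun t => Rabs (f t - l) < eps).
Proof.
  unfold conv. rewrite filterlim_locally. split.
  - intros H e He. exact (H (mkposreal e He)).
  - intros H e. exact (H e (cond_pos e)).
Qed.

Lemma to_pinf_iff (b : R) (f : R -> R) :
  to_pinf b f <-> forall K, at_left b (fun t => K < f t).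
Proof.
  split.
  - intros H K. apply (H (fun x => K < x)). now exists K.
  - intros H P [K HK]. unfold filtermap. generalize (H K). apply filter_imp. auto.
Qed.

Lemma to_minf_iff (b : R) (f : R -> R) :
  filterlim f (at_left b) (Rbar_locally m_infty) <-> forall K, at_left b (fun t => f t < K).
Proof.
  split.
  - intros H K. apply (H (fun x => x < K)). now exists K.
  - intros H P [K HK]. unfold filtermap. generalize (H K). apply filter_imp. auto.
Qed.

Lemma to_pinf_le (b : R) (f g : R -> R) :
  at_left b (fun t => f t <= g t) -> to_pinf b f -> to_pinf b g.
Proof.
  intros H. rewrite 2!to_pinf_iff. intros H1 K.
  generalize (filter_and _ _ H (H1 K)). apply filter_imp. intros t Ht. lra.
Qed.

Lemma conv_plus (b : R) (f g : R -> R) (l m : R) :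
  conv b f l -> conv b g m -> conv b (fun t => f t + g t) (l + m).
Proof.
  intros Hf Hg. apply (filterlim_comp_2 (G := locally l) (H := locally m) f g Rplus Hf Hg).
  exact (filterlim_plus l m).
Qed.

Lemma conv_mult (b : R) (f g : R -> R) (l m : R) :
  conv b f l -> conv b g m -> conv b (fun t => f t * g t) (l * m).
Proof.
  intros Hf Hg. apply (filterlim_comp_2 (G := locally l) (H := locally m) f g Rmult Hf Hg).
  exact (filterlim_mult l m).
Qed.

Lemma conv_const (b c : R) : conv b (fun _ => c) c.
Proof. apply filterlim_const. Qed.

Lemma conv_id (b : R) : conv b (fun t => t) b.
Proof.
  apply conv_iff. intros e He. apply (at_left_intro b (b - e)); [lra|].
  intros t Ht. rewrite Rabs_left; lra.
Qed.

Lemma conv_comp (b : R) (f g : R -> R) (l : R) :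
  continuous g l -> conv b f l -> conv b (fun t => g (f t)) (g l).
Proof. intros Hg Hf. exact (filterlim_comp _ _ _ f g _ _ _ Hf Hg). Qed.

Lemma conv_ext (b : R) (f g : R -> R) (l : R) :
  at_left b (fun t => f t = g t) -> conv b f l -> conv b g l.
Proof. apply filterlim_ext_loc. Qed.

Lemma conv_le (b : R) (f : R -> R) (l c : R) :
  conv b f l -> at_left b (fun t => f t <= c) -> l <= c.
Proof.
  intros H Hc. apply Rnot_lt_le. intros Hl.
  assert (He : 0 < l - c) by lra.
  generalize (filter_and _ _ Hc (proj1 (conv_iff _ _ _) H _ He)). intros H2.
  destruct (filter_ex _ H2) as [t [H3 H4]]. apply Rabs_def2 in H4. lra.
Qed.

Lemma conv_ge (b : R) (f : R -> R) (l c : R) :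
  conv b f l -> at_left b (fun t => c <= f t) -> c <= l.
Proof.
  intros H Hc. apply Rnot_lt_le. intros Hl.
  assert (He : 0 < c - l) by lra.
  generalize (filter_and _ _ Hc (proj1 (conv_iff _ _ _) H _ He)). intros H2.
  destruct (filter_ex _ H2) as [t [H3 H4]]. apply Rabs_def2 in H4. lra.
Qed.

Lemma conv_gt_ev (b : R) (f : R -> R) (l c : R) :
  conv b f l -> c < l -> at_left b (fun t => c < f t).
Proof.
  intros H Hl. assert (He : 0 < l - c) by lra.
  generalize (proj1 (conv_iff _ _ _) H _ He). apply filter_imp. intros t Ht.
  apply Rabs_def2 in Ht. lra.
Qed.

Lemma conv_lt_ev (b : R) (f : R -> R) (l c : R) :
  conv b f l -> l < c -> at_left b (fun t => f t < c).
Proof.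
  intros H Hl. assert (He : 0 < c - l) by lra.
  generalize (proj1 (conv_iff _ _ _) H _ He). apply filter_imp. intros t Ht.
  apply Rabs_def2 in Ht. lra.
Qed.

Lemma conv_of_continuous (b : R) (f : R -> R) : continuous f b -> conv b f (f b).
Proof. intros H. exact (conv_comp b (fun t => t) f b H (conv_id b)). Qed.

Lemma is_derive_eq (f : R -> R) (x l m : R) : is_derive f x l -> l = m -> is_derive f x m.
Proof. intros H <-. exact H. Qed.

Lemma is_derive_Rplus (f g : R -> R) (x l m : R) :
  is_derive f x l -> is_derive g x m -> is_derive (fun t => f t + g t) x (l + m).
Proof. intros Hf Hg. exact (is_derive_plus f g x l m Hf Hg). Qed.

Lemma is_derive_Rminus (f g : R -> R) (x l m : R) :
  is_derive f x l -> is_derive g x m -> is_derive (fun t => f t - g t) x (l - m).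
Proof. intros Hf Hg. exact (is_derive_minus f g x l m Hf Hg). Qed.

Lemma is_derive_Rscal (f : R -> R) (c x l : R) :
  is_derive f x l -> is_derive (fun t => c * f t) x (c * l).
Proof. intros Hf. exact (is_derive_scal f x c l Hf). Qed.

Lemma is_derive_Rmult (f g : R -> R) (x l m : R) :
  is_derive f x l -> is_derive g x m -> is_derive (fun t => f t * g t) x (l * g x + f x * m).
Proof. intros Hf Hg. exact (is_derive_mult f g x l m Hf Hg Rmult_comm). Qed.

Lemma is_derive_sq (f : R -> R) (x l : R) :
  is_derive f x l -> is_derive (fun t => f t ^ 2) x (2 * f x * l).
Proof.
  intros Hf. apply is_derive_ext with (fun t => f t * f t); [intros; simpl; ring|].
  apply is_derive_eq with (1 := is_derive_Rmult f f x l l Hf Hf). ring.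
Qed.

Lemma is_derive_ln_comp (f : R -> R) (x l : R) :
  is_derive f x l -> 0 < f x -> is_derive (fun t => ln (f t)) x (l / f x).
Proof.
  intros Hf Hpos. exact (is_derive_comp ln f x _ _ (is_derive_ln _ Hpos) Hf).
Qed.

Lemma is_derive_exp_comp (f : R -> R) (x l : R) :
  is_derive f x l -> is_derive (fun t => exp (f t)) x (l * exp (f x)).
Proof. intros Hf. exact (is_derive_comp exp f x _ _ (is_derive_exp _) Hf). Qed.

Lemma is_derive_linear (c x : R) : is_derive (fun t => c * t) x c.
Proof. auto_derive; [easy|ring]. Qed.

Lemma is_derive_cont_pt (f : R -> R) (x l : R) : is_derive f x l -> continuity_pt f x.
Proof.
  intros H. apply continuity_pt_filterlim. apply (ex_derive_continuous f x). now exists l.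
Qed.

Lemma deriv_nonneg_le (T b : R) (f g : R -> R) :
  (forall t, T < t < b -> is_derive f t (g t)) ->
  (forall t, T < t < b -> 0 <= g t) ->
  forall x y, T < x -> x <= y -> y < b -> f x <= f y.
Proof.
  intros Hd Hg x y Hx Hxy Hy.
  destruct (MVT_gen f x y g) as [c [Hc Heq]].
  - intros t. rewrite Rmin_left, Rmax_right by lra. intros Ht. apply Hd. lra.
  - intros t. rewrite Rmin_left, Rmax_right by lra. intros Ht.
    apply (is_derive_cont_pt f t (g t)). apply Hd. lra.
  - rewrite Rmin_left, Rmax_right in Hc by lra.
    assert (0 <= g c * (y - x)) by (apply Rmult_le_pos; [apply Hg|]; lra). lra.
Qed.

Lemma deriv_nonpos_le (T b : R) (f g : R -> R) :
  (forall t, T < t < b -> is_derive f t (g t)) ->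
  (forall t, T < t < b -> g t <= 0) ->
  forall x y, T < x -> x <= y -> y < b -> f y <= f x.
Proof.
  intros Hd Hg x y Hx Hxy Hy.
  assert (- f x <= - f y); [|lra].
  apply (deriv_nonneg_le T b (fun t => - f t) (fun t => - g t)); try assumption.
  - intros t Ht. apply (is_derive_opp f t (g t)). now apply Hd.
  - intros t Ht. specialize (Hg t Ht). lra.
Qed.

Lemma deriv_zero_const (T b : R) (f : R -> R) :
  (forall t, T < t < b -> is_derive f t 0) ->
  forall x y, T < x < b -> T < y < b -> f x = f y.
Proof.
  intros Hd.
  assert (H : forall x y, T < x -> x <= y -> y < b -> f x = f y).
  { intros x y Hx Hxy Hy. apply Rle_antisym.
    - apply (deriv_nonneg_le T b f (fun _ => 0)); auto; intros; lra.
    - apply (deriv_nonpos_le T b f (fun _ => 0)); auto; intros; lra. }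
  intros x y Hx Hy. destruct (Rle_dec x y).
  - apply H; lra.
  - symmetry. apply H; lra.
Qed.

Lemma mono_conv (T b K : R) (f : R -> R) :
  T < b ->
  (forall x y, T < x -> x <= y -> y < b -> f x <= f y) ->
  (forall t, T < t < b -> f t <= K) ->
  exists l, conv b f l.
Proof.
  intros HT Hm HK.
  destruct (completeness (fun y => exists t, T < t < b /\ y = f t)) as [l [Hub Hlub]].
  - exists K. intros y [t [Ht ->]]. now apply HK.
  - exists (f ((T + b) / 2)), ((T + b) / 2). split; [lra|easy].
  - exists l. apply conv_iff. intros e He.
    assert (Hex : exists t, T < t < b /\ l - e < f t).
    { apply NNPP. intros Hn. assert (l <= l - e); [|lra]. apply Hlub.
      intros y [t [Ht ->]]. apply Rnot_lt_le. intros Hlt. apply Hn. now exists t. }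
    destruct Hex as [t0 [Ht0 Hf]].
    apply (at_left_intro b t0); [lra|]. intros t Ht.
    assert (f t0 <= f t) by (apply Hm; lra).
    assert (f t <= l) by (apply Hub; exists t; split; [lra|easy]).
    apply Rabs_def1; lra.
Qed.

(** [f + C * t] is nondecreasing, and on the bounded interval the correction [C * t] is bounded and
    has a limit. Thus monotonicity is needed only up to bounded terms in the derivative. *)
Lemma drift_conv (T b K C : R) (f g : R -> R) :
  T < b ->
  (forall t, T < t < b -> is_derive f t (g t)) ->
  (forall t, T < t < b -> - C <= g t) ->
  (forall t, T < t < b -> f t <= K) ->
  exists l, conv b f l.
Proof.
  intros HT Hd Hg HK.
  destruct (mono_conv T b (K + Rabs C * (Rabs T + Rabs b)) (fun t => f t + C * t)) as [l Hl];
    [easy| | |].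
  - apply (deriv_nonneg_le T b _ (fun t => g t + C)).
    + intros t Ht. apply (is_derive_plus f (fun t => C * t)); [now apply Hd|].
      auto_derive; [easy|ring].
    + intros t Ht. specialize (Hg t Ht). lra.
  - intros t Ht. specialize (HK t Ht).
    assert (C * t <= Rabs C * (Rabs T + Rabs b)); [|lra].
    apply Rle_trans with (1 := Rle_abs _). rewrite Rabs_mult.
    apply Rmult_le_compat_l; [apply Rabs_pos|].
    unfold Rabs; repeat destruct Rcase_abs; lra.
  - exists (l + (- C) * b).
    apply (conv_ext b (fun t => (f t + C * t) + (- C) * t)).
    + apply filter_forall. intros t. ring.
    + apply conv_plus; [exact Hl|]. apply conv_mult; [apply conv_const|apply conv_id].
Qed.

Lemma drift_conv_opp (T b K C : R) (f g : R -> R) :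
  T < b ->
  (forall t, T < t < b -> is_derive f t (g t)) ->
  (forall t, T < t < b -> g t <= C) ->
  (forall t, T < t < b -> K <= f t) ->
  exists l, conv b f l.
Proof.
  intros HT Hd Hg HK.
  destruct (drift_conv T b (- K) C (fun t => - f t) (fun t => - g t)) as [l Hl]; [easy| | | |].
  - intros t Ht. apply (is_derive_opp f t (g t)). now apply Hd.
  - intros t Ht. specialize (Hg t Ht). lra.
  - intros t Ht. specialize (HK t Ht). lra.
  - exists ((-1) * l). apply (conv_ext b (fun t => (-1) * - f t)).
    + apply filter_forall. intros t. ring.
    + apply conv_mult; [apply conv_const|exact Hl].
Qed.

Lemma linear_bound (T b C : R) : exists B, 0 <= B /\ forall t, T < t < b -> Rabs (C * t) <= B.
Proof.
  exists (Rabs C * (Rabs T + Rabs b)). split.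
  - apply Rmult_le_pos; [apply Rabs_pos|]. generalize (Rabs_pos T) (Rabs_pos b). lra.
  - intros t Ht. rewrite Rabs_mult. apply Rmult_le_compat_l; [apply Rabs_pos|].
    unfold Rabs; repeat destruct Rcase_abs; lra.
Qed.

Lemma drift_upper (T b C : R) (f g : R -> R) :
  T < b ->
  (forall t, T < t < b -> is_derive f t (g t)) ->
  (forall t, T < t < b -> g t <= C) ->
  exists K, at_left b (fun t => f t <= K).
Proof.
  intros HT Hd Hg. destruct (linear_bound T b C) as [B [HB0 HB]].
  set (t0 := (T + b) / 2).
  exists (f t0 - C * t0 + B). apply (at_left_intro b t0); [unfold t0; lra|].
  intros t Ht.
  assert (H : f t - C * t <= f t0 - C * t0).
  { apply (deriv_nonpos_le T b (fun t => f t - C * t) (fun t => g t - C));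
      try (unfold t0 in *; lra).
    - intros x Hx. apply (is_derive_minus f (fun t => C * t)); [now apply Hd|].
      auto_derive; [easy|ring].
    - intros x Hx. specialize (Hg x Hx). lra. }
  assert (H2 : Rabs (C * t) <= B) by (apply HB; unfold t0 in *; lra).
  apply Rabs_le_between in H2. lra.
Qed.

Lemma drift_lower (T b C : R) (f g : R -> R) :
  T < b ->
  (forall t, T < t < b -> is_derive f t (g t)) ->
  (forall t, T < t < b -> C <= g t) ->
  exists K, at_left b (fun t => K <= f t).
Proof.
  intros HT Hd Hg.
  destruct (drift_upper T b (- C) (fun t => - f t) (fun t => - g t)) as [K HK]; [easy| | |].
  - intros t Ht. apply (is_derive_opp f t (g t)). now apply Hd.
  - intros t Ht. specialize (Hg t Ht). lra.
  - exists (- K). revert HK. apply filter_imp. intros t Ht. lra.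
Qed.

(** The weight [D] is the derivative of a clock [s] that tends to infinity: [f - dl * s] has a
    derivative bounded below, hence loses only a bounded amount on the finite interval, while
    [dl * s] diverges. *)
Lemma to_pinf_of_drift (T b dl C : R) (s D f g : R -> R) :
  T < b -> 0 < dl ->
  (forall t, T < t < b -> is_derive s t (D t)) -> to_pinf b s ->
  (forall t, T < t < b -> is_derive f t (g t)) ->
  (forall t, T < t < b -> dl * D t - C <= g t) ->
  to_pinf b f.
Proof.
  intros HT Hdl Hs Hinf Hf Hg.
  destruct (drift_lower T b (- C) (fun t => f t - dl * s t) (fun t => g t - dl * D t))
    as [K HK]; [easy| | |].
  - intros t Ht. apply (is_derive_minus f (fun t => dl * s t)); [now apply Hf|].
    apply is_derive_scal. now apply Hs.
  - intros t Ht. specialize (Hg t Ht). lra.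
  - apply to_pinf_iff. intros K1.
    generalize (filter_and _ _ HK (proj1 (to_pinf_iff _ _) Hinf ((K1 - K) / dl))).
    apply filter_imp. intros t [H1 H2].
    apply (Rmult_lt_compat_l dl) in H2; [|easy].
    replace (dl * ((K1 - K) / dl)) with (K1 - K) in H2 by (field; lra). lra.
Qed.

Lemma drift_absurd (T b dl C K : R) (s D f g : R -> R) :
  T < b -> 0 < dl ->
  (forall t, T < t < b -> is_derive s t (D t)) -> to_pinf b s ->
  (forall t, T < t < b -> is_derive f t (g t)) ->
  (forall t, T < t < b -> g t <= - dl * D t + C) ->
  (forall t, T < t < b -> K <= f t) -> False.
Proof.
  intros HT Hdl Hs Hinf Hf Hg HK.
  assert (H : to_pinf b (fun t => - f t)).
  { apply (to_pinf_of_drift T b dl C s D _ (fun t => - g t)); try assumption.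
    - intros t Ht. apply (is_derive_opp f t (g t)). now apply Hf.
    - intros t Ht. specialize (Hg t Ht). lra. }
  destruct (at_left_witness b T _ HT (proj1 (to_pinf_iff _ _) H (- K))) as [t [Ht H1]].
  specialize (HK t Ht). lra.
Qed.

(** If [f t1 < c], then at the last time before [t1] with [f >= c] continuity gives [f = c], and the
    positive derivative makes [f] exceed [c] just afterwards. The sign of the derivative is required
    only on the level itself. *)
Lemma barrier (T b c : R) (f g : R -> R) :
  (forall t, T < t < b -> is_derive f t (g t)) ->
  (forall t, T < t < b -> f t = c -> 0 < g t) ->
  forall t0 t1, T < t0 -> t0 <= t1 -> t1 < b -> c <= f t0 -> c <= f t1.
Proof.
  intros Hd Hg t0 t1 H0 H01 H1 Hc. apply Rnot_lt_le. intros Hlt.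
  destruct (completeness (fun x => t0 <= x <= t1 /\ c <= f x)) as [x [Hub Hlub]].
  { exists t1. intros y Hy. lra. }
  { exists t0. split; [lra|easy]. }
  assert (Hx0 : t0 <= x) by (apply Hub; split; [lra|easy]).
  assert (Hx1 : x <= t1) by (apply Hlub; intros y Hy; lra).
  assert (Hxb : T < x < b) by lra.
  assert (Hcont : continuous f x).
  { apply (ex_derive_continuous f x). exists (g x). now apply Hd. }
  assert (Hfx1 : c <= f x).
  { apply Rnot_lt_le. intros Hfx.
    assert (He : 0 < c - f x) by lra.
    destruct (proj1 (filterlim_locally f (f x)) Hcont (mkposreal _ He)) as [e H].
    assert (x <= x - e); [|destruct e; simpl in *; lra].
    apply Hlub. intros y [Hy1 Hy2]. apply Rnot_lt_le. intros Hy3.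
    assert (Hyx : y <= x) by (apply Hub; easy).
    assert (Hb : Rabs (f y - f x) < c - f x).
    { apply H. change (Rabs (y - x) < e). apply Rabs_def1; destruct e; simpl in *; lra. }
    apply Rabs_def2 in Hb. lra. }
  assert (Hxt : x < t1) by (destruct (Req_dec x t1) as [->|]; lra).
  assert (Hfx2 : f x <= c).
  { apply Rnot_lt_le. intros Hfx.
    assert (He : 0 < f x - c) by lra.
    destruct (proj1 (filterlim_locally f (f x)) Hcont (mkposreal _ He)) as [e H].
    set (y := Rmin (x + e / 2) t1).
    assert (Hy : x < y /\ y <= t1 /\ y < x + e).
    { unfold y. destruct e as [e He']; simpl.
      generalize (Rmin_l (x + e / 2) t1) (Rmin_r (x + e / 2) t1).
      assert (x < Rmin (x + e / 2) t1) by (apply Rmin_glb_lt; lra). lra. }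
    assert (Hb : Rabs (f y - f x) < f x - c).
    { apply H. change (Rabs (y - x) < e). apply Rabs_def1; destruct e; simpl in *; lra. }
    apply Rabs_def2 in Hb.
    assert (y <= x) by (apply Hub; split; lra). lra. }
  assert (Hgx : 0 < g x) by (apply Hg; lra).
  assert (HD := Hd x Hxb). apply is_derive_Reals in HD.
  destruct (HD (g x) Hgx) as [e H].
  set (h := Rmin (e / 2) (t1 - x)).
  assert (Hh : 0 < h /\ h <= t1 - x /\ h < e).
  { unfold h. destruct e as [e He]; simpl.
    generalize (Rmin_l (e / 2) (t1 - x)) (Rmin_r (e / 2) (t1 - x)).
    assert (0 < Rmin (e / 2) (t1 - x)) by (apply Rmin_glb_lt; lra). lra. }
  assert (Hh1 : Rabs ((f (x + h) - f x) / h - g x) < g x).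
  { apply H; [lra|]. rewrite Rabs_pos_eq; lra. }
  apply Rabs_def2 in Hh1. destruct Hh1 as [_ Hh1].
  assert (Hq : 0 < (f (x + h) - f x) / h) by lra.
  assert (Hq2 : 0 < f (x + h) - f x).
  { apply (Rmult_lt_compat_r h) in Hq; [|lra].
    unfold Rdiv in Hq. rewrite Rmult_assoc, Rinv_l in Hq by lra. lra. }
  assert (x + h <= x) by (apply Hub; split; lra). lra.
Qed.

Lemma barrier_opp (T b c : R) (f g : R -> R) :
  (forall t, T < t < b -> is_derive f t (g t)) ->
  (forall t, T < t < b -> f t = c -> g t < 0) ->
  forall t0 t1, T < t0 -> t0 <= t1 -> t1 < b -> f t0 <= c -> f t1 <= c.
Proof.
  intros Hd Hg t0 t1 H0 H01 H1 Hc.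
  assert (- c <= - f t1); [|lra].
  apply (barrier T b (- c) (fun t => - f t) (fun t => - g t)) with t0; try lra.
  - intros t Ht. apply (is_derive_opp f t (g t)). now apply Hd.
  - intros t Ht Hf. assert (g t < 0) by (apply Hg; lra). lra.
Qed.

(* If the limit does not exist, every level strictly between the lower and the upper
   limit is crossed in both directions arbitrarily late. *)
Lemma conv_of_one_way_levels (T b K1 K2 : R) (f g : R -> R) :
  T < b ->
  (forall t, T < t < b -> is_derive f t (g t)) ->
  (forall t, T < t < b -> K1 <= f t <= K2) ->
  (forall al be, al < be -> exists c, al < c < be /\
     (at_left b (fun t => f t = c -> 0 < g t) \/ at_left b (fun t => f t = c -> g t < 0))) ->
  exists l, conv b f l.
Proof.
  intros HT Hd HK Hlev.
  (* [l] is the lower limit of [f]. *)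
  destruct (completeness (fun c => at_left b (fun t => c <= f t))) as [l [Hub Hlub]].
  { exists K2. intros c Hc. destruct (at_left_witness b T _ HT Hc) as [t [Ht H]].
    specialize (HK t Ht). lra. }
  { exists K1. apply (at_left_intro b T); [easy|]. intros t Ht. now apply HK. }
  assert (Hlow : forall c, c < l -> at_left b (fun t => c <= f t)).
  { intros c Hc. apply NNPP. intros Hn. assert (l <= c); [|lra]. apply Hlub.
    intros c' Hc'. apply Rnot_lt_le. intros Hlt. apply Hn.
    revert Hc'. apply filter_imp. intros t Ht. lra. }
  destruct (classic (forall c, l < c -> at_left b (fun t => f t <= c))) as [Hup|Hup].
  - exists l. apply conv_iff. intros e He.
    assert (H1 : at_left b (fun t => l - e / 2 <= f t)) by (apply Hlow; lra).
    assert (H2 : at_left b (fun t => f t <= l + e / 2)) by (apply Hup; lra).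
    generalize (filter_and _ _ H1 H2). apply filter_imp. intros t Ht. apply Rabs_def1; lra.
  - exfalso. apply not_all_ex_not in Hup. destruct Hup as [be Hbe].
    apply imply_to_and in Hbe. destruct Hbe as [Hlb Hbe].
    destruct (Hlev l be Hlb) as [c [Hc Hsgn]].
    assert (Hc1 : ~ at_left b (fun t => c <= f t)).
    { intros H. assert (c <= l) by (now apply Hub). lra. }
    assert (Hc2 : ~ at_left b (fun t => f t <= c)).
    { intros H. apply Hbe. revert H. apply filter_imp. intros t Ht. lra. }
    destruct Hsgn as [Hs|Hs]; apply at_left_iff in Hs; destruct Hs as [T1 [HT1 Hs]].
    + destruct (not_at_left b (Rmax T T1) _ (Rmax_lub_lt _ _ _ HT HT1) Hc2) as [t0 [Ht0 Hn0]].
      assert (T <= Rmax T T1) by apply Rmax_l. assert (T1 <= Rmax T T1) by apply Rmax_r.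
      destruct (not_at_left b t0 _ (proj2 Ht0) Hc1) as [t1 [Ht1 Hn1]].
      apply Hn1. apply (barrier (Rmax T T1) b c f g) with t0; try lra.
      * intros t Ht. apply Hd. lra.
      * intros t Ht. apply Hs. lra.
    + destruct (not_at_left b (Rmax T T1) _ (Rmax_lub_lt _ _ _ HT HT1) Hc1) as [t0 [Ht0 Hn0]].
      assert (T <= Rmax T T1) by apply Rmax_l. assert (T1 <= Rmax T T1) by apply Rmax_r.
      destruct (not_at_left b t0 _ (proj2 Ht0) Hc2) as [t1 [Ht1 Hn1]].
      apply Hn1. apply (barrier_opp (Rmax T T1) b c f g) with t0; try lra.
      * intros t Ht. apply Hd. lra.
      * intros t Ht. apply Hs. lra.
Qed.

(** * Local existence and continuation *)

Lemma filter_forall_le {T : Type} (Fl : (T -> Prop) -> Prop) {FF : Filter Fl}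
  (N : nat) (P : nat -> T -> Prop) :
  (forall j, (j <= N)%nat -> Fl (P j)) -> Fl (fun s => forall j, (j <= N)%nat -> P j s).
Proof.
  induction N as [|N IH]; intros H.
  - generalize (H 0%nat (le_n _)). apply filter_imp. intros s Hs j Hj.
    now replace j with 0%nat by lia.
  - assert (H1 : Fl (fun s => forall j, (j <= N)%nat -> P j s)) by (apply IH; intros; apply H; lia).
    generalize (filter_and _ _ H1 (H (S N) (le_n _))). apply filter_imp.
    intros s [Hs1 Hs2] j Hj. destruct (Nat.eq_dec j (S N)) as [->|]; [easy|]. apply Hs1. lia.
Qed.

Lemma continuous_iff (f : R -> R) (x : R) :
  continuous f x <-> forall eps, 0 < eps -> locally x (fun t => Rabs (f t - f x) < eps).
Proof.
  unfold continuous. rewrite filterlim_locally. split.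
  - intros H e He. exact (H (mkposreal e He)).
  - intros H e. exact (H e (cond_pos e)).
Qed.

Lemma abs_RInt_0_le (g : R -> R) (t M : R) :
  (forall s, Rabs s <= Rabs t -> continuous g s) ->
  (forall s, Rabs s <= Rabs t -> Rabs (g s) <= M) ->
  Rabs (RInt g 0 t) <= M * Rabs t.
Proof.
  intros Hc Hb. destruct (Rle_dec 0 t) as [Ht|Ht].
  - rewrite (Rabs_pos_eq t) in * by easy.
    rewrite Rmult_comm. replace t with (t - 0) at 2 by ring.
    apply abs_RInt_le_const; [easy| |].
    + apply (ex_RInt_continuous g). intros s. rewrite Rmin_left, Rmax_right by easy.
      intros Hs. apply Hc. rewrite Rabs_pos_eq; lra.
    + intros s Hs. apply Hb. rewrite Rabs_pos_eq; lra.
  - rewrite (Rabs_left t) in * by lra.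
    assert (Hex : ex_RInt g t 0).
    { apply (ex_RInt_continuous g). intros s. rewrite Rmin_left, Rmax_right by lra.
      intros Hs. apply Hc. apply Rabs_le. lra. }
    rewrite <- (opp_RInt_swap g t 0 Hex). change (opp (RInt g t 0)) with (- RInt g t 0).
    rewrite Rabs_Ropp, Rmult_comm. replace (- t) with (0 - t) by ring.
    apply abs_RInt_le_const; [lra|easy|].
    intros s Hs. apply Hb. apply Rabs_le. lra.
Qed.

Lemma half_pow_small (c eps : R) : 0 < eps -> exists m, c * (1 / 2) ^ m < eps.
Proof.
  intros He. assert (Hc : 0 < Rabs c + 1) by (generalize (Rabs_pos c); lra).
  destruct (pow_lt_1_zero (1 / 2)) with (y := eps / (Rabs c + 1)) as [m Hm].
  - rewrite Rabs_pos_eq; lra.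
  - now apply Rdiv_lt_0_compat.
  - exists m. specialize (Hm m (le_n _)).
    assert (Hp : 0 < (1 / 2) ^ m) by (apply pow_lt; lra).
    rewrite Rabs_pos_eq in Hm by lra.
    apply (Rmult_lt_compat_l (Rabs c + 1)) in Hm; [|easy].
    replace ((Rabs c + 1) * (eps / (Rabs c + 1))) with eps in Hm by (field; lra).
    apply Rle_lt_trans with (2 := Hm). apply Rmult_le_compat_r; [lra|].
    generalize (Rle_abs c). lra.
Qed.

Lemma geometric_cauchy (u : nat -> R) (c : R) :
  (forall m, Rabs (u (S m) - u m) <= c * (1 / 2) ^ m) ->
  exists l, forall m, Rabs (l - u m) <= 2 * c * (1 / 2) ^ m.
Proof.
  intros H.
  (* Keeping the remaining tail of the geometric series on the right makes the induction on [p]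
     close. *)
  assert (Hp : forall m p, Rabs (u (m + p)%nat - u m) <= 2 * c * (1 / 2) ^ m - 2 * c * (1 / 2) ^ (m + p)).
  { intros m p. induction p as [|p IH].
    - rewrite Nat.add_0_r, 2!Rminus_diag, Rabs_R0. lra.
    - rewrite Nat.add_succ_r. specialize (H (m + p)%nat).
      replace (u (S (m + p)) - u m) with ((u (S (m + p)) - u (m + p)%nat) + (u (m + p)%nat - u m)) by ring.
      apply Rle_trans with (1 := Rabs_triang _ _). simpl. lra. }
  assert (Hc : 0 <= c).
  { specialize (H 0%nat). simpl in H. generalize (Rabs_pos (u 1%nat - u 0%nat)). lra. }
  assert (Hpos : forall m, 0 < (1 / 2) ^ m) by (intros; apply pow_lt; lra).
  assert (Hp2 : forall m p, Rabs (u (m + p)%nat - u m) <= 2 * c * (1 / 2) ^ m).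
  { intros m p. apply Rle_trans with (1 := Hp m p). specialize (Hpos (m + p)%nat).
    assert (0 <= 2 * c * (1 / 2) ^ (m + p)) by (apply Rmult_le_pos; lra). lra. }
  assert (Hex : ex_finite_lim_seq u).
  { apply ex_lim_seq_cauchy_corr. intros eps.
    destruct (half_pow_small (4 * c) eps (cond_pos eps)) as [m Hm]. exists m.
    intros p q Hmp Hmq.
    replace p with (m + (p - m))%nat by lia. replace q with (m + (q - m))%nat by lia.
    generalize (Hp2 m (p - m)%nat) (Hp2 m (q - m)%nat). intros E1 E2.
    apply Rabs_le_between in E1. apply Rabs_le_between in E2. apply Rabs_def1; lra. }
  destruct Hex as [l Hl]. exists l. intros m.
  assert (Hl2 : is_lim_seq (fun p => Rabs (u (p + m)%nat - u m)) (Rabs (l - u m))).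
  { apply (is_lim_seq_abs _ (l - u m)). apply is_lim_seq_minus'; [|apply is_lim_seq_const].
    now apply is_lim_seq_incr_n with (N := m) in Hl. }
  apply (is_lim_seq_le (fun p => Rabs (u (p + m)%nat - u m)) (fun _ => 2 * c * (1 / 2) ^ m) (Rabs (l - u m)) (2 * c * (1 / 2) ^ m)).
  - intros p. rewrite Nat.add_comm. apply Hp2.
  - easy.
  - apply is_lim_seq_const.
Qed.

Lemma continuous_field (N : nat) (F : nat -> (nat -> R) -> R) (L : R) (x : nat -> R -> R) (t : R) :
  0 < L ->
  (forall i x y d, (i <= N)%nat -> (forall j, (j <= N)%nat -> Rabs (x j - y j) <= d) ->
     Rabs (F i x - F i y) <= L * d) ->
  (forall i, (i <= N)%nat -> continuous (x i) t) ->
  forall i, (i <= N)%nat -> continuous (fun s => F i (fun j => x j s)) t.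
Proof.
  intros HL HF Hx i Hi. apply continuous_iff. intros e He.
  assert (He2 : 0 < e / (2 * L)) by (apply Rdiv_lt_0_compat; lra).
  assert (H := filter_forall_le (locally t) N (fun j s => Rabs (x j s - x j t) < e / (2 * L))).
  specialize (H (fun j Hj => proj1 (continuous_iff _ _) (Hx j Hj) _ He2)).
  revert H. apply filter_imp. intros s Hs.
  apply Rle_lt_trans with (L * (e / (2 * L))).
  - apply (HF i (fun j => x j s) (fun j => x j t) (e / (2 * L)) Hi). intros j Hj. left. now apply Hs.
  - replace (L * (e / (2 * L))) with (e / 2) by (field; lra). lra.
Qed.

Fixpoint picard (F : nat -> (nat -> R) -> R) (x0 : nat -> R) (m i : nat) (t : R) : R :=
  match m with
  | O => x0 i
  | S m => x0 i + RInt (fun s => F i (fun j => picard F x0 m j s)) 0 t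
  end.

Lemma is_derive_RInt_0 (g : R -> R) (t r : R) :
  Rabs t < r -> (forall s, Rabs s < r -> continuous g s) ->
  is_derive (fun t => RInt g 0 t) t (g t).
Proof.
  intros Ht Hg. apply (is_derive_RInt g (fun t => RInt g 0 t) 0 t); [|now apply Hg].
  assert (He : 0 < r - Rabs t) by lra.
  exists (mkposreal _ He). intros y Hy. change (Rabs (y - t) < r - Rabs t) in Hy.
  apply (RInt_correct g). apply (ex_RInt_continuous g). intros z Hz. apply Hg.
  assert (Hyr : Rabs y < r).
  { replace y with (y - t + t) by ring. generalize (Rabs_triang (y - t) t). lra. }
  apply Rle_lt_trans with (2 := Hyr).
  unfold Rmin, Rmax in Hz. destruct (Rle_dec 0 y).
  - rewrite 2!Rabs_pos_eq; lra.
  - rewrite 2!Rabs_left1; lra.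
Qed.

(** On |t| <= 1 / (2 L) the Picard map halves distances, so the iterates converge geometrically and
    the limit satisfies the integral equation. The displacement bound [K * Rabs t] serves the local
    version, where it shows that the solution does not leave the box. *)
Lemma cauchy_lipschitz_global (N : nat) (F : nat -> (nat -> R) -> R) (x0 : nat -> R) (K L : R) :
  0 <= K -> 1 <= L ->
  (forall i x, (i <= N)%nat -> Rabs (F i x) <= K) ->
  (forall i x y d, (i <= N)%nat -> (forall j, (j <= N)%nat -> Rabs (x j - y j) <= d) ->
     Rabs (F i x - F i y) <= L * d) ->
  exists (h : R) (X : nat -> R -> R), 0 < h /\
    forall i t, (i <= N)%nat -> Rabs t < h ->
      X i 0 = x0 i /\ Rabs (X i t - x0 i) <= K * Rabs t /\
      is_derive (X i) t (F i (fun j => X j t)).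
Proof.
  intros HK HL HFb HF. assert (HL0 : 0 < L) by lra.
  set (h := / (2 * L)). assert (Hh : 0 < h) by (apply Rinv_0_lt_compat; lra).
  assert (HLh : L * h = 1 / 2) by (unfold h; field; lra).
  assert (HKh : 0 <= K * h) by (apply Rmult_le_pos; lra).
  set (It := picard F x0).
  assert (Hcont : forall m i t, (i <= N)%nat -> continuous (It m i) t).
  { induction m as [|m IH]; intros i t Hi.
    - apply continuous_const.
    - apply (ex_derive_continuous (It (S m) i)). eexists. unfold It. simpl.
      apply (is_derive_plus (fun _ => x0 i)); [apply (is_derive_const (x0 i))|].
      apply (is_derive_RInt_0 _ t (Rabs t + 1)); [lra|].
      intros s _. apply (continuous_field N F L (It m)); try easy. intros j Hj. now apply IH. }
  assert (HcontF : forall m i t, (i <= N)%nat -> continuous (fun s => F i (fun j => It m j s)) t).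
  { intros m i t Hi. apply (continuous_field N F L); try easy. intros j Hj. now apply Hcont. }
  assert (HexF : forall m i t, (i <= N)%nat -> ex_RInt (fun s => F i (fun j => It m j s)) 0 t).
  { intros m i t Hi. apply (ex_RInt_continuous (fun s => F i (fun j => It m j s))).
    intros s _. now apply HcontF. }
  assert (Hstep : forall m i t, (i <= N)%nat -> Rabs t <= h ->
     Rabs (It (S m) i t - It m i t) <= K * h * (1 / 2) ^ m).
  { induction m as [|m IH]; intros i t Hi Ht.
    - simpl. unfold It; simpl. rewrite Rmult_1_r.
      rewrite Rplus_minus_l.
      apply Rle_trans with (K * Rabs t); [|apply Rmult_le_compat_l; easy].
      apply abs_RInt_0_le; [intros; apply continuous_const|]. intros s _. now apply HFb.
    - change (It (S (S m)) i t) with (x0 i + RInt (fun s => F i (fun j => It (S m) j s)) 0 t).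
      change (It (S m) i t) with (x0 i + RInt (fun s => F i (fun j => It m j s)) 0 t).
      replace (_ - _) with (RInt (fun s => F i (fun j => It (S m) j s)) 0 t -
        RInt (fun s => F i (fun j => It m j s)) 0 t) by ring.
      rewrite <- (RInt_minus (fun s => F i (fun j => It (S m) j s)) (fun s => F i (fun j => It m j s)))
        by now apply HexF.
      apply Rle_trans with (L * (K * h * (1 / 2) ^ m) * Rabs t).
      + apply abs_RInt_0_le.
        * intros s _. apply (continuous_minus (fun s => F i (fun j => It (S m) j s))); now apply HcontF.
        * intros s Hs. apply HF; [easy|]. intros j Hj. apply IH; [easy|lra].
      + assert (0 <= L * (K * h * (1 / 2) ^ m)).
        { apply Rmult_le_pos; [lra|]. apply Rmult_le_pos; [easy|]. left. apply pow_lt. lra. }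
        apply Rle_trans with (L * (K * h * (1 / 2) ^ m) * h); [now apply Rmult_le_compat_l|].
        right. replace (L * (K * h * (1 / 2) ^ m) * h) with (L * h * (K * h * (1 / 2) ^ m)) by ring.
        rewrite HLh. simpl. ring. }
  set (X := fun i t => real (Lim_seq (fun m => It m i t))).
  set (c := 2 * (K * h)). assert (Hc0 : 0 <= c) by (unfold c; lra).
  assert (HX : forall i t, (i <= N)%nat -> Rabs t <= h ->
     forall m, Rabs (X i t - It m i t) <= c * (1 / 2) ^ m).
  { intros i t Hi Ht.
    destruct (geometric_cauchy (fun m => It m i t) (K * h)) as [l Hl].
    { intros m. now apply Hstep. }
    assert (HlX : X i t = l); [|rewrite HlX; exact Hl].
    unfold X. rewrite (is_lim_seq_unique _ l); [easy|].
    apply is_lim_seq_spec. intros eps.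
    destruct (half_pow_small c eps (cond_pos eps)) as [m Hm]. exists m. intros p Hp.
    rewrite Rabs_minus_sym. apply Rle_lt_trans with (1 := Hl p).
    apply Rle_lt_trans with (2 := Hm). apply Rmult_le_compat_l; [easy|].
    replace p with (m + (p - m))%nat by lia. rewrite pow_add.
    assert (0 < (1 / 2) ^ m) by (apply pow_lt; lra).
    assert ((1 / 2) ^ (p - m) <= 1).
    { apply Rle_trans with (1 ^ (p - m)); [apply pow_incr; lra|rewrite pow1; lra]. }
    rewrite <- (Rmult_1_r ((1 / 2) ^ m)) at 2. apply Rmult_le_compat_l; lra. }
  assert (Hnear : forall t, Rabs t < h -> locally t (fun s => Rabs s < h)).
  { intros t Ht. assert (He : 0 < h - Rabs t) by lra. exists (mkposreal _ He). intros y Hy.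
    change (Rabs (y - t) < h - Rabs t) in Hy.
    replace y with (y - t + t) by ring. generalize (Rabs_triang (y - t) t). lra. }
  assert (HXc : forall i t, (i <= N)%nat -> Rabs t < h -> continuous (X i) t).
  { intros i t Hi Ht. apply continuous_iff. intros e He.
    destruct (half_pow_small c (e / 3)) as [m Hm]; [lra|].
    assert (He3 : 0 < e / 3) by lra.
    generalize (filter_and _ _ (Hnear t Ht) (proj1 (continuous_iff _ _) (Hcont m i t Hi) _ He3)).
    apply filter_imp. intros s [Hs1 Hs2].
    assert (Hs1' : Rabs s <= h) by lra. assert (Ht' : Rabs t <= h) by lra.
    generalize (HX i s Hi Hs1' m) (HX i t Hi Ht' m). intros E1 E2.
    apply Rabs_le_between in E1. apply Rabs_le_between in E2. apply Rabs_def2 in Hs2.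
    apply Rabs_def1; lra. }
  assert (HXF : forall i t, (i <= N)%nat -> Rabs t < h ->
     continuous (fun s => F i (fun j => X j s)) t).
  { intros i t Hi Ht. apply (continuous_field N F L); try easy. intros j Hj. now apply HXc. }
  assert (Hint : forall i t, (i <= N)%nat -> Rabs t < h ->
     X i t = x0 i + RInt (fun s => F i (fun j => X j s)) 0 t).
  (* An exact identity from approximations: a nonzero defect would be at most [2 * c * (1 / 2) ^ m]
     for every [m]. *)
  { intros i t Hi Ht. apply Rminus_diag_uniq. apply NNPP. intros Hne.
    apply Rabs_pos_lt in Hne.
    destruct (half_pow_small (2 * c) _ Hne) as [m Hm]. revert Hm. apply Rle_not_lt.
    assert (Ht' : Rabs t <= h) by lra.
    replace (X i t - (x0 i + RInt (fun s => F i (fun j => X j s)) 0 t)) with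
      ((X i t - It (S m) i t) + (RInt (fun s => F i (fun j => It m j s)) 0 t -
        RInt (fun s => F i (fun j => X j s)) 0 t)) by (unfold It; simpl; ring).
    assert (HexX : ex_RInt (fun s => F i (fun j => X j s)) 0 t).
    { apply (ex_RInt_continuous (fun s => F i (fun j => X j s))). intros s Hs. apply HXF; [easy|].
      apply Rle_lt_trans with (2 := Ht). unfold Rmin, Rmax in Hs. destruct (Rle_dec 0 t).
      - rewrite 2!Rabs_pos_eq; lra.
      - rewrite 2!Rabs_left1; lra. }
    rewrite <- (RInt_minus (fun s => F i (fun j => It m j s)) (fun s => F i (fun j => X j s)));
      [|now apply HexF|exact HexX].
    apply Rle_trans with (1 := Rabs_triang _ _).
    assert (Hpm : 0 < (1 / 2) ^ m) by (apply pow_lt; lra).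
    assert (E1 := HX i t Hi Ht' (S m)). rewrite <- tech_pow_Rmult in E1.
    assert (E2 : Rabs (RInt (fun s => minus (F i (fun j => It m j s)) (F i (fun j => X j s))) 0 t)
      <= L * (c * (1 / 2) ^ m) * Rabs t).
    { apply abs_RInt_0_le.
      - intros s Hs. apply (continuous_minus (fun s => F i (fun j => It m j s))); [now apply HcontF|].
        apply HXF; [easy|lra].
      - intros s Hs. apply HF; [easy|]. intros j Hj. rewrite Rabs_minus_sym. apply HX; [easy|lra]. }
    assert (E3 : L * (c * (1 / 2) ^ m) * Rabs t <= c * (1 / 2) ^ m).
    { assert (0 <= c * (1 / 2) ^ m) by (apply Rmult_le_pos; lra).
      assert (L * Rabs t <= 1) by (apply Rle_trans with (L * h); [apply Rmult_le_compat_l|]; lra).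
      replace (L * (c * (1 / 2) ^ m) * Rabs t) with (L * Rabs t * (c * (1 / 2) ^ m)) by ring.
      rewrite <- (Rmult_1_l (c * (1 / 2) ^ m)) at 2. now apply Rmult_le_compat_r. }
    assert (0 <= c * (1 / 2) ^ m) by (apply Rmult_le_pos; lra).
    apply Rle_trans with (c * (1 / 2 * (1 / 2) ^ m) + c * (1 / 2) ^ m); [|lra].
    apply Rplus_le_compat; [exact E1|]. now apply Rle_trans with (1 := E2). }
  exists h, X. split; [easy|]. intros i t Hi Ht. split; [|split].
  - rewrite (Hint i 0 Hi) by (now rewrite Rabs_R0).
    rewrite RInt_point. apply Rplus_0_r.
  - rewrite (Hint i t Hi Ht).
    rewrite Rplus_minus_l.
    apply abs_RInt_0_le; intros s Hs; [apply HXF; [easy|lra]|now apply HFb].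
  - apply is_derive_ext_loc with (fun t => x0 i + RInt (fun s => F i (fun j => X j s)) 0 t).
    + generalize (Hnear t Ht). apply filter_imp. intros s Hs. symmetry. now apply Hint.
    + apply is_derive_eq with (0 + F i (fun j => X j t)); [|ring].
      apply (is_derive_Rplus (fun _ => x0 i) (fun t => RInt (fun s => F i (fun j => X j s)) 0 t));
        [apply (is_derive_const (x0 i))|].
      apply (is_derive_RInt_0 (fun s => F i (fun j => X j s)) t h Ht). intros s Hs. now apply HXF.
Qed.

(* Clamping to the box reduces to a globally bounded Lipschitz field. *)
Lemma cauchy_lipschitz_local (N : nat) (F : nat -> (nat -> R) -> R) (x0 : nat -> R) (K L : R) :
  0 <= K -> 1 <= L ->
  (forall i x, (i <= N)%nat -> (forall j, (j <= N)%nat -> Rabs (x j - x0 j) <= 1) ->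
     Rabs (F i x) <= K) ->
  (forall i x y d, (i <= N)%nat ->
     (forall j, (j <= N)%nat -> Rabs (x j - x0 j) <= 1) ->
     (forall j, (j <= N)%nat -> Rabs (y j - x0 j) <= 1) ->
     (forall j, (j <= N)%nat -> Rabs (x j - y j) <= d) ->
     Rabs (F i x - F i y) <= L * d) ->
  exists (h : R) (X : nat -> R -> R), 0 < h /\
    forall i t, (i <= N)%nat -> Rabs t < h ->
      X i 0 = x0 i /\ is_derive (X i) t (F i (fun j => X j t)).
Proof.
  intros HK HL HFb HF.
  set (cl := fun (x : nat -> R) j => Rmax (x0 j - 1) (Rmin (x0 j + 1) (x j))).
  assert (Hbox : forall x j, Rabs (cl x j - x0 j) <= 1).
  { intros x j. apply Rabs_le. unfold cl, Rmax, Rmin. repeat destruct Rle_dec; lra. }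
  assert (Hlip : forall x y j, Rabs (cl x j - cl y j) <= Rabs (x j - y j)).
  { intros x y j. unfold cl, Rmax, Rmin. repeat destruct Rle_dec; unfold Rabs;
      repeat destruct Rcase_abs; lra. }
  assert (Hid : forall x j, Rabs (x j - x0 j) <= 1 -> cl x j = x j).
  { intros x j Hx. apply Rabs_le_between in Hx. unfold cl, Rmax, Rmin.
    repeat destruct Rle_dec; lra. }
  destruct (cauchy_lipschitz_global N (fun i x => F i (cl x)) x0 K L HK HL) as [h [X [Hh HX]]].
  - intros i x Hi. now apply HFb.
  - intros i x y d Hi Hd. apply HF; try easy. intros j Hj.
    apply Rle_trans with (1 := Hlip x y j). now apply Hd.
  (* A speed of at most [K] during a time below [1 / (K + 1)] moves each coordinate by less than 1,
     so the clamp is never active. *)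
  - exists (Rmin h (/ (K + 1))), X.
    assert (HK1 : 0 < / (K + 1)) by (apply Rinv_0_lt_compat; lra).
    split; [now apply Rmin_glb_lt|]. intros i t Hi Ht.
    assert (Hth : Rabs t < h) by (apply Rlt_le_trans with (1 := Ht), Rmin_l).
    assert (HtK : Rabs t < / (K + 1)) by (apply Rlt_le_trans with (1 := Ht), Rmin_r).
    destruct (HX i t Hi Hth) as [H1 [_ H3]]. split; [easy|].
    apply is_derive_eq with (1 := H3).
    assert (Hcl : forall j, (j <= N)%nat -> Rabs (X j t - x0 j) <= 1).
    { intros j Hj. destruct (HX j t Hj Hth) as [_ [H2 _]].
      apply Rle_trans with (1 := H2). apply Rle_trans with (K * / (K + 1)).
      - apply Rmult_le_compat_l; lra.
      - apply Rmult_le_reg_r with (K + 1); [lra|]. rewrite Rmult_assoc, Rinv_l; lra. }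
    (* The clamped and the unclamped state agree only on the coordinates up to [N]; equality of the
       values of [F] is the Lipschitz bound with [d = 0]. *)
    apply Rminus_diag_uniq. apply NNPP. intros Hne. apply Rabs_pos_lt in Hne.
    revert Hne. apply Rle_not_lt. rewrite <- (Rmult_0_r L).
    apply HF; try easy. intros j Hj.
    rewrite (Hid (fun j => X j t)) by now apply Hcl. rewrite Rminus_diag, Rabs_R0. lra.
Qed.

(** * Finite sums, the REP vector field and continuation of bounded solutions *)

Lemma sum_n_m_le_loc (x y : nat -> R) (n : nat) :
  (forall j, (1 <= j <= n)%nat -> x j <= y j) -> sum_n_m x 1 n <= sum_n_m y 1 n.
Proof.
  induction n as [|n IH]; intros H.
  - rewrite 2!sum_n_m_zero by lia. lra.
  - rewrite 2!sum_n_Sm by lia. apply Rplus_le_compat; [apply IH; intros; apply H; lia|apply H; lia].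
Qed.

Lemma sum_n_m_const_1 (n : nat) (c : R) : sum_n_m (fun _ => c) 1 n = INR n * c.
Proof. rewrite sum_n_m_const. f_equal. f_equal. lia. Qed.

Lemma sum_n_m_dist (x y : nat -> R) (n : nat) (d : R) :
  (forall j, (1 <= j <= n)%nat -> Rabs (x j - y j) <= d) ->
  Rabs (sum_n_m x 1 n - sum_n_m y 1 n) <= INR n * d.
Proof.
  induction n as [|n IH]; intros H.
  - rewrite 2!sum_n_m_zero by lia. rewrite Rminus_diag, Rabs_R0. simpl. lra.
  - rewrite 2!sum_n_Sm by lia. rewrite S_INR. change plus with Rplus.
    replace (sum_n_m x 1 n + x (S n) - (sum_n_m y 1 n + y (S n))) with
      ((sum_n_m x 1 n - sum_n_m y 1 n) + (x (S n) - y (S n))) by ring.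
    apply Rle_trans with (1 := Rabs_triang _ _).
    assert (H1 := H (S n) ltac:(lia)). assert (H2 := IH (fun j Hj => H j ltac:(lia))). lra.
Qed.

Lemma sum_n_m_abs_le (x : nat -> R) (n : nat) (d : R) :
  (forall j, (1 <= j <= n)%nat -> Rabs (x j) <= d) -> Rabs (sum_n_m x 1 n) <= INR n * d.
Proof.
  intros H. replace (sum_n_m x 1 n) with (sum_n_m x 1 n - sum_n_m (fun _ => 0) 1 n).
  - apply sum_n_m_dist. intros j Hj. rewrite Rminus_0_r. now apply H.
  - rewrite sum_n_m_const_1. ring.
Qed.

Lemma continuous_sum_n_m (x : nat -> R -> R) (n : nat) (t : R) :
  (forall j, (1 <= j <= n)%nat -> continuous (x j) t) ->
  continuous (fun s => sum_n_m (fun j => x j s) 1 n) t.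
Proof.
  induction n as [|n IH]; intros H.
  - apply continuous_ext with (fun _ => 0).
    + intros s. now rewrite sum_n_m_zero by lia.
    + apply continuous_const.
  - apply continuous_ext with (fun s => sum_n_m (fun j => x j s) 1 n + x (S n) s).
    + intros s. now rewrite sum_n_Sm by lia.
    + apply (continuous_plus (fun s => sum_n_m (fun j => x j s) 1 n)).
      * apply IH. intros j Hj. apply H. lia.
      * apply H. lia.
Qed.

Lemma finite_choice (n : nat) (P : nat -> R -> Prop) :
  (forall i, (i <= n)%nat -> exists l, P i l) -> exists f, forall i, (i <= n)%nat -> P i (f i).
Proof.
  induction n as [|n IH]; intros H.
  - destruct (H 0%nat (le_n _)) as [l Hl]. exists (fun _ => l). intros i Hi.
    now replace i with 0%nat by lia.
  - destruct IH as [f Hf]; [intros; apply H; lia|]. destruct (H (S n) (le_n _)) as [l Hl].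
    exists (fun i => if Nat.eq_dec i (S n) then l else f i). intros i Hi.
    destruct (Nat.eq_dec i (S n)) as [->|]; [easy|]. apply Hf. lia.
Qed.

(** By the mean value theorem each difference quotient at [c] is a value of [g] at an intermediate
    point, and tends to [g c] by continuity. This supplies the derivative at the time where two
    solutions are glued. *)
Lemma is_derive_fill (f g : R -> R) (a c b : R) :
  a < c < b -> continuous f c -> continuous g c ->
  (forall t, a < t < b -> t <> c -> is_derive f t (g t)) -> is_derive f c (g c).
Proof.
  intros Hc Hf Hg Hd. apply is_derive_Reals. intros e He.
  destruct (proj1 (continuous_iff g c) Hg e He) as [d Hd2].
  set (r := Rmin d (Rmin (c - a) (b - c))).
  assert (Hr : 0 < r) by (unfold r; repeat apply Rmin_glb_lt; try lra; apply cond_pos).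
  assert (Hr1 : r <= d) by apply Rmin_l.
  assert (Hr2 : r <= c - a) by (eapply Rle_trans; [apply Rmin_r|apply Rmin_l]).
  assert (Hr3 : r <= b - c) by (eapply Rle_trans; [apply Rmin_r|apply Rmin_r]).
  exists (mkposreal r Hr). intros u Hu0 Hu. simpl in Hu.
  apply Rabs_def2 in Hu.
  destruct (MVT_gen f c (c + u) g) as [x [Hx Heq]].
  - intros x Hx. apply Hd; unfold Rmin, Rmax in Hx; destruct (Rle_dec c (c + u)); lra.
  - intros x Hx. destruct (Req_dec x c) as [->|Hne].
    + now apply continuity_pt_filterlim.
    + apply (is_derive_cont_pt f x (g x)).
      apply Hd; unfold Rmin, Rmax in Hx; destruct (Rle_dec c (c + u)); lra.
  - rewrite Heq. replace (g x * (c + u - c) / u - g c) with (g x - g c) by (field; easy).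
    apply Hd2. change (Rabs (x - c) < d).
    unfold Rmin, Rmax in Hx. apply Rabs_def1; destruct (Rle_dec c (c + u)); lra.
Qed.

(* The state is the vector (rho, lam_1, ..., lam_n), indexed from 0. *)
Definition rep_field (n : nat) (k cb : R) (i : nat) (x : nat -> R) : R :=
  match i with
  | O => - x 0%nat * sum_n_m x 1 n
  | S _ => - x i ^ 2 + k / INR n * (x 0%nat - cb)
  end.

Lemma rep_field_bound (n : nat) (k cb B : R) (i : nat) (x : nat -> R) :
  0 <= B -> (i <= n)%nat -> (forall j, (j <= n)%nat -> Rabs (x j) <= B) ->
  Rabs (rep_field n k cb i x) <= B * (INR n * B) + B ^ 2 + Rabs (k / INR n) * (B + Rabs cb).
Proof.
  intros HB Hi Hx.
  assert (H0 := Hx 0%nat ltac:(lia)).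
  assert (P1 : 0 <= Rabs (k / INR n) * (B + Rabs cb)).
  { apply Rmult_le_pos; [apply Rabs_pos|]. generalize (Rabs_pos cb). lra. }
  assert (P2 : 0 <= B * (INR n * B)) by (apply Rmult_le_pos, Rmult_le_pos; [|apply pos_INR|]; lra).
  destruct i as [|i]; simpl rep_field.
  - assert (H1 : Rabs (sum_n_m x 1 n) <= INR n * B).
    { apply sum_n_m_abs_le. intros j Hj. apply Hx. lia. }
    rewrite Rabs_mult, Rabs_Ropp. generalize (pow2_ge_0 B). intros P3.
    assert (Rabs (x 0%nat) * Rabs (sum_n_m x 1 n) <= B * (INR n * B)); [|lra].
    apply Rmult_le_compat; try apply Rabs_pos; easy.
  - apply Rle_trans with (1 := Rabs_triang _ _). rewrite Rabs_Ropp, (Rabs_mult (k / INR n)).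
    change (x (S i) * (x (S i) * 1)) with (x (S i) ^ 2).
    rewrite <- (RPow_abs (x (S i)) 2).
    assert (Rabs (x (S i)) ^ 2 <= B ^ 2) by (apply pow_incr; split; [apply Rabs_pos|now apply Hx]).
    assert (Rabs (x 0%nat - cb) <= B + Rabs cb).
    { apply Rle_trans with (1 := Rabs_triang _ _). rewrite Rabs_Ropp. lra. }
    assert (Rabs (k / INR n) * Rabs (x 0%nat - cb) <= Rabs (k / INR n) * (B + Rabs cb)); [|lra].
    apply Rmult_le_compat_l; [apply Rabs_pos|easy].
Qed.

Lemma rep_field_lip (n : nat) (k cb B d : R) (i : nat) (x y : nat -> R) :
  0 <= B -> (i <= n)%nat ->
  (forall j, (j <= n)%nat -> Rabs (x j) <= B) ->
  (forall j, (j <= n)%nat -> Rabs (y j) <= B) ->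
  (forall j, (j <= n)%nat -> Rabs (x j - y j) <= d) ->
  Rabs (rep_field n k cb i x - rep_field n k cb i y)
    <= (1 + 2 * INR n * B + 2 * B + Rabs (k / INR n)) * d.
Proof.
  intros HB Hi Hx Hy Hd.
  assert (Hx0 := Hx 0%nat ltac:(lia)). assert (Hy0 := Hy 0%nat ltac:(lia)).
  assert (Hd0 := Hd 0%nat ltac:(lia)).
  assert (P0 : 0 <= d) by (generalize (Rabs_pos (x 0%nat - y 0%nat)); lra).
  assert (P1 := Rabs_pos (k / INR n)). assert (P2 := pos_INR n).
  assert (P3 : 0 <= INR n * B) by now apply Rmult_le_pos.
  assert (P4 : 0 <= Rabs (k / INR n) * d) by now apply Rmult_le_pos.
  assert (P5 : 0 <= B * d) by now apply Rmult_le_pos.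
  assert (P6 : 0 <= INR n * B * d) by now apply Rmult_le_pos.
  destruct i as [|i]; simpl rep_field.
  - assert (H1 : Rabs (sum_n_m x 1 n) <= INR n * B).
    { apply sum_n_m_abs_le. intros j Hj. apply Hx. lia. }
    assert (H2 : Rabs (sum_n_m x 1 n - sum_n_m y 1 n) <= INR n * d).
    { apply sum_n_m_dist. intros j Hj. apply Hd. lia. }
    replace (- x 0%nat * sum_n_m x 1 n - - y 0%nat * sum_n_m y 1 n) with
      (- ((x 0%nat - y 0%nat) * sum_n_m x 1 n + y 0%nat * (sum_n_m x 1 n - sum_n_m y 1 n))) by ring.
    rewrite Rabs_Ropp. apply Rle_trans with (1 := Rabs_triang _ _). rewrite 2!Rabs_mult.
    assert (Rabs (x 0%nat - y 0%nat) * Rabs (sum_n_m x 1 n) <= d * (INR n * B))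
      by (apply Rmult_le_compat; try apply Rabs_pos; easy).
    assert (Rabs (y 0%nat) * Rabs (sum_n_m x 1 n - sum_n_m y 1 n) <= B * (INR n * d))
      by (apply Rmult_le_compat; try apply Rabs_pos; easy).
    lra.
  - assert (HxS := Hx _ Hi). assert (HyS := Hy _ Hi). assert (HdS := Hd _ Hi).
    replace (_ - _) with ((- (x (S i) + y (S i))) * (x (S i) - y (S i)) +
      k / INR n * (x 0%nat - y 0%nat)) by ring.
    apply Rle_trans with (1 := Rabs_triang _ _). rewrite 2!Rabs_mult, Rabs_Ropp.
    assert (Rabs (x (S i) + y (S i)) * Rabs (x (S i) - y (S i)) <= (2 * B) * d).
    { apply Rmult_le_compat; try apply Rabs_pos; try easy.
      apply Rle_trans with (1 := Rabs_triang _ _). lra. }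
    assert (Rabs (k / INR n) * Rabs (x 0%nat - y 0%nat) <= Rabs (k / INR n) * d)
      by (apply Rmult_le_compat_l; easy).
    lra.
Qed.

Lemma continuous_rep_field (n : nat) (k cb : R) (i : nat) (x : nat -> R -> R) (t : R) :
  (i <= n)%nat -> (forall j, (j <= n)%nat -> continuous (x j) t) ->
  continuous (fun s => rep_field n k cb i (fun j => x j s)) t.
Proof.
  intros Hi Hx. destruct i as [|i]; simpl rep_field.
  - apply (continuous_mult (fun s => - x 0%nat s)).
    + apply (continuous_opp (x 0%nat)). apply Hx. lia.
    + apply continuous_sum_n_m. intros j Hj. apply Hx. lia.
  - apply (continuous_plus (fun s => - x (S i) s ^ 2)).
    + apply (continuous_opp (fun s => x (S i) s ^ 2)).
      apply (continuous_mult (x (S i))); [now apply Hx|].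
      apply (continuous_mult (x (S i))); [now apply Hx|]. apply continuous_const.
    + apply (continuous_mult (fun _ => k / INR n)); [apply continuous_const|].
      apply (continuous_minus (x 0%nat)); [apply Hx; lia|apply continuous_const].
Qed.

(** A bounded solution has bounded derivatives, hence a limit vector at [T]; the local solution
    started from it, shifted by [T], is glued on. Both pieces solve the system away from [T], and at
    [T] the equation follows from the continuity of the glued function and of the field. *)
Lemma bounded_solution_extends (n : nat) (k cb rho0 T K : R) (lam0 : nat -> R)
  (lam : nat -> R -> R) (rho : R -> R) :
  0 < T -> 0 <= K ->
  REP_solution n k cb rho0 lam0 T lam rho ->
  at_left T (fun t => Rabs (rho t) <= K /\
                      forall i, (1 <= i <= n)%nat -> Rabs (lam i t) <= K) ->
  exists (T' : R) (mu : nat -> R -> R) (sigma : R -> R),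
    T < T' /\ REP_solution n k cb rho0 lam0 T' mu sigma /\
    (forall t, 0 <= t < T -> sigma t = rho t /\ forall i, (1 <= i <= n)%nat -> mu i t = lam i t).
Proof.
  intros HT HK [S1 [S2 [S3 [S4 S5]]]] Hb.
  set (y := fun i => match i with O => rho | S _ => lam i end).
  assert (Hy : forall i t, (i <= n)%nat -> 0 < t < T ->
    is_derive (y i) t (rep_field n k cb i (fun j => y j t))).
  { intros i t Hi Ht. destruct (S5 t Ht) as [D1 D2]. destruct i as [|i].
    - simpl. replace (sum_n_m (fun j => y j t) 1 n) with (lam_sum n lam t); [easy|].
      apply sum_n_m_ext_loc. intros [|j] Hj; [lia|easy].
    - simpl rep_field. apply D1. lia. }
  apply at_left_iff in Hb. destruct Hb as [T0 [HT0 Hb]].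
  set (T1 := Rmax 0 T0).
  assert (HT1 : 0 <= T1 /\ T0 <= T1 /\ T1 < T).
  { unfold T1. split; [apply Rmax_l|]. split; [apply Rmax_r|]. now apply Rmax_lub_lt. }
  assert (Hyb : forall i t, (i <= n)%nat -> T1 < t < T -> Rabs (y i t) <= K).
  { intros i t Hi Ht. destruct (Hb t) as [B1 B2]; [lra|].
    destruct i as [|i]; [easy|]. apply B2. lia. }
  set (C := K * (INR n * K) + K ^ 2 + Rabs (k / INR n) * (K + Rabs cb)).
  assert (Hlim : forall i, (i <= n)%nat -> exists l, conv T (y i) l).
  { intros i Hi.
    apply (drift_conv T1 T K C (y i) (fun t => rep_field n k cb i (fun j => y j t))); [lra| | |].
    - intros t Ht. apply Hy; [easy|lra].
    - intros t Ht. assert (E : Rabs (rep_field n k cb i (fun j => y j t)) <= C).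
      { apply rep_field_bound; try easy. intros j Hj. now apply Hyb. }
      now apply Rabs_le_between in E.
    - intros t Ht. apply Rle_trans with (1 := Rle_abs _). now apply Hyb. }
  destruct (finite_choice n _ Hlim) as [x0 Hx0]. clear Hlim.
  assert (Hx0b : forall i, (i <= n)%nat -> Rabs (x0 i) <= K).
  { intros i Hi. apply Rabs_le. split.
    - apply (conv_ge T (y i) _ _ (Hx0 i Hi)). apply (at_left_intro T T1); [easy|].
      intros t Ht. assert (E := Hyb i t Hi Ht). now apply Rabs_le_between in E.
    - apply (conv_le T (y i) _ _ (Hx0 i Hi)). apply (at_left_intro T T1); [easy|].
      intros t Ht. assert (E := Hyb i t Hi Ht). now apply Rabs_le_between in E. }
  assert (Hbox : forall x : nat -> R, (forall j, (j <= n)%nat -> Rabs (x j - x0 j) <= 1) ->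
    forall j, (j <= n)%nat -> Rabs (x j) <= K + 1).
  { intros x Hx j Hj. replace (x j) with (x j - x0 j + x0 j) by ring.
    apply Rle_trans with (1 := Rabs_triang _ _). generalize (Hx j Hj) (Hx0b j Hj). lra. }
  assert (HK1 : 0 <= K + 1) by lra.
  (* The limit vector is bounded by [K], so the unit box around it lies in the cube of half-width
     [K + 1]; the two constants are those of [rep_field_bound] and [rep_field_lip] for
     [B = K + 1]. *)
  destruct (cauchy_lipschitz_local n (rep_field n k cb) x0
    ((K + 1) * (INR n * (K + 1)) + (K + 1) ^ 2 + Rabs (k / INR n) * (K + 1 + Rabs cb))
    (1 + 2 * INR n * (K + 1) + 2 * (K + 1) + Rabs (k / INR n))) as [h [X [Hh HX]]].
  { generalize (pow2_ge_0 (K + 1)). intros Q1.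
    assert (0 <= (K + 1) * (INR n * (K + 1)))
      by (apply Rmult_le_pos, Rmult_le_pos; [|apply pos_INR|]; lra).
    assert (0 <= Rabs (k / INR n) * (K + 1 + Rabs cb)).
    { apply Rmult_le_pos; [apply Rabs_pos|]. generalize (Rabs_pos cb). lra. }
    lra. }
  { assert (0 <= 2 * INR n * (K + 1)).
    { apply Rmult_le_pos; [|easy]. generalize (pos_INR n). lra. }
    generalize (Rabs_pos (k / INR n)). lra. }
  { intros i x Hi Hx. apply rep_field_bound; try easy. now apply Hbox. }
  { intros i x y' d Hi Hx Hy' Hd. apply rep_field_lip; try easy; now apply Hbox. }
  set (z := fun i t => if Rlt_dec t T then y i t else X i (t - T)).
  assert (Hzl : forall i t, t < T -> z i t = y i t).
  { intros i t Ht. unfold z. destruct (Rlt_dec t T); [easy|lra]. }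
  assert (Hzr : forall i t, T <= t -> z i t = X i (t - T)).
  { intros i t Ht. unfold z. destruct (Rlt_dec t T); [lra|easy]. }
  assert (HzT : forall i, (i <= n)%nat -> z i T = x0 i).
  { intros i Hi. rewrite Hzr by lra. rewrite Rminus_diag.
    apply (HX i 0 Hi). now rewrite Rabs_R0. }
  assert (Hzc : forall i, (i <= n)%nat -> continuous (z i) T).
  { intros i Hi. apply continuous_iff. intros e He. rewrite (HzT i Hi).
    destruct (proj1 (at_left_iff _ _) (proj1 (conv_iff _ _ _) (Hx0 i Hi) e He)) as [T2 [HT2 H2]].
    assert (HXc : continuous (X i) 0).
    { apply (ex_derive_continuous (X i)). eexists. apply (HX i 0 Hi). now rewrite Rabs_R0. }
    destruct (proj1 (continuous_iff _ _) HXc e He) as [d Hd].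
    assert (HX0 : X i 0 = x0 i) by (apply (HX i 0 Hi); now rewrite Rabs_R0).
    assert (Hr : 0 < Rmin d (T - T2)) by (apply Rmin_glb_lt; [apply cond_pos|lra]).
    exists (mkposreal _ Hr). intros t Ht. change (Rabs (t - T) < Rmin d (T - T2)) in Ht.
    assert (Ht1 : Rabs (t - T) < d) by (apply Rlt_le_trans with (1 := Ht), Rmin_l).
    assert (Ht2 : Rabs (t - T) < T - T2) by (apply Rlt_le_trans with (1 := Ht), Rmin_r).
    destruct (Rlt_dec t T) as [Hlt|Hge].
    - rewrite Hzl by easy. apply H2. apply Rabs_def2 in Ht2. lra.
    - rewrite Hzr by lra. rewrite <- HX0. apply Hd.
      change (Rabs (t - T - 0) < d). now rewrite Rminus_0_r. }
  assert (Hzd : forall i t, (i <= n)%nat -> 0 < t < T + h ->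
    is_derive (z i) t (rep_field n k cb i (fun j => z j t))).
  { assert (Hoff : forall i t, (i <= n)%nat -> 0 < t < T + h -> t <> T ->
      is_derive (z i) t (rep_field n k cb i (fun j => z j t))).
    { intros i t Hi Ht Hne. destruct (Rlt_dec t T) as [Hlt|Hge].
      - apply is_derive_ext_loc with (y i).
        + generalize (open_lt T t Hlt). apply filter_imp. intros s Hs. now rewrite Hzl.
        + replace (rep_field n k cb i (fun j => z j t))
            with (rep_field n k cb i (fun j => y j t)); [apply Hy; [easy|lra]|].
          destruct i; simpl; unfold z; destruct (Rlt_dec t T); easy.
      - assert (Hgt : T < t) by lra.
        apply is_derive_ext_loc with (fun s => X i (s - T)).
        + generalize (open_gt T t Hgt). apply filter_imp. intros s Hs. rewrite Hzr; [easy|now left].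
        + replace (rep_field n k cb i (fun j => z j t))
            with (rep_field n k cb i (fun j => X j (t - T)))
            by (destruct i; simpl; unfold z; destruct (Rlt_dec t T); easy).
          apply is_derive_eq with (1 * rep_field n k cb i (fun j => X j (t - T))); [|ring].
          apply (is_derive_comp (X i) (fun s => s - T) t).
          * apply HX; [easy|]. apply Rabs_def1; lra.
          * auto_derive; [easy|ring]. }
    intros i t Hi Ht. destruct (Req_dec t T) as [->|Hne]; [|now apply Hoff].
    apply (is_derive_fill (z i) (fun t => rep_field n k cb i (fun j => z j t)) 0 T (T + h)); [lra| | |].
    - now apply Hzc.
    - now apply continuous_rep_field.
    - intros t Ht' Hne. now apply Hoff. }
  assert (Hnear0 : forall P : R -> Prop, (forall t, t < T -> P t) -> at_right 0 P).
  { intros P HP. exists (mkposreal T HT). intros t Ht _. apply HP.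
    change (Rabs (t - 0) < T) in Ht. apply Rabs_def2 in Ht. lra. }
  exists (T + h), z, (z 0%nat). split; [lra|]. split; [split; [|split; [|split; [|split]]]|].
  - now rewrite Hzl.
  - intros i Hi. rewrite Hzl by easy. destruct i; [lia|]. now apply S2.
  - apply (filterlim_ext_loc rho); [|easy]. apply Hnear0. intros t Ht. now rewrite Hzl.
  - intros i Hi. apply (filterlim_ext_loc (lam i)); [|now apply S4].
    apply Hnear0. intros t Ht. rewrite Hzl by easy. destruct i; [lia|easy].
  - intros t Ht. split.
    + intros i Hi. destruct i; [lia|]. apply (Hzd (S i) t); [lia|easy].
    + apply (Hzd 0%nat t); [lia|easy].
  - intros t Ht. split; [now rewrite Hzl|]. intros i Hi. rewrite Hzl by easy.
    destruct i; [lia|easy].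
Qed.

(** * The asymptotic planar system *)

Lemma to_pinf_ln (b : R) (f : R -> R) : to_pinf b f -> to_pinf b (fun t => ln (f t)).
Proof.
  rewrite 2!to_pinf_iff. intros H K. generalize (H (exp K)). apply filter_imp.
  intros t Ht. rewrite <- (ln_exp K). apply ln_increasing; [apply exp_pos|easy].
Qed.


Lemma exp_ge_id (x : R) : x <= exp x.
Proof. generalize (exp_ineq1_le x). lra. Qed.

Lemma to_pinf_of_ln (b : R) (f : R -> R) :
  at_left b (fun t => 0 < f t) -> to_pinf b (fun t => ln (f t)) -> to_pinf b f.
Proof.
  intros Hp. rewrite 2!to_pinf_iff. intros H K.
  generalize (filter_and _ _ Hp (H K)). apply filter_imp. intros t [H1 H2].
  generalize (exp_ge_id (ln (f t))). rewrite exp_ln; lra.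
Qed.

Lemma conv0_of_ln (b : R) (f g : R -> R) :
  at_left b (fun t => 0 < f t) -> to_pinf b g -> at_left b (fun t => ln (f t) <= - g t) ->
  conv b f 0.
Proof.
  intros Hp Hg H. apply conv_iff. intros e He.
  generalize (filter_and _ _ (filter_and _ _ Hp H) (proj1 (to_pinf_iff _ _) Hg (- ln e))).
  apply filter_imp. intros t [[H1 H2] H3].
  rewrite Rminus_0_r, Rabs_pos_eq by lra. apply ln_lt_inv; lra.
Qed.

Lemma to_pinf_affine (b c d : R) (f : R -> R) :
  0 < c -> to_pinf b f -> to_pinf b (fun t => c * f t + d).
Proof.
  intros Hc. rewrite 2!to_pinf_iff. intros H K. generalize (H ((K - d) / c)).
  apply filter_imp. intros t Ht. apply (Rmult_lt_compat_l c) in Ht; [|easy].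
  replace (c * ((K - d) / c)) with (K - d) in Ht by (field; lra). lra.
Qed.

(** The system of the overview in the original time: [D] is the derivative of the clock [s] and
    multiplies the leading terms, while [e1] and [e2] are remainders, bounded on a finite interval.
    Their sign is recorded because the monotonicity arguments below rely on it. In the application
    [a = J - n/2] and [nu = n - 4]. *)
Record planar (T b a nu C : R) (s D M G e1 e2 : R -> R) : Prop := {
  pl_T : T < b;
  pl_s : forall t, T < t < b -> is_derive s t (D t);
  pl_D : forall t, T < t < b -> is_derive D t (2 * M t * D t ^ 2);
  pl_M : forall t, T < t < b -> is_derive M t (D t * (1 / 4 - M t ^ 2 - G t) + e1 t);
  pl_G : forall t, T < t < b -> is_derive G t (G t * (D t * (nu * M t + a) + e2 t));
  pl_D1 : forall t, T < t < b -> 1 <= D t;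
  pl_M1 : forall t, T < t < b -> - (1 / 2) < M t < 1 / 2;
  pl_G0 : forall t, T < t < b -> 0 < G t;
  pl_e1 : forall t, T < t < b -> 0 <= e1 t <= C;
  pl_e2 : forall t, T < t < b -> 0 <= e2 t <= C;
  pl_Dinf : to_pinf b D;
  pl_sinf : to_pinf b s }.

Arguments pl_T {T b a nu C s D M G e1 e2}.
Arguments pl_s {T b a nu C s D M G e1 e2}.
Arguments pl_D {T b a nu C s D M G e1 e2}.
Arguments pl_M {T b a nu C s D M G e1 e2}.
Arguments pl_G {T b a nu C s D M G e1 e2}.
Arguments pl_D1 {T b a nu C s D M G e1 e2}.
Arguments pl_M1 {T b a nu C s D M G e1 e2}.
Arguments pl_G0 {T b a nu C s D M G e1 e2}.
Arguments pl_e1 {T b a nu C s D M G e1 e2}.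
Arguments pl_e2 {T b a nu C s D M G e1 e2}.
Arguments pl_Dinf {T b a nu C s D M G e1 e2}.
Arguments pl_sinf {T b a nu C s D M G e1 e2}.

Lemma planar_restrict T T' b a nu C s D M G e1 e2 :
  T <= T' < b -> planar T b a nu C s D M G e1 e2 -> planar T' b a nu C s D M G e1 e2.
Proof.
  intros H [? ? ? ? ? ? ? ? ? ? ? ?].
  split; try assumption; try lra; intros t Ht;
  match goal with H : forall t, T < t < b -> _ |- _ => apply H; lra end.
Qed.

Lemma planar_ev (P : R -> Prop) T b a nu C s D M G e1 e2 :
  planar T b a nu C s D M G e1 e2 -> at_left b P ->
  exists T', T <= T' < b /\ planar T' b a nu C s D M G e1 e2 /\ forall t, T' < t < b -> P t.
Proof.
  intros H HP. apply at_left_iff in HP. destruct HP as [T1 [HT1 HP]].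
  exists (Rmax T T1).
  assert (T <= Rmax T T1 < b).
  { split; [apply Rmax_l|]. apply Rmax_lub_lt; [apply (pl_T H)|easy]. }
  split; [easy|]. split; [now apply planar_restrict with T|].
  intros t Ht. apply HP. generalize (Rmax_r T T1). lra.
Qed.

Arguments planar_ev P {T b a nu C s D M G e1 e2}.

Lemma planar_lnD T b a nu C s D M G e1 e2 : planar T b a nu C s D M G e1 e2 ->
  forall t, T < t < b -> is_derive (fun x => ln (D x)) t (2 * M t * D t).
Proof.
  intros H t Ht. assert (HD := pl_D1 H t Ht).
  eapply is_derive_eq. { apply is_derive_ln_comp; [now apply (pl_D H)|lra]. }
  field. lra.
Qed.

Arguments planar_lnD {T b a nu C s D M G e1 e2}.

Lemma planar_lnG T b a nu C s D M G e1 e2 : planar T b a nu C s D M G e1 e2 ->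
  forall t, T < t < b -> is_derive (fun x => ln (G x)) t (D t * (nu * M t + a) + e2 t).
Proof.
  intros H t Ht. assert (HG := pl_G0 H t Ht).
  eapply is_derive_eq. { apply is_derive_ln_comp; [now apply (pl_G H)|lra]. }
  field. lra.
Qed.

Arguments planar_lnG {T b a nu C s D M G e1 e2}.

(** Where [G > 1], the derivative of [M] is at most [- (3 / 4) * D + C], and the diverging clock
    would push [M] below [- 1/2]. *)
Lemma planar_G_not_pinf T b a nu C s D M G e1 e2 :
  planar T b a nu C s D M G e1 e2 -> ~ to_pinf b G.
Proof.
  intros H HG. destruct (planar_ev _ H (proj1 (to_pinf_iff _ _) HG 1))
    as [T' [HT' [H' HG1]]].
  destruct H' as [hT hs hD hM hG hD1 hM1 hG0 he1 he2 hDi hsi].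
  apply (drift_absurd T' b (3 / 4) C (- (1 / 2)) s D M
          (fun t => D t * (1 / 4 - M t ^ 2 - G t) + e1 t)); try assumption; try lra.
  - intros t Ht. specialize (HG1 t Ht). specialize (hD1 t Ht). specialize (he1 t Ht).
    assert (0 <= D t * (M t ^ 2 + (G t - 1))).
    { apply Rmult_le_pos; [lra|]. generalize (pow2_ge_0 (M t)). lra. }
    lra.
  - intros t Ht. specialize (hM1 t Ht). lra.
Qed.

Arguments planar_G_not_pinf {T b a nu C s D M G e1 e2}.

(** Since [ln D] has derivative [2 * M * D], the combination [ln G - nu / 2 * ln D] is free of [M]:
    its derivative is [a * D + e2]. For [a > 0] it diverges with the clock; for [a = 0] it is
    bounded below, and [nu > 0] lets [ln D] carry [G] to infinity. Both contradict
    [planar_G_not_pinf]. *)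
Lemma planar_excess_growth T b a nu C s D M G e1 e2 :
  planar T b a nu C s D M G e1 e2 -> 0 <= nu -> 0 <= a -> 0 < a + nu -> False.
Proof.
  intros H Hnu Ha Han. apply (planar_G_not_pinf H).
  assert (HlD := planar_lnD H).
  assert (HlG := planar_lnG H).
  assert (HY : forall t, T < t < b ->
    is_derive (fun t => ln (G t) - nu / 2 * ln (D t)) t (a * D t + e2 t)).
  { intros t Ht. eapply is_derive_eq.
    { apply is_derive_Rminus; [now apply HlG|apply is_derive_Rscal; now apply HlD]. } field. }
  apply to_pinf_of_ln.
  { apply (at_left_intro b T); [apply H|]. apply H. }
  assert (HlDp : at_left b (fun t => 0 <= ln (D t))).
  { apply (at_left_intro b T); [apply H|]. intros t Ht. rewrite <- ln_1.
    apply ln_le; [lra|now apply H]. }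
  destruct (Rle_lt_or_eq_dec 0 a Ha) as [Ha0|Ha0].
  - assert (HYi : to_pinf b (fun t => ln (G t) - nu / 2 * ln (D t))).
    { apply (to_pinf_of_drift T b a 0 s D _ _ (pl_T H) Ha0
               (pl_s H) (pl_sinf H) HY).
      intros t Ht. generalize (pl_e2 H t Ht). lra. }
    apply to_pinf_le with (2 := HYi). revert HlDp. apply filter_imp. intros t Ht.
    assert (0 <= nu / 2 * ln (D t)) by (apply Rmult_le_pos; lra). lra.
  - destruct (drift_lower T b 0 _ _ (pl_T H) HY) as [K HK].
    { intros t Ht. generalize (pl_e2 H t Ht). subst a. lra. }
    apply to_pinf_le with (fun t => nu / 2 * ln (D t) + K).
    + revert HK. apply filter_imp. intros t Ht. lra.
    + apply to_pinf_affine; [lra|]. apply to_pinf_ln. apply H.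
Qed.

(** The case [n = 3], [J = 2]. The rate [1/2 - M] of [G] is positive but may degenerate as [M]
    approaches [1/2]. It still keeps [G] above a positive constant, and subtracting the bounded [M]
    from [ln G] completes the rate to [(M - 1/2)^2 + G], which cannot degenerate. *)
Lemma planar_excess_three T b C s D M G e1 e2 :
  planar T b (1 / 2) (-1) C s D M G e1 e2 -> False.
Proof.
  intros H. apply (planar_G_not_pinf H).
  assert (HT := pl_T H).
  assert (HlG := planar_lnG H).
  destruct (drift_lower T b 0 _ _ HT HlG) as [K HK].
  { intros t Ht. destruct H as [hT hs hD hM hG hD1 hM1 hG0 he1 he2 hDi hsi]. specialize (hD1 t Ht). specialize (hM1 t Ht).
    specialize (he2 t Ht).
    assert (0 <= D t * (-1 * M t + 1 / 2)) by (apply Rmult_le_pos; lra). lra. }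
  destruct (planar_ev _ H HK) as [T' [HT' [H' HK']]].
  destruct H' as [hT hs hD hM hG hD1 hM1 hG0 he1 he2 hDi hsi]. clear HlG.
  assert (HlG := planar_lnG H).
  apply to_pinf_of_ln. { now apply (at_left_intro b T'). }
  apply to_pinf_le with (fun t => 1 * (ln (G t) - M t) + - (1 / 2)).
  { apply (at_left_intro b T'); [easy|]. intros t Ht. specialize (hM1 t Ht). lra. }
  apply to_pinf_affine; [lra|].
  apply (to_pinf_of_drift T' b (exp K) C s D _
     (fun t => D t * (-1 * M t + 1 / 2) + e2 t - (D t * (1 / 4 - M t ^ 2 - G t) + e1 t)));
    try assumption; try apply exp_pos.
  - intros t Ht. apply is_derive_Rminus; [apply HlG; lra|now apply hM].
  - intros t Ht. specialize (hD1 t Ht). specialize (hM1 t Ht).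
    specialize (he2 t Ht). specialize (he1 t Ht). specialize (HK' t Ht).
    assert (exp K <= G t).
    { rewrite <- (exp_ln (G t)) by now apply hG0.
      destruct HK' as [HK'| ->]; [|lra]. left. now apply exp_increasing. }
    assert (0 <= D t * ((M t - 1 / 2) ^ 2 + (G t - exp K))).
    { apply Rmult_le_pos; [lra|]. generalize (pow2_ge_0 (M t - 1 / 2)). lra. }
    lra.
Qed.

(** The growth rate of [G] contains no damping by [G], but the derivative of [M] contains [- D * G].
    As [M] is bounded, [G * exp M] is comparable to [G] and inherits this term: its derivative is
    negative where [G >= ka], so a high enough level is a barrier. *)
Lemma planar_G_bounded T b a nu C s D M G e1 e2 :
  planar T b a nu C s D M G e1 e2 -> exists K, 0 < K /\ at_left b (fun t => G t <= K).
Proof.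
  intros H. destruct H as [hT hs hD hM hG hD1 hM1 hG0 he1 he2 hDi hsi].
  set (ka := Rabs nu + Rabs a + 2 * C + 1).
  assert (HC : 0 <= C) by (specialize (he1 ((T + b) / 2)); lra).
  assert (Hka : 0 < ka) by (unfold ka; generalize (Rabs_pos nu) (Rabs_pos a); lra).
  set (Q := fun t => G t * exp (M t)).
  set (t0 := (T + b) / 2).
  assert (Ht0 : T < t0 < b) by (unfold t0; lra).
  set (c := Rmax (Q t0) (ka * exp (1 / 2))).
  assert (HQ : forall t, t0 < t < b -> Q t <= c).
  { intros t Ht.
    apply (barrier_opp T b c Q (fun t => G t * (D t * (nu * M t + a) + e2 t) * exp (M t) +
       G t * ((D t * (1 / 4 - M t ^ 2 - G t) + e1 t) * exp (M t)))) with t0; try lra.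
    - intros x Hx. unfold Q. apply (is_derive_Rmult G (fun t => exp (M t))); [now apply hG|]. apply (is_derive_exp_comp M). now apply hM.
    - intros x Hx HQ. specialize (hG0 x Hx). specialize (hD1 x Hx).
      specialize (hM1 x Hx). specialize (he1 x Hx). specialize (he2 x Hx).
      assert (HG : ka <= G x).
      { assert (ka * exp (1 / 2) <= Q x) by (rewrite HQ; apply Rmax_r).
        unfold Q in *. assert (exp (M x) <= exp (1 / 2)) by (left; apply exp_increasing; lra).
        apply Rmult_le_reg_r with (exp (M x)); [apply exp_pos|].
        apply Rle_trans with (ka * exp (1 / 2)); [|easy].
        apply Rmult_le_compat_l; lra. }
      replace (_ + _) with (- (G x * exp (M x)) *
        (D x * (G x + M x ^ 2 - 1 / 4 - nu * M x - a) - e1 x - e2 x)) by ring.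
      assert (0 < G x * exp (M x)) by (apply Rmult_lt_0_compat; [easy|apply exp_pos]).
      assert (0 < D x * (G x + M x ^ 2 - 1 / 4 - nu * M x - a) - e1 x - e2 x).
      { assert (nu * M x <= Rabs nu).
        { apply Rle_trans with (1 := Rle_abs _). rewrite Rabs_mult.
          assert (Rabs (M x) <= 1) by (apply Rabs_le; lra).
          generalize (Rabs_pos nu). nra. }
        generalize (Rle_abs a) (pow2_ge_0 (M x)). intros Ha HM2.
        assert (HH : 2 * C + 3 / 4 <= G x + M x ^ 2 - 1 / 4 - nu * M x - a) by (unfold ka in HG; lra).
        nra. }
      nra.
    - apply Rmax_l. }
  exists (c * exp (1 / 2)). split.
  { apply Rmult_lt_0_compat; [|apply exp_pos]. apply Rlt_le_trans with (2 := Rmax_r _ _).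
    apply Rmult_lt_0_compat; [easy|apply exp_pos]. }
  apply (at_left_intro b t0); [lra|]. intros t Ht. specialize (HQ t Ht). unfold Q in HQ.
  assert (HtT : T < t < b) by lra. specialize (hM1 t HtT). specialize (hG0 t HtT).
  replace (G t) with (G t * exp (M t) * exp (- M t)) by (rewrite Rmult_assoc, <- exp_plus;
    replace (M t + - M t) with 0 by ring; rewrite exp_0; ring).
  assert (exp (- M t) <= exp (1 / 2)) by (left; apply exp_increasing; lra).
  apply Rmult_le_compat; try easy.
  - left. apply Rmult_lt_0_compat; [easy|apply exp_pos].
  - left. apply exp_pos.
Qed.

(** With [G] close to [g], the sign of [M'] on a level [c] is that of [1/4 - c^2 - g], so only roots
    of this polynomial can be crossed in both directions arbitrarily late. A negative limit would
    make [D] eventually nonincreasing, against [D -> +oo]. *)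
Lemma planar_M_conv T b a nu C s D M G e1 e2 g :
  planar T b a nu C s D M G e1 e2 -> conv b G g ->
  exists l, conv b M l /\ 0 <= l <= 1 / 2.
Proof.
  intros H Hg.
  assert (Hex : exists l, conv b M l).
  { destruct H as [hT hs hD hM hG hD1 hM1 hG0 he1 he2 hDi hsi].
    apply (conv_of_one_way_levels T b (- (1 / 2)) (1 / 2) M _ hT hM).
    { intros t Ht. specialize (hM1 t Ht). lra. }
    intros al be Hab.
    (* A quadratic polynomial cannot vanish at three points; the candidates lie at one half, one
       third and one quarter of the interval. *)
    assert (Hc : exists c, al < c < be /\ 1 / 4 - c ^ 2 - g <> 0).
    { destruct (Req_dec (1 / 4 - ((al + be) / 2) ^ 2 - g) 0) as [E1|];
        [|exists ((al + be) / 2); split; [lra|easy]].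
      destruct (Req_dec (1 / 4 - ((2 * al + be) / 3) ^ 2 - g) 0) as [E2|];
        [|exists ((2 * al + be) / 3); split; [lra|easy]].
      exists ((3 * al + be) / 4). split; [lra|]. intros E3.
      assert (E4 : (be - al) * (5 * be + 7 * al) = 0) by (simpl in *; lra).
      assert (E5 : (be - al) * (3 * be + 5 * al) = 0) by (simpl in *; lra).
      apply Rmult_integral in E4. apply Rmult_integral in E5. lra. }
    destruct Hc as [c [Hc Hne]]. exists c. split; [easy|].
    destruct (Rtotal_order 0 (1 / 4 - c ^ 2 - g)) as [Hp|[Hz|Hn]].
    - left.
      assert (H1 : at_left b (fun t => G t < 1 / 4 - c ^ 2)) by (apply (conv_lt_ev b G g); [easy|lra]).
      generalize (filter_and _ _ (at_left_ge b T hT) H1). apply filter_imp.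
      intros t [Ht HG] ->. specialize (hD1 t Ht). specialize (he1 t Ht).
      assert (0 < D t * (1 / 4 - c ^ 2 - G t)) by (apply Rmult_lt_0_compat; lra). lra.
    - now symmetry in Hz.
    (* Here [e1] has the wrong sign; the margin [dl], multiplied by [D -> +oo], outweighs its bound
       [C]. *)
    - right. set (dl := - (1 / 4 - c ^ 2 - g) / 2).
      assert (Hdl : 0 < dl) by (unfold dl; lra).
      assert (H1 : at_left b (fun t => 1 / 4 - c ^ 2 + dl < G t)).
      { apply (conv_gt_ev b G g); [easy|unfold dl; lra]. }
      generalize (filter_and _ _ (filter_and _ _ (at_left_ge b T hT) H1)
        (proj1 (to_pinf_iff _ _) hDi (C / dl))). apply filter_imp.
      intros t [[Ht HG] HD] ->. specialize (hD1 t Ht). specialize (he1 t Ht).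
      apply (Rmult_lt_compat_l dl) in HD; [|easy].
      replace (dl * (C / dl)) with C in HD by (field; lra).
      assert (0 < D t * (G t - (1 / 4 - c ^ 2 + dl))) by (apply Rmult_lt_0_compat; lra). lra. }
  destruct Hex as [l Hl]. exists l. split; [easy|]. split.
  - apply Rnot_lt_le. intros Hneg.
    destruct (planar_ev _ H (conv_lt_ev b M l 0 Hl Hneg)) as [T' [HT' [H' HM0]]].
    destruct H' as [hT hs hD hM hG hD1 hM1 hG0 he1 he2 hDi hsi].
    destruct (drift_upper T' b 0 D _ hT hD) as [K HK].
    { intros t Ht. specialize (HM0 t Ht). generalize (pow2_ge_0 (D t)). nra. }
    destruct (filter_ex _ (filter_and _ _ HK (proj1 (to_pinf_iff _ _) hDi K))) as [t Ht]. lra.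
  - apply (conv_le b M l _ Hl). apply (at_left_intro b T); [apply H|].
    intros t Ht. generalize (pl_M1 H t Ht). lra.
Qed.

(** The derivative of [Y = ln G - nu / 2 * ln D] is [a * D + e2], and [nu / 2 * ln D <= 0]. For
    [a < 0], [Y] tends to [-oo]; for [a = 0] and [nu < 0], [Y] is bounded above and [ln D] diverges:
    in both cases [G -> 0]. For [a = nu = 0] the derivative of [G] is [G * e2 >= 0], and [G] is
    bounded. *)
Lemma planar_G_conv_nonpos T b a nu C s D M G e1 e2 :
  planar T b a nu C s D M G e1 e2 -> nu <= 0 -> a <= 0 -> exists g, conv b G g.
Proof.
  intros H Hnu Ha. assert (HlD := planar_lnD H). assert (HlG := planar_lnG H).
  destruct (planar_G_bounded _ _ _ _ _ _ _ _ _ _ _ H) as [K [HK0 HK]].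
  destruct H as [hT hs hD hM hG hD1 hM1 hG0 he1 he2 hDi hsi].
  assert (HlD0 : forall t, T < t < b -> 0 <= ln (D t)).
  { intros t Ht. rewrite <- ln_1. apply ln_le; [lra|now apply hD1]. }
  assert (HY : forall t, T < t < b ->
    is_derive (fun t => ln (G t) - nu / 2 * ln (D t)) t (a * D t + e2 t)).
  { intros t Ht. eapply is_derive_eq.
    { apply is_derive_Rminus; [now apply HlG|apply is_derive_Rscal; now apply HlD]. } field. }
  assert (HGp : at_left b (fun t => 0 < G t)) by (now apply (at_left_intro b T)).
  destruct (Rle_lt_or_eq_dec a 0 Ha) as [Ha0|Ha0]; [|destruct (Rle_lt_or_eq_dec nu 0 Hnu) as [Hn0|Hn0]].
  - exists 0.
    assert (HYi : to_pinf b (fun t => - (ln (G t) - nu / 2 * ln (D t)))).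
    { apply (to_pinf_of_drift T b (- a) C s D _ (fun t => - (a * D t + e2 t))); try assumption; try lra.
      - intros t Ht. now apply (is_derive_opp (fun t => ln (G t) - nu / 2 * ln (D t))), HY.
      - intros t Ht. specialize (he2 t Ht). lra. }
    apply (conv0_of_ln b G _ HGp HYi). apply (at_left_intro b T); [easy|].
    intros t Ht. specialize (HlD0 t Ht).
    assert (0 <= - nu * ln (D t)) by (apply Rmult_le_pos; lra). lra.
  - exists 0.
    destruct (drift_upper T b C _ _ hT HY) as [K1 HK1].
    { intros t Ht. specialize (he2 t Ht). subst a. lra. }
    apply (conv0_of_ln b G (fun t => (- nu / 2) * ln (D t) + (- K1)) HGp).
    + apply to_pinf_affine; [lra|]. now apply to_pinf_ln.
    + revert HK1. apply filter_imp. intros t Ht. lra.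
  - apply at_left_iff in HK. destruct HK as [T1 [HT1 HK]].
    apply (drift_conv (Rmax T T1) b K 0 G (fun t => G t * (D t * (nu * M t + a) + e2 t))).
    + now apply Rmax_lub_lt.
    + intros t Ht. apply hG. generalize (Rmax_l T T1). lra.
    + intros t Ht. assert (Ht' : T < t < b) by (generalize (Rmax_l T T1); lra).
      specialize (hG0 t Ht'). specialize (he2 t Ht'). subst. nra.
    + intros t Ht. apply HK. generalize (Rmax_r T T1). lra.
Qed.

(** The points [c], [c q], [c q^2] are in geometric progression. If the value were [V] at all three,
    eliminating [A] and [V] would leave [B c^(N+2) (P - 1) (P - q^2) = 0] with
    [P = q^(N+2) > q^2 > 1]. *)
Lemma power_levels (A B V al be : R) (N : nat) :
  0 < B -> (1 <= N)%nat -> 0 <= al < be ->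
  exists c, al < c < be /\ A * c ^ 2 + B * c ^ (N + 2) <> V.
Proof.
  intros HB HN Hab. set (c := (al + be) / 2). assert (Hc : 0 < c) by (unfold c; lra).
  (* As [x <= 1], [(1 + x)^2 <= 1 + 3 x < 1 + 4 x], which keeps [c * (1 + x)^2] below [be]. *)
  set (x := Rmin 1 ((be / c - 1) / 4)).
  assert (Hr : 1 < be / c).
  { apply Rmult_lt_reg_r with c; [easy|]. unfold Rdiv. rewrite Rmult_assoc, Rinv_l by lra.
    unfold c; lra. }
  assert (Hx : 0 < x /\ x <= 1 /\ 4 * x <= be / c - 1).
  { unfold x. generalize (Rmin_l 1 ((be / c - 1) / 4)) (Rmin_r 1 ((be / c - 1) / 4)).
    assert (0 < Rmin 1 ((be / c - 1) / 4)) by (apply Rmin_glb_lt; lra). lra. }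
  set (q := 1 + x).
  assert (Hq2 : c * q ^ 2 < be).
  { apply Rlt_le_trans with (c * (be / c)); [|right; field; lra].
    apply Rmult_lt_compat_l; [easy|]. unfold q. nra. }
  assert (Hq1 : c < c * q /\ c * q < c * q ^ 2) by (unfold q; split; nra).
  destruct (Req_dec (A * c ^ 2 + B * c ^ (N + 2)) V) as [E1|];
    [|exists c; split; [unfold c; lra|easy]].
  destruct (Req_dec (A * (c * q) ^ 2 + B * (c * q) ^ (N + 2)) V) as [E2|];
    [|exists (c * q); split; [unfold c in *; lra|easy]].
  exists (c * q ^ 2). split; [unfold c in *; lra|]. intros E3.
  set (P := q ^ (N + 2)) in *.
  assert (HP : P = q ^ N * q ^ 2) by (unfold P; now rewrite pow_add).
  assert (HqN : 1 < q ^ N) by (apply Rlt_pow_R1; [unfold q; lra|lia]).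
  assert (Hqq : 1 < q ^ 2) by (apply Rlt_pow_R1; [unfold q; lra|lia]).
  assert (HcN : 0 < c ^ (N + 2)) by now apply pow_lt.
  assert (E2' : A * c ^ 2 * q ^ 2 + B * c ^ (N + 2) * P = V).
  { rewrite <- E2. rewrite 2!Rpow_mult_distr. fold P. ring. }
  assert (E3' : A * c ^ 2 * (q ^ 2 * q ^ 2) + B * c ^ (N + 2) * (P * P) = V).
  { rewrite <- E3. rewrite 2!Rpow_mult_distr. replace ((q ^ 2) ^ (N + 2)) with (P * P).
    - ring.
    - unfold P. rewrite <- Rpow_mult_distr. f_equal. ring. }
  assert (HH : (B * c ^ (N + 2)) * ((P - 1) * (P - q ^ 2)) = 0).
  { replace ((B * c ^ (N + 2)) * ((P - 1) * (P - q ^ 2))) with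
      ((A * c ^ 2 * (q ^ 2 * q ^ 2) + B * c ^ (N + 2) * (P * P)) -
       (A * c ^ 2 * q ^ 2 + B * c ^ (N + 2) * P) -
       q ^ 2 * ((A * c ^ 2 * q ^ 2 + B * c ^ (N + 2) * P) - (A * c ^ 2 + B * c ^ (N + 2)))) by ring.
    rewrite E1, E2', E3'. ring. }
  assert (0 < B * c ^ (N + 2)) by now apply Rmult_lt_0_compat.
  assert (HPq : q ^ 2 < P) by (rewrite HP; nra).
  assert (0 < (P - 1) * (P - q ^ 2)) by (apply Rmult_lt_0_compat; lra).
  assert (0 < (B * c ^ (N + 2)) * ((P - 1) * (P - q ^ 2))) by now apply Rmult_lt_0_compat.
  lra.
Qed.

Lemma exp_INR_mult (N : nat) (x : R) : exp (INR N * x) = exp x ^ N.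
Proof.
  induction N as [|N IH]; [now rewrite Rmult_0_l, exp_0|].
  rewrite S_INR, Rmult_plus_distr_r, exp_plus, IH, Rmult_1_l. simpl. ring.
Qed.

Lemma continuous_pow (N : nat) (x : R) : continuous (fun y => y ^ N) x.
Proof. apply (ex_derive_continuous (fun y => y ^ N)). auto_derive. easy. Qed.

(* With [m = M - M*], the quantity [h] satisfies [h' = D m h], and in the time [s] it is
   the position of a damped oscillator in the potential
   [- G* h^2 / 2 + exp y h^(N+2) / (N+2)]; [V] is its energy. *)
Lemma planar_G_conv_pos T b a C s D M G e1 e2 (N : nat) :
  planar T b a (INR N) C s D M G e1 e2 -> (1 <= N)%nat -> a < 0 -> exists g, conv b G g.
Proof.
  intros H0 HN Ha. set (nu := INR N) in *.
  assert (Hnu : 1 <= nu) by (now apply (le_INR 1)).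
  (* At [M = ms] the leading growth rate of [G] vanishes; with [G = gs] as well, so does the leading
     term of [M']. *)
  set (ms := - a / nu). set (gs := 1 / 4 - ms ^ 2).
  assert (Hms : 0 < ms) by (apply Rdiv_lt_0_compat; lra).
  assert (Hams : a = - nu * ms) by (unfold ms; field; lra).
  (* [h] is [sqrt D * exp (- ms * s)], and [y] changes only by the integral of [e2]. Hence
     [G = exp y * h^N] with a convergent [y], and it remains to find the limit of [h]. *)
  set (lh := fun t => 1 / 2 * ln (D t) - ms * s t).
  set (y := fun t => ln (G t) - nu * lh t).
  set (h := fun t => exp (lh t)).
  assert (Hlh : forall t, T < t < b -> is_derive lh t (D t * (M t - ms))).
  { intros t Ht. eapply is_derive_eq.
    { apply is_derive_Rminus; apply is_derive_Rscal; [now apply (planar_lnD H0)|now apply H0]. } field. }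
  assert (Hy : forall t, T < t < b -> is_derive y t (e2 t)).
  { intros t Ht. eapply is_derive_eq.
    { apply is_derive_Rminus; [now apply (planar_lnG H0)|apply is_derive_Rscal; now apply Hlh]. }
    rewrite Hams. ring. }
  destruct (planar_G_bounded _ _ _ _ _ _ _ _ _ _ _ H0) as [Kg [HKg0 HKg]].
  destruct (drift_lower T b 0 y e2 (pl_T H0) Hy) as [yl Hyl]; [intros t Ht; apply (pl_e2 H0 t Ht)|].
  destruct (drift_upper T b C y e2 (pl_T H0) Hy) as [yu Hyu]; [intros t Ht; apply (pl_e2 H0 t Ht)|].
  destruct (planar_ev _ H0 (filter_and _ _ HKg (filter_and _ _ Hyl Hyu)))
    as [T' [HT' [H Hev]]]. clear HKg Hyl Hyu.
  assert (Hlh' : forall t, T' < t < b -> is_derive lh t (D t * (M t - ms))).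
  { intros t Ht. apply Hlh. lra. }
  assert (Hy' : forall t, T' < t < b -> is_derive y t (e2 t)).
  { intros t Ht. apply Hy. lra. }
  clear Hlh Hy H0. rename Hlh' into Hlh. rename Hy' into Hy.
  destruct H as [hT hs hD hM hG hD1 hM1 hG0 he1 he2 hDi hsi].
  assert (HC : 0 <= C) by (assert (T' < (T' + b) / 2 < b) by lra; specialize (he1 _ H); lra).
  assert (Hh : forall t, T' < t < b -> is_derive h t (D t * (M t - ms) * h t)).
  { intros t Ht. apply (is_derive_exp_comp lh). now apply Hlh. }
  assert (Hh0 : forall t, 0 < h t) by (intros t; apply exp_pos).
  assert (HhN : forall t, exp (nu * lh t) = h t ^ N).
  { intros t. apply exp_INR_mult. }
  assert (HGy : forall t, T' < t < b -> G t = exp (y t) * h t ^ N).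
  { intros t Ht. rewrite <- HhN, <- exp_plus. unfold y.
    replace (ln (G t) - nu * lh t + nu * lh t) with (ln (G t)) by ring.
    symmetry. apply exp_ln. now apply hG0. }
  (* Where [h > 1], [h <= h^N = G * exp (- y)], which bounds [h]. *)
  set (hb := Kg * exp (- yl) + 1).
  assert (Hhb0 : 0 < Kg * exp (- yl)) by (apply Rmult_lt_0_compat; [easy|apply exp_pos]).
  assert (Hhb : forall t, T' < t < b -> h t <= hb).
  { intros t Ht. destruct (Hev t Ht) as [E1 [E2 E3]].
    destruct (Rle_dec (h t) 1) as [Hl|Hl]; [unfold hb; lra|].
    assert (HhN1 : h t <= h t ^ N).
    { rewrite <- (pow_1 (h t)) at 1. apply Rle_pow; [lra|easy]. }
    assert (h t ^ N = G t * exp (- y t)).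
    { rewrite HGy by easy. rewrite Rmult_comm, <- Rmult_assoc, <- exp_plus.
      replace (- y t + y t) with 0 by ring. rewrite exp_0. ring. }
    assert (exp (- y t) <= exp (- yl)).
    { destruct E2 as [E2| ->]; [left; apply exp_increasing; lra|lra]. }
    assert (G t * exp (- y t) <= Kg * exp (- yl)); [|unfold hb; lra].
    apply Rmult_le_compat; try easy; [left; now apply hG0|left; apply exp_pos]. }
  destruct (drift_conv T' b yu 0 y e2 hT Hy) as [yi Hyi].
  { intros t Ht. specialize (he2 t Ht). lra. }
  { intros t Ht. apply (Hev t Ht). }
  set (m := fun t => M t - ms).
  set (B := 1 / 2 + ms).
  assert (Hm : forall t, T' < t < b -> - B <= m t <= B).
  { intros t Ht. specialize (hM1 t Ht). unfold m, B. lra. }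
  assert (Hmd : forall t, T' < t < b -> is_derive m t (D t * (1 / 4 - M t ^ 2 - G t) + e1 t)).
  { intros t Ht. eapply is_derive_eq.
    { apply is_derive_Rminus; [now apply hM|apply (is_derive_const ms t)]. } exact (Rminus_0_r _). }
  (* In the time [s] the velocity of [h] is [h * m]: [ph] is its square, and [G * h^2] is
     [exp y * h^(N+2)]. Up to remainders the energy loses [2 * ms * ph] per unit of [s]. *)
  set (ph := fun t => h t ^ 2 * m t ^ 2).
  set (V := fun t => h t ^ 2 * (1 / 2 * m t ^ 2 - gs / 2 + 1 / (nu + 2) * G t)).
  assert (HV : forall t, T' < t < b -> is_derive V t
     (h t ^ 2 * (- 2 * ms * m t ^ 2 * D t + e1 t * m t + e2 t * G t / (nu + 2)))).
  { intros t Ht. eapply is_derive_eq.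
    { apply is_derive_Rmult; [apply is_derive_sq; now apply Hh|].
      apply is_derive_Rplus; [apply is_derive_Rminus; [apply is_derive_Rscal, is_derive_sq; now apply Hmd|apply (is_derive_const (gs / 2) t)]|].
      apply is_derive_Rscal. now apply hG. }
    change (zero : R) with 0. unfold gs. rewrite Hams. unfold m. field. lra. }
  assert (Hph : forall t, T' < t < b -> is_derive ph t
     (h t ^ 2 * (2 * m t) * (D t * (m t ^ 2 + (1 / 4 - M t ^ 2 - G t)) + e1 t))).
  { intros t Ht. eapply is_derive_eq.
    { apply is_derive_Rmult; [apply is_derive_sq; now apply Hh|apply is_derive_sq; now apply Hmd]. }
    unfold m. ring. }
  (* [K] bounds the rate of change of [ph] per unit of [s]. *)
  set (K := 2 * hb ^ 2 * B * (B ^ 2 + 1 + Kg + C)).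
  assert (HB : 0 < B) by (unfold B; lra).
  assert (Hhb1 : 1 <= hb) by (unfold hb; lra).
  assert (Hh2 : forall t, T' < t < b -> 0 < h t ^ 2 <= hb ^ 2).
  { intros t Ht. split; [apply pow_lt, Hh0|]. apply pow_incr. split; [left; apply Hh0|now apply Hhb]. }
  assert (HhB : 0 < hb ^ 2) by (apply pow_lt; lra).
  assert (HK : 0 < K).
  { unfold K. apply Rmult_lt_0_compat; [apply Rmult_lt_0_compat; lra|].
    generalize (pow2_ge_0 B). lra. }
  assert (HphK : forall t, T' < t < b ->
     h t ^ 2 * (2 * m t) * (D t * (m t ^ 2 + (1 / 4 - M t ^ 2 - G t)) + e1 t) <= K * D t).
  { intros t Ht. specialize (hD1 t Ht). specialize (he1 t Ht). specialize (hM1 t Ht).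
    specialize (hG0 t Ht). destruct (Hev t Ht) as [HGK _]. specialize (Hm t Ht).
    specialize (Hh2 t Ht).
    apply Rle_trans with (1 := Rle_abs _). rewrite !Rabs_mult, (Rabs_pos_eq (h t ^ 2)) by lra.
    rewrite (Rabs_pos_eq 2) by lra.
    assert (Rabs (m t) <= B) by (now apply Rabs_le).
    assert (E : Rabs (D t * (m t ^ 2 + (1 / 4 - M t ^ 2 - G t)) + e1 t) <= (B ^ 2 + 1 + Kg + C) * D t).
    { assert (m t ^ 2 <= B ^ 2).
      { rewrite <- (pow2_abs (m t)). apply pow_incr. split; [apply Rabs_pos|easy]. }
      assert (0 <= m t ^ 2) by apply pow2_ge_0.
      assert (0 <= M t ^ 2 <= 1 / 4) by nra.
      assert (0 <= B ^ 2) by apply pow2_ge_0.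
      apply Rabs_le. split; nra. }
    replace (K * D t) with (hb ^ 2 * (2 * B) * ((B ^ 2 + 1 + Kg + C) * D t)) by (unfold K; ring).
    apply Rmult_le_compat; try easy; try apply Rabs_pos.
    - apply Rmult_le_pos; [lra|]. apply Rmult_le_pos; [lra|apply Rabs_pos].
    - apply Rmult_le_compat; try lra. apply Rmult_le_pos; [lra|apply Rabs_pos]. }
  set (C1 := hb ^ 2 * (C * B + C * Kg)).
  assert (HVd : forall t, T' < t < b ->
     h t ^ 2 * (- 2 * ms * m t ^ 2 * D t + e1 t * m t + e2 t * G t / (nu + 2))
     <= - (2 * ms * ph t) * D t + C1).
  { intros t Ht. specialize (he1 t Ht). specialize (he2 t Ht).
    specialize (hG0 t Ht). destruct (Hev t Ht) as [HGK _]. specialize (Hm t Ht).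
    specialize (Hh2 t Ht). unfold ph, C1.
    assert (E1 : e1 t * m t <= C * B).
    { apply Rle_trans with (e1 t * B); [apply Rmult_le_compat_l|apply Rmult_le_compat_r]; lra. }
    assert (E2 : e2 t * G t / (nu + 2) <= C * Kg).
    { apply Rle_trans with (e2 t * G t * 1);
        [|rewrite Rmult_1_r; apply Rmult_le_compat; lra].
      apply Rmult_le_compat_l; [apply Rmult_le_pos; lra|]. unfold Rdiv. rewrite <- Rinv_1. apply Rinv_le_contravar; lra. }
    assert (E3 : h t ^ 2 * (e1 t * m t + e2 t * G t / (nu + 2)) <= hb ^ 2 * (C * B + C * Kg)).
    { assert (0 <= C * B + C * Kg) by nra.
      apply Rle_trans with (h t ^ 2 * (C * B + C * Kg)).
      - apply Rmult_le_compat_l; lra.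
      - apply Rmult_le_compat_r; lra. }
    lra. }
  assert (Hph0 : forall t, 0 <= ph t) by (intros t; apply Rmult_le_pos; apply pow2_ge_0).
  set (Vl := - hb ^ 2 * (Rabs gs)).
  assert (HVl : forall t, T' < t < b -> Vl <= V t).
  { intros t Ht. specialize (Hh2 t Ht). specialize (hG0 t Ht). unfold Vl, V.
    generalize (pow2_ge_0 (m t)) (Rle_abs gs) (Rabs_pos gs). intros P1 P2 P3.
    assert (0 < 1 / (nu + 2) * G t) by (apply Rmult_lt_0_compat; [apply Rdiv_lt_0_compat; lra|easy]).
    apply Rle_trans with (h t ^ 2 * - Rabs gs); [nra|].
    apply Rmult_le_compat_l; lra. }
  destruct (drift_conv_opp T' b Vl C1 V _ hT HV) as [Vi HVi]; [|easy|].
  { intros t Ht. apply Rle_trans with (1 := HVd t Ht). specialize (hD1 t Ht). specialize (Hph0 t).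
    assert (0 <= 2 * ms * ph t * D t) by
      (apply Rmult_le_pos; [apply Rmult_le_pos; [lra|easy]|lra]). lra. }
  (* Integrability of the dissipation alone does not give [ph -> 0]. With [al = ms / K] the growth
     of [al * ph^2] is at most the dissipation [2 * ms * ph * D], so [V + al * ph^2] is again
     nonincreasing up to remainders and converges; subtracting the limit of [V], so does [ph^2]. *)
  assert (Hph_conv : exists f, conv b (fun t => ph t ^ 2) f).
  { set (al := ms / K). assert (Hal : 0 < al) by now apply Rdiv_lt_0_compat.
    destruct (drift_conv_opp T' b Vl C1 (fun t => V t + al * ph t ^ 2)
      (fun t => h t ^ 2 * (- 2 * ms * m t ^ 2 * D t + e1 t * m t + e2 t * G t / (nu + 2)) +
        al * (2 * ph t * (h t ^ 2 * (2 * m t) * (D t * (m t ^ 2 + (1 / 4 - M t ^ 2 - G t)) + e1 t)))) hT)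
      as [W HW].
    - intros t Ht. apply is_derive_Rplus; [now apply HV|apply is_derive_Rscal, is_derive_sq; now apply Hph].
    - intros t Ht. specialize (HVd t Ht). specialize (HphK t Ht). specialize (Hph0 t).
      assert (al * (2 * ph t * (h t ^ 2 * (2 * m t) * (D t * (m t ^ 2 + (1 / 4 - M t ^ 2 - G t)) + e1 t)))
        <= al * (2 * ph t * (K * D t))).
      { apply Rmult_le_compat_l; [lra|]. apply Rmult_le_compat_l; lra. }
      replace (al * (2 * ph t * (K * D t))) with (2 * ms * ph t * D t) in H by (unfold al; field; lra).
      lra.
    - intros t Ht. specialize (HVl t Ht). assert (0 <= al * ph t ^ 2).
      { apply Rmult_le_pos; [lra|apply pow2_ge_0]. } lra.
    - exists (1 / al * (W + (-1) * Vi)).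
      apply (conv_ext b (fun t => 1 / al * ((V t + al * ph t ^ 2) + (-1) * V t))).
      + apply filter_forall. intros t. field. lra.
      + apply conv_mult; [apply conv_const|]. apply conv_plus; [easy|].
        apply conv_mult; [apply conv_const|easy]. }
  destruct Hph_conv as [f Hf].
  (* A positive limit would leave a dissipation of at least [2 * ms * sqrt (f / 2)] per unit of [s],
     whereas [V] is bounded below. *)
  assert (Hf0 : f = 0).
  { apply Rle_antisym.
    2: { apply (conv_ge b _ _ _ Hf). apply filter_forall. intros t. apply pow2_ge_0. }
    apply Rnot_lt_le. intros Hfp.
    assert (Hev2 : at_left b (fun t => f / 2 < ph t ^ 2)) by (apply (conv_gt_ev b _ f); [easy|lra]).
    apply at_left_iff in Hev2. destruct Hev2 as [T1 [HT1 Hev2]].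
    assert (HTm := Rmax_l T' T1). assert (HTm' := Rmax_r T' T1).
    apply (drift_absurd (Rmax T' T1) b (2 * ms * sqrt (f / 2)) C1 Vl s D V
      (fun t => h t ^ 2 * (- 2 * ms * m t ^ 2 * D t + e1 t * m t + e2 t * G t / (nu + 2)))).
    - now apply Rmax_lub_lt.
    - apply Rmult_lt_0_compat; [lra|]. apply sqrt_lt_R0. lra.
    - intros t Ht. apply hs. lra.
    - easy.
    - intros t Ht. apply HV. lra.
    - intros t Ht. assert (Ht' : T' < t < b) by lra.
      apply Rle_trans with (1 := HVd t Ht').
      assert (sqrt (f / 2) <= ph t).
      { rewrite <- (sqrt_pow2 (ph t)) by easy. apply sqrt_le_1_alt.
        left. apply Hev2. lra. }
      specialize (hD1 t Ht').
      assert (0 <= 2 * ms * ((ph t - sqrt (f / 2)) * D t)); [|lra].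
      apply Rmult_le_pos; [lra|]. apply Rmult_le_pos; lra.
    - intros t Ht. apply HVl. lra. }
  assert (Hphc : conv b ph 0).
  { subst f. apply conv_iff. intros e He.
    assert (He2 : 0 < e ^ 2) by now apply pow_lt.
    generalize (conv_lt_ev b _ _ _ Hf He2). apply filter_imp. intros t Ht.
    rewrite Rminus_0_r, Rabs_pos_eq by easy. apply Rnot_le_lt. intros Hle.
    apply Rlt_not_le in Ht. apply Ht. apply pow_incr. lra. }
  (* The coefficients of the potential with [y] frozen at its limit. Along the solution this
     potential tends to [Vi], because the kinetic term tends to 0. *)
  set (A2 := - gs / 2). set (B2 := exp yi / (nu + 2)).
  assert (HB2 : 0 < B2) by (apply Rdiv_lt_0_compat; [apply exp_pos|lra]).
  assert (Hdel : conv b (fun t => (exp yi - exp (y t)) * (h t ^ (N + 2) / (nu + 2))) 0).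
  { assert (He : conv b (fun t => exp (y t)) (exp yi)).
    { apply (conv_comp b y exp yi); [|easy]. apply (ex_derive_continuous exp). auto_derive. easy. }
    apply conv_iff. intros e Hep.
    assert (HhN2 : 0 < hb ^ (N + 2)) by (apply pow_lt; lra).
    generalize (filter_and _ _ (at_left_ge b T' hT)
      (proj1 (conv_iff _ _ _) He (e / hb ^ (N + 2)) (Rdiv_lt_0_compat _ _ Hep HhN2))).
    apply filter_imp. intros t [Ht Hd].
    rewrite Rminus_0_r, Rabs_mult, Rabs_minus_sym.
    assert (E0 : 0 < h t ^ (N + 2)) by apply pow_lt, Hh0.
    assert (E1 : h t ^ (N + 2) / (nu + 2) <= hb ^ (N + 2)).
    { apply Rle_trans with (h t ^ (N + 2) * 1).
      - apply Rmult_le_compat_l; [lra|]. rewrite <- Rinv_1. apply Rinv_le_contravar; lra.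
      - rewrite Rmult_1_r. apply pow_incr. split; [left; apply Hh0|now apply Hhb]. }
    assert (E2 : 0 < h t ^ (N + 2) / (nu + 2)) by (apply Rdiv_lt_0_compat; lra).
    rewrite (Rabs_pos_eq (_ / _)) by lra.
    apply Rle_lt_trans with (Rabs (exp (y t) - exp yi) * hb ^ (N + 2)).
    - apply Rmult_le_compat_l; [apply Rabs_pos|easy].
    - apply (Rmult_lt_compat_r (hb ^ (N + 2))) in Hd; [|easy].
      replace (e / hb ^ (N + 2) * hb ^ (N + 2)) with e in Hd by (field; lra). easy. }
  assert (HU : conv b (fun t => A2 * h t ^ 2 + B2 * h t ^ (N + 2)) Vi).
  { replace Vi with ((Vi + (- (1 / 2)) * 0) + 0) by ring.
    apply (conv_ext b (fun t => (V t + (- (1 / 2)) * ph t) +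
       (exp yi - exp (y t)) * (h t ^ (N + 2) / (nu + 2)))).
    - apply (at_left_intro b T'); [easy|]. intros t Ht. unfold V, ph, A2, B2.
      rewrite (HGy t Ht). rewrite pow_add. field. lra.
    - apply conv_plus; [|easy]. apply conv_plus; [easy|].
      apply conv_mult; [apply conv_const|easy]. }
  destruct (conv_of_one_way_levels T' b 0 hb h _ hT Hh) as [hi Hhi].
  { intros t Ht. split; [left; apply Hh0|now apply Hhb]. }
  { intros al be Hab. destruct (Rlt_dec al 0) as [Hal|Hal].
    - exists ((al + Rmin be 0) / 2). generalize (Rmin_l be 0) (Rmin_r be 0).
      assert (al < Rmin be 0) by now apply Rmin_glb_lt. intros P1 P2. split; [lra|].
      left. apply filter_forall. intros t Ht. specialize (Hh0 t). lra.
    - destruct (power_levels A2 B2 Vi al be N HB2 HN) as [c [Hc Hne]]; [lra|].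
      exists c. split; [easy|]. left.
      (* Such a level is eventually not attained at all, so the one-way condition holds
         vacuously. *)
      assert (Hgap : 0 < Rabs (A2 * c ^ 2 + B2 * c ^ (N + 2) - Vi)) by (apply Rabs_pos_lt; lra).
      generalize (proj1 (conv_iff _ _ _) HU _ Hgap). apply filter_imp.
      intros t Ht E. rewrite E in Ht. lra. }
  exists (exp yi * hi ^ N).
  apply (conv_ext b (fun t => exp (y t) * h t ^ N)).
  - apply (at_left_intro b T'); [easy|]. intros t Ht. symmetry. now apply HGy.
  - apply conv_mult.
    + apply (conv_comp b y exp yi); [|easy]. apply (ex_derive_continuous exp). auto_derive. easy.
    + apply (conv_comp b h (fun x => x ^ N) hi); [|easy]. apply continuous_pow.
Qed.

(** For [J > n/2] the coefficient [a] is positive. If [n >= 4], then [nu >= 0] and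
    [planar_excess_growth] applies; below that, [n/2 < J < n] leaves only [n = 3], [J = 2]. *)
Lemma planar_multiplicity_le (n J : nat) T b C s D M G e1 e2 :
  (2 <= n)%nat -> (J < n)%nat ->
  planar T b (INR J - INR n / 2) (INR n - 4) C s D M G e1 e2 ->
  INR J <= INR n / 2.
Proof.
  intros Hn HJ H. apply Rnot_lt_le. intros Hlt.
  destruct (le_lt_dec 4 n) as [H4|H4].
  - apply le_INR in H4. simpl in H4.
    apply (planar_excess_growth _ _ _ _ _ _ _ _ _ _ _ H); lra.
  - assert (HJ2 : (n < 2 * J)%nat).
    { apply INR_lt. rewrite mult_INR. simpl. lra. }
    assert (n = 3%nat) by lia. assert (J = 2%nat) by lia. subst n J.
    simpl in H. replace (1 + 1 - (1 + 1 + 1) / 2) with (1 / 2) in H by field.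
    replace (1 + 1 + 1 - 4) with (-1) in H by ring.
    exact (planar_excess_three _ _ _ _ _ _ _ _ _ H).
Qed.

Lemma planar_G_conv (n J : nat) T b C s D M G e1 e2 :
  (2 <= n)%nat -> (J < n)%nat ->
  planar T b (INR J - INR n / 2) (INR n - 4) C s D M G e1 e2 ->
  exists g, conv b G g.
Proof.
  intros Hn HJ H. assert (HJn := planar_multiplicity_le _ _ _ _ _ _ _ _ _ _ _ Hn HJ H).
  destruct (le_lt_dec n 4) as [H4|H4].
  - apply le_INR in H4. simpl in H4.
    apply (planar_G_conv_nonpos _ _ _ _ _ _ _ _ _ _ _ H); lra.
  - assert (HN : INR n - 4 = INR (n - 4)) by (rewrite minus_INR by lia; simpl; ring).
    rewrite HN in H. apply (planar_G_conv_pos _ _ _ _ _ _ _ _ _ _ _ H); [lia|].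
    (* The balanced case [J = n/2] cannot occur for [n > 4]: there [nu > 0] alone would already make
       [G] diverge. *)
    apply Rnot_le_lt. intros Ha.
    assert (1 <= INR (n - 4)) by (apply (le_INR 1); lia).
    apply (planar_excess_growth _ _ _ _ _ _ _ _ _ _ _ H); lra.
Qed.

(** With a negative limiting rate [G] would decay to 0; then [M] would have a drift close to
    [1/4 - l^2 > 0] per unit of [s] and leave its bounds. *)
Lemma planar_rate_nonneg T b a nu C s D M G e1 e2 l :
  planar T b a nu C s D M G e1 e2 -> conv b M l -> 0 <= l < 1 / 2 -> 0 <= nu * l + a.
Proof.
  intros H Hl Hl2. apply Rnot_lt_le. intros Hk.
  set (ka := nu * l + a) in *.
  assert (Hc1 : conv b (fun t => nu * M t + a) ka).
  { apply conv_plus; [|apply conv_const]. apply conv_mult; [apply conv_const|easy]. }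
  assert (Hk2 : ka < ka / 2) by lra.
  destruct (planar_ev _ H (conv_lt_ev b _ ka (ka / 2) Hc1 Hk2)) as [T1 [HT1 [H1 Hrate]]].
  assert (HG0 : conv b G 0).
  { apply (conv0_of_ln b G (fun t => - ln (G t))).
    - apply (at_left_intro b T1); [apply H1|apply H1].
    - apply (to_pinf_of_drift T1 b (- ka / 2) C s D _ (fun t => - (D t * (nu * M t + a) + e2 t)));
        try apply H1; try lra.
      + intros t Ht. now apply (is_derive_opp (fun t => ln (G t))), (planar_lnG H1).
      + intros t Ht. specialize (Hrate t Ht).
        generalize (pl_e2 H1 t Ht) (pl_D1 H1 t Ht). intros P1 P2.
        assert (0 <= D t * (ka / 2 - (nu * M t + a))) by (apply Rmult_le_pos; lra). lra.
    - apply filter_forall. intros t. lra. }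
  set (dl := (1 / 4 - l ^ 2) / 2).
  assert (Hdl : 0 < dl) by (unfold dl; nra).
  assert (Hc2 : conv b (fun t => (1 / 4 + (-1) * (M t * M t)) + (-1) * G t)
                  ((1 / 4 + (-1) * (l * l)) + (-1) * 0)).
  { apply conv_plus; [apply conv_plus; [apply conv_const|]|].
    - apply conv_mult; [apply conv_const|now apply conv_mult].
    - apply conv_mult; [apply conv_const|easy]. }
  assert (Hlim : dl < (1 / 4 + (-1) * (l * l)) + (-1) * 0) by (unfold dl in *; simpl in *; lra).
  destruct (planar_ev _ H1 (conv_gt_ev b _ _ dl Hc2 Hlim)) as [T2 [HT2 [H2 Hrate2]]].
  assert (HM : to_pinf b M).
  { apply (to_pinf_of_drift T2 b dl 0 s D M _ (pl_T H2) Hdl (pl_s H2) (pl_sinf H2) (pl_M H2)).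
    intros t Ht. specialize (Hrate2 t Ht).
    generalize (pl_e1 H2 t Ht) (pl_D1 H2 t Ht). intros P1 P2.
    assert (0 <= D t * (1 / 4 - M t ^ 2 - G t - dl)) by (apply Rmult_le_pos; simpl; lra). lra. }
  destruct (at_left_witness b T2 _ (pl_T H2) (proj1 (to_pinf_iff _ _) HM 1)) as [t [Ht HMt]].
  generalize (pl_M1 H2 t Ht). lra.
Qed.

(** The rate of [ln rho] in [s] tends to [a + n l], which exceeds the limiting rate [(n - 4) l + a]
    of [G] by [4 l]. The latter is nonnegative for [l < 1/2], and for [l = 1/2] the rate [a + n l]
    is [J]. If [l = 0] the limiting rate may vanish, but then [a >= 0], so [ln rho - n / 2 * ln D]
    is bounded below and [D -> +oo] suffices. *)
Lemma planar_rho_pinf (n J : nat) T b C s D M G e1 e2 rho l :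
  (2 <= n)%nat -> (1 <= J < n)%nat ->
  planar T b (INR J - INR n / 2) (INR n - 4) C s D M G e1 e2 ->
  conv b M l -> 0 <= l <= 1 / 2 ->
  (forall t, T < t < b -> 0 < rho t) ->
  (forall t, T < t < b ->
     is_derive rho t (rho t * (D t * (INR J - INR n / 2 + INR n * M t) + e2 t))) ->
  to_pinf b rho.
Proof.
  intros Hn HJ H Hl Hl2 Hr0 Hr. set (a := INR J - INR n / 2) in *.
  assert (Hn2 : 2 <= INR n) by now apply (le_INR 2).
  assert (HJ1 : 1 <= INR J) by (apply (le_INR 1); lia).
  apply to_pinf_of_ln; [apply (at_left_intro b T); [apply H|easy]|].
  assert (Hlr : forall t, T < t < b ->
    is_derive (fun t => ln (rho t)) t (D t * (a + INR n * M t) + e2 t)).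
  { intros t Ht. eapply is_derive_eq; [apply is_derive_ln_comp; [now apply Hr|now apply Hr0]|].
    field. apply Rgt_not_eq. now apply Hr0. }
  assert (Hcase : 0 < a + INR n * l \/ 0 <= a).
  { destruct (Rlt_dec l (1 / 2)) as [Hlt|Hge].
    - assert (Hnn := planar_rate_nonneg _ _ _ _ _ _ _ _ _ _ _ _ H Hl (conj (proj1 Hl2) Hlt)).
      destruct (Rle_lt_or_eq_dec 0 l (proj1 Hl2)) as [Hp|Hz]; [left; lra|right; subst l; lra].
    - left. assert (l = 1 / 2) by lra. subst l. unfold a. lra. }
  destruct Hcase as [Hc|Hc].
  - set (ka := a + INR n * l) in *.
    assert (Hc1 : conv b (fun t => a + INR n * M t) ka).
    { apply conv_plus; [apply conv_const|]. apply conv_mult; [apply conv_const|easy]. }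
    assert (Hk2 : ka / 2 < ka) by lra.
    destruct (planar_ev _ H (conv_gt_ev b _ ka (ka / 2) Hc1 Hk2)) as [T1 [HT1 [H1 Hrate]]].
    apply (to_pinf_of_drift T1 b (ka / 2) 0 s D _ (fun t => D t * (a + INR n * M t) + e2 t));
      try apply H1; try lra.
    + intros t Ht. apply Hlr. lra.
    + intros t Ht. specialize (Hrate t Ht).
      generalize (pl_e2 H1 t Ht) (pl_D1 H1 t Ht). intros P1 P2.
      assert (0 <= D t * (a + INR n * M t - ka / 2)) by (apply Rmult_le_pos; lra). lra.
  - assert (Hd : forall t, T < t < b ->
      is_derive (fun t => ln (rho t) - INR n / 2 * ln (D t)) t (a * D t + e2 t)).
    { intros t Ht. eapply is_derive_eq.
      { apply is_derive_Rminus; [now apply Hlr|apply is_derive_Rscal; now apply (planar_lnD H)]. } field. }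
    destruct (drift_lower T b 0 _ _ (pl_T H) Hd) as [K HK].
    { intros t Ht. generalize (pl_e2 H t Ht) (pl_D1 H t Ht). intros P1 P2.
      assert (0 <= a * D t) by (apply Rmult_le_pos; lra). lra. }
    apply to_pinf_le with (fun t => INR n / 2 * ln (D t) + K).
    + revert HK. apply filter_imp. intros t Ht. lra.
    + apply to_pinf_affine; [lra|]. apply to_pinf_ln. apply H.
Qed.

(** * The linearized REP system *)

(* [A i] is a primitive of [l i], so that [u_i = exp (A i)] solves the linear equation
   [u'' = ka (r - cb) u]; [rep_W] is the constancy of the Wronskian of [u_i], [u_j]. *)
Record rep (n : nat) (ka cb b : R) (l : nat -> R -> R) (r : R -> R)
  (A : nat -> R -> R) (dd : nat -> R) : Prop := {
  rep_b : 0 < b;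
  rep_n : (2 <= n)%nat;
  rep_ka : 0 < ka;
  rep_cb : 0 < cb;
  rep_l : forall i t, (1 <= i <= n)%nat -> 0 < t < b ->
    is_derive (l i) t (- l i t ^ 2 + ka * (r t - cb));
  rep_r : forall t, 0 < t < b ->
    is_derive r t (- r t * sum_n_m (fun i => l i t) 1 n);
  rep_pos : forall t, 0 < t < b -> 0 < r t;
  rep_A : forall i t, (1 <= i <= n)%nat -> 0 < t < b -> is_derive (A i) t (l i t);
  rep_W : forall i j t, (1 <= i <= n)%nat -> (1 <= j <= n)%nat -> 0 < t < b ->
    exp (A i t + A j t) * (l j t - l i t) = dd j - dd i;
  rep_ord : forall i, (1 <= i <= n)%nat -> dd 1%nat <= dd i <= dd n }.

Arguments rep_b {n ka cb b l r A dd}.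
Arguments rep_n {n ka cb b l r A dd}.
Arguments rep_ka {n ka cb b l r A dd}.
Arguments rep_cb {n ka cb b l r A dd}.
Arguments rep_l {n ka cb b l r A dd}.
Arguments rep_r {n ka cb b l r A dd}.
Arguments rep_pos {n ka cb b l r A dd}.
Arguments rep_A {n ka cb b l r A dd}.
Arguments rep_W {n ka cb b l r A dd}.
Arguments rep_ord {n ka cb b l r A dd}.

Ltac rep_use H :=
  cbv beta;
  lazymatch type of H with
  | rep _ _ _ _ ?l ?r ?A _ =>
    lazymatch goal with
    | |- is_derive (l _) _ _ => apply (rep_l H)
    | |- is_derive (fun t => l ?i t) _ _ => apply (rep_l H i)
    | |- is_derive (A _) _ _ => apply (rep_A H)
    | |- is_derive (fun t => A ?i t) _ _ => apply (rep_A H i)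
    | |- 0 < r _ => apply (rep_pos H)
    | |- r _ > 0 => apply (rep_pos H)
    | |- 0 < _ => first [apply (rep_ka H) | apply (rep_cb H)]
    | |- _ <= _ => apply (rep_ord H)
    end
  end.

Lemma rep_le n ka cb b l r A dd i j t :
  rep n ka cb b l r A dd -> (1 <= i <= n)%nat -> (1 <= j <= n)%nat -> 0 < t < b ->
  dd i <= dd j -> l i t <= l j t.
Proof.
  intros H Hi Hj Ht Hd. assert (HW := rep_W H i j t Hi Hj Ht).
  apply Rnot_lt_le. intros Hlt.
  assert (0 < exp (A i t + A j t) * (l i t - l j t)).
  { apply Rmult_lt_0_compat; [apply exp_pos|lra]. } lra.
Qed.

Lemma rep_between n ka cb b l r A dd i t :
  rep n ka cb b l r A dd -> (1 <= i <= n)%nat -> 0 < t < b ->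
  l 1%nat t <= l i t <= l n t.
Proof.
  intros H Hi Ht. assert (Hn := rep_n H).
  split; apply (rep_le _ _ _ _ _ _ _ _ _ _ _ H); try lia; try easy; now rep_use H.
Qed.

Lemma deriv_nonneg_le_cc (f g : R -> R) (x y : R) :
  x <= y ->
  (forall t, x <= t <= y -> is_derive f t (g t)) ->
  (forall t, x <= t <= y -> 0 <= g t) -> f x <= f y.
Proof.
  intros Hxy Hd Hg. destruct (MVT_gen f x y g) as [c [Hc Heq]].
  - intros t. rewrite Rmin_left, Rmax_right by lra. intros Ht. apply Hd. lra.
  - intros t. rewrite Rmin_left, Rmax_right by lra. intros Ht.
    apply (is_derive_cont_pt f t (g t)). now apply Hd.
  - rewrite Rmin_left, Rmax_right in Hc by lra.
    assert (0 <= g c * (y - x)) by (apply Rmult_le_pos; [now apply Hg|lra]). lra.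
Qed.

(* Comparison of [u_i] with the solution of [v'' = - w^2 v] having the same data at [t]. *)
Lemma rep_sturm n ka cb b l r A dd w i t T :
  rep n ka cb b l r A dd -> (1 <= i <= n)%nat -> 0 < w -> w ^ 2 = ka * cb ->
  0 < t -> t <= T -> T < b -> w * (T - t) <= PI ->
  exp (A i t) * (cos (w * (T - t)) + l i t / w * sin (w * (T - t))) <= exp (A i T).
Proof.
  intros H Hi Hw Hw2 Ht HtT HT HPI.
  (* Duhamel's formula as monotonicity in [s]: the expression below is the value at [T] of the
     solution of [v'' = - w^2 v] with the data of [u_i] at time [s], and its derivative in [s]
     contains only the nonnegative source [ka * r * u_i]. *)
  replace (exp (A i T)) with
    (exp (A i T) * (cos (w * (T - T)) + l i T / w * sin (w * (T - T)))).
  2: { rewrite Rminus_diag, Rmult_0_r, cos_0, sin_0. ring. }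
  apply (deriv_nonneg_le_cc
    (fun s => exp (A i s) * (cos (w * (T - s)) + l i s / w * sin (w * (T - s))))
    (fun s => exp (A i s) * (sin (w * (T - s)) * (ka * r s / w)))); [easy| |].
  - intros s Hs. assert (Hs' : 0 < s < b) by lra.
    assert (D1 : is_derive (fun s => cos (w * (T - s))) s (w * sin (w * (T - s))))
      by (auto_derive; [easy|unfold Rminus; ring]).
    assert (D2 : is_derive (fun s => / w * sin (w * (T - s))) s (- cos (w * (T - s))))
      by (auto_derive; [easy|unfold Rminus; field; lra]).
    eapply is_derive_eq.
    { apply (is_derive_Rmult (fun s => exp (A i s))
        (fun s => cos (w * (T - s)) + l i s / w * sin (w * (T - s)))).
      - apply is_derive_exp_comp. now rep_use H.
      - apply (is_derive_ext (fun s => cos (w * (T - s)) + l i s * (/ w * sin (w * (T - s))))).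
        + intros x. simpl. unfold Rdiv. ring.
        + apply (is_derive_Rplus (fun s => cos (w * (T - s))) (fun s => l i s * (/ w * sin (w * (T - s)))));
            [exact D1|]. apply (is_derive_Rmult (l i)); [now rep_use H|exact D2]. }
    simpl. replace (ka * (r s - cb)) with (ka * r s - w ^ 2) by (rewrite Hw2; ring).
    field. lra.
  - intros s Hs. apply Rmult_le_pos; [left; apply exp_pos|]. apply Rmult_le_pos.
    + apply sin_ge_0; [apply Rmult_le_pos; lra|].
      apply Rle_trans with (2 := HPI). apply Rmult_le_compat_l; lra.
    + assert (0 < r s) by (rep_use H; lra). left. apply Rdiv_lt_0_compat; [|easy].
      apply Rmult_lt_0_compat; [rep_use H|easy].
Qed.

(** A positive comparison value at time [b] would, by continuity, keep [u_i] above a positive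
    constant near [b]. For [w (b - t) < PI] the inequality reads [l_i <= - w cot (w (b - t))]; it
    yields the divergence of [l_i] as [t -> b] and the lower bound on [b] as [t -> 0]. *)
Lemma rep_cot_bound n ka cb b l r A dd w i t :
  rep n ka cb b l r A dd -> (1 <= i <= n)%nat -> 0 < w -> w ^ 2 = ka * cb ->
  (forall c, ~ at_left b (fun t => c <= A i t)) ->
  0 < t < b -> w * (b - t) <= PI ->
  cos (w * (b - t)) + l i t / w * sin (w * (b - t)) <= 0.
Proof.
  intros H Hi Hw Hw2 Hnb Ht HPI. apply Rnot_lt_le. intros Hpos.
  set (c := fun T => cos (w * (T - t)) + l i t / w * sin (w * (T - t))).
  assert (Hc : conv b c (c b)).
  { apply conv_of_continuous. apply (ex_derive_continuous c). unfold c. auto_derive. easy. }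
  assert (Hc2 : c b / 2 < c b) by (unfold c; lra).
  apply (Hnb (A i t + ln (c b / 2))).
  generalize (filter_and _ _ (at_left_ge b t (proj2 Ht)) (conv_gt_ev b c _ _ Hc Hc2)).
  apply filter_imp. intros T [HT HcT].
  assert (Hcb : 0 < c b / 2) by (unfold c; lra).
  assert (HS := rep_sturm n ka cb b l r A dd w i t T H Hi Hw Hw2).
  assert (HPI2 : w * (T - t) <= PI).
  { apply Rle_trans with (2 := HPI). apply Rmult_le_compat_l; lra. }
  specialize (HS ltac:(lra) ltac:(lra) ltac:(lra) HPI2).
  change (exp (A i t) * c T <= exp (A i T)) in HS.
  rewrite <- (ln_exp (A i T)). rewrite <- (ln_exp (A i t)). rewrite <- ln_mult; [|apply exp_pos|easy].
  apply ln_le; [apply Rmult_lt_0_compat; [apply exp_pos|easy]|].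
  apply Rle_trans with (2 := HS). apply Rmult_le_compat_l; [left; apply exp_pos|lra].
Qed.

Lemma rep_l_minf n ka cb b l r A dd i :
  rep n ka cb b l r A dd -> (1 <= i <= n)%nat ->
  (forall c, ~ at_left b (fun t => c <= A i t)) ->
  to_pinf b (fun t => - l i t).
Proof.
  intros H Hi Hnb. set (w := sqrt (ka * cb)).
  assert (Hkc : 0 < ka * cb) by (apply Rmult_lt_0_compat; rep_use H).
  assert (Hw : 0 < w) by now apply sqrt_lt_R0.
  assert (Hw2 : w ^ 2 = ka * cb) by (unfold w; apply pow2_sqrt; lra).
  assert (HPI := PI_RGT_0). assert (Hb := rep_b H).
  apply to_pinf_iff. intros K.
  (* The first bound gives [w * (b - t) < PI / 3], so that the cosine is at least [1/2]; the second
     gives [K * (b - t) < 1/2]. *)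
  set (e := Rmin (PI / 3 / w) (/ (2 * (Rabs K + 1)))).
  assert (HK : 0 < Rabs K + 1) by (generalize (Rabs_pos K); lra).
  assert (He : 0 < e).
  { apply Rmin_glb_lt; [|apply Rinv_0_lt_compat; lra]. apply Rdiv_lt_0_compat; lra. }
  apply (at_left_intro b (Rmax 0 (b - e))); [apply Rmax_lub_lt; lra|]. intros t Ht.
  assert (Ht0 : 0 < t) by (apply Rle_lt_trans with (1 := Rmax_l 0 (b - e)); lra).
  assert (Hte : b - e < t) by (apply Rle_lt_trans with (1 := Rmax_r 0 (b - e)); lra).
  set (x := b - t). assert (Hx : 0 < x < e) by (unfold x; lra).
  assert (He1 : e <= PI / 3 / w) by apply Rmin_l.
  assert (He2 : e <= / (2 * (Rabs K + 1))) by apply Rmin_r.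
  assert (Hwx : 0 < w * x < PI / 3).
  { split; [now apply Rmult_lt_0_compat|]. apply Rlt_le_trans with (w * (PI / 3 / w)).
    - apply Rmult_lt_compat_l; lra.
    - right. field. lra. }
  assert (HB := rep_cot_bound n ka cb b l r A dd w i t H Hi Hw Hw2 Hnb ltac:(lra)).
  specialize (HB ltac:(fold x; lra)). fold x in HB.
  assert (Hcos : 1 / 2 <= cos (w * x)).
  { rewrite <- cos_PI3. left. apply cos_decreasing_1; lra. }
  assert (Hsin : 0 < sin (w * x)) by (apply sin_gt_0; lra).
  assert (Hsin2 : sin (w * x) < w * x) by (apply sin_lt_x; lra).
  assert (HKx : K * x < 1 / 2).
  { apply Rle_lt_trans with (Rabs K * x); [apply Rmult_le_compat_r; [lra|apply Rle_abs]|].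
    assert (Hx2 : x < / (2 * (Rabs K + 1))) by lra.
    apply (Rmult_lt_compat_l (Rabs K + 1)) in Hx2; [|easy].
    replace ((Rabs K + 1) * / (2 * (Rabs K + 1))) with (1 / 2) in Hx2 by (field; lra). lra. }
  apply Rnot_le_lt. intros Hle.
  assert (Hl : - K <= l i t) by lra.
  assert (HH : l i t / w * sin (w * x) <= - (1 / 2)) by lra.
  destruct (Rle_lt_dec 0 (l i t)) as [Hl0|Hl0].
  - assert (0 <= l i t / w * sin (w * x)); [|lra].
    apply Rmult_le_pos; [|lra]. apply Rdiv_le_0_compat; lra.
  - assert (E : l i t * x <= l i t / w * sin (w * x)).
    { replace (l i t * x) with (l i t / w * (w * x)) by (field; lra).
      apply Rmult_le_compat_neg_l; [|lra].
      assert (0 <= - l i t / w) by (apply Rdiv_le_0_compat; lra).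
      unfold Rdiv in *. lra. }
    assert (- K * x <= l i t * x) by (apply Rmult_le_compat_r; lra). lra.
Qed.

(** Absence of a lower bound improves to a limit because [l i < 0] near [b], so that [A i] is
    eventually nonincreasing. *)
Lemma rep_A_minf n ka cb b l r A dd i :
  rep n ka cb b l r A dd -> (1 <= i <= n)%nat ->
  (forall c, ~ at_left b (fun t => c <= A i t)) ->
  to_pinf b (fun t => - A i t).
Proof.
  intros H Hi Hnb. assert (Hb := rep_b H).
  assert (Hl := proj1 (to_pinf_iff _ _) (rep_l_minf _ _ _ _ _ _ _ _ _ H Hi Hnb) 0).
  apply at_left_iff in Hl. destruct Hl as [T [HT Hl]].
  apply to_pinf_iff. intros K.
  assert (HT' : Rmax 0 T < b) by now apply Rmax_lub_lt.
  destruct (not_at_left b _ _ HT' (Hnb (- K))) as [t0 [Ht0 HA]].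
  apply (at_left_intro b t0); [lra|]. intros t Ht.
  assert (A i t <= A i t0); [|lra].
  generalize (Rmax_l 0 T) (Rmax_r 0 T). intros P1 P2.
  apply (deriv_nonpos_le (Rmax 0 T) b (A i) (l i)); try lra.
  - intros s Hs. rep_use H; [easy|lra].
  - intros s Hs. specialize (Hl s ltac:(lra)). lra.
Qed.

Lemma rep_sum_bounds n ka cb b l r A dd t :
  rep n ka cb b l r A dd -> 0 < t < b ->
  INR n * l 1%nat t <= sum_n_m (fun i => l i t) 1 n <= INR n * l n t /\
  sum_n_m (fun i => l i t) 1 n <= l 1%nat t + (INR n - 1) * l n t.
Proof.
  intros H Ht. assert (Hn := rep_n H). split; [split|].
  - rewrite <- sum_n_m_const_1. apply sum_n_m_le_loc. intros j Hj.
    now apply (rep_between _ _ _ _ _ _ _ _ _ _ H).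
  - rewrite <- sum_n_m_const_1. apply sum_n_m_le_loc. intros j Hj.
    now apply (rep_between _ _ _ _ _ _ _ _ _ _ H).
  - rewrite sum_Sn_m by lia. apply Rplus_le_compat_l.
    replace (INR n - 1) with (INR (S n - 2)) by (rewrite minus_INR, S_INR by lia; simpl; ring).
    rewrite <- sum_n_m_const. clear - H Ht Hn.
    assert (Hg : forall m, (m <= n)%nat ->
      sum_n_m (fun i => l i t) 2 m <= sum_n_m (fun _ => l n t) 2 m).
    { induction m as [|m IH]; intros Hm.
      - rewrite 2!sum_n_m_zero by lia. apply Rle_refl.
      - destruct (le_lt_dec 2 (S m)) as [Hm2|Hm2].
        + rewrite 2!sum_n_Sm by lia. apply Rplus_le_compat; [apply IH; lia|].
          apply (rep_between _ _ _ _ _ _ _ _ _ _ H); [lia|easy].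
        + rewrite 2!sum_n_m_zero by lia. apply Rle_refl. }
    now apply Hg.
Qed.

(* [r] is proportional to [exp (- sum A_i)]; only comparisons are needed. *)
Lemma rep_ln_r_mono n ka cb b l r A dd (B g : R -> R) :
  rep n ka cb b l r A dd ->
  (forall t, 0 < t < b -> is_derive B t (g t)) ->
  (forall t, 0 < t < b -> sum_n_m (fun i => l i t) 1 n <= g t) ->
  exists c, at_left b (fun t => c - B t <= ln (r t)).
Proof.
  intros H HB Hg. assert (Hb := rep_b H).
  destruct (drift_lower 0 b 0 (fun t => ln (r t) + B t)
    (fun t => - sum_n_m (fun i => l i t) 1 n + g t)) as [c Hc]; [easy| | |].
  - intros t Ht. apply is_derive_Rplus; [|now apply HB]. eapply is_derive_eq.
    { apply is_derive_ln_comp; [now apply (rep_r H)|now rep_use H]. }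
    field. apply Rgt_not_eq. now rep_use H.
  - intros t Ht. specialize (Hg t Ht). lra.
  - exists c. revert Hc. apply filter_imp. intros t Ht. lra.
Qed.

Lemma rep_r_upper n ka cb b l r A dd :
  rep n ka cb b l r A dd -> exists c, at_left b (fun t => ln (r t) <= c - INR n * A 1%nat t).
Proof.
  intros H. assert (Hb := rep_b H). assert (Hn := rep_n H).
  destruct (drift_upper 0 b 0 (fun t => ln (r t) + INR n * A 1%nat t)
    (fun t => - sum_n_m (fun i => l i t) 1 n + INR n * l 1%nat t)) as [c Hc]; [easy| | |].
  - intros t Ht. apply is_derive_Rplus; [|apply is_derive_Rscal; rep_use H; [lia|easy]]. eapply is_derive_eq.
    { apply is_derive_ln_comp; [now apply (rep_r H)|now rep_use H]. }
    field. apply Rgt_not_eq. now rep_use H.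
  - intros t Ht. generalize (rep_sum_bounds _ _ _ _ _ _ _ _ t H Ht). lra.
  - exists c. revert Hc. apply filter_imp. intros t Ht. lra.
Qed.

Lemma exp_le (x y : R) : x <= y -> exp x <= exp y.
Proof. intros [Hlt| ->]; [left; now apply exp_increasing|apply Rle_refl]. Qed.

(** A chain of one-sided bounds. The bound on [A 1] bounds [r], so [l n] has derivative at most
    [ka * R0] and is bounded above; hence so is [A 1], whose derivative is at most [l n]. Now [u_1']
    has a derivative bounded below, and dividing by [u_1 >= exp c] bounds [l 1] below. All [l i] lie
    between [l 1] and [l n]. *)
Lemma rep_bounded_of_A1 n ka cb b l r A dd c :
  rep n ka cb b l r A dd -> at_left b (fun t => c <= A 1%nat t) ->
  exists K, 0 <= K /\ at_left b (fun t => Rabs (r t) <= K /\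
    forall i, (1 <= i <= n)%nat -> Rabs (l i t) <= K).
Proof.
  intros H Hc. assert (Hb := rep_b H). assert (Hn := rep_n H).
  assert (Hka := rep_ka H). assert (Hcb := rep_cb H).
  destruct (rep_r_upper _ _ _ _ _ _ _ _ H) as [c1 Hc1].
  set (R0 := exp (c1 - INR n * c)). assert (HR0 : 0 < R0) by apply exp_pos.
  assert (Hr : at_left b (fun t => 0 < t < b /\ 0 < r t <= R0 /\ c <= A 1%nat t)).
  { generalize (filter_and _ _ (filter_and _ _ Hc Hc1) (at_left_ge b 0 Hb)).
    apply filter_imp. intros t [[E1 E2] E3]. split; [exact E3|].
    assert (0 < r t) by now rep_use H. split; [|easy]. split; [easy|].
    rewrite <- (exp_ln (r t)) by easy. apply exp_le.
    assert (INR n * c <= INR n * A 1%nat t) by (apply Rmult_le_compat_l; [apply pos_INR|easy]). lra. }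
  apply at_left_iff in Hr. destruct Hr as [T [HT Hr]].
  assert (Hln : exists K1, at_left b (fun t => l n t <= K1)).
  { apply (drift_upper T b (ka * R0) (l n) (fun t => - l n t ^ 2 + ka * (r t - cb)) HT).
    - intros t Ht. rep_use H; [lia|]. now apply Hr.
    - intros t Ht. destruct (Hr t Ht) as [_ [E _]]. generalize (pow2_ge_0 (l n t)).
      assert (ka * (r t - cb) <= ka * R0) by (apply Rmult_le_compat_l; lra). lra. }
  destruct Hln as [K1 HK1]. apply at_left_iff in HK1. destruct HK1 as [T1 [HT1 HK1]].
  assert (HTT : Rmax T T1 < b) by now apply Rmax_lub_lt.
  generalize (Rmax_l T T1) (Rmax_r T T1). intros P1 P2.
  destruct (drift_upper (Rmax T T1) b K1 (A 1%nat) (l 1%nat) HTT) as [K2 HK2].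
  { intros t Ht. rep_use H; [lia|]. apply Hr. lra. }
  { intros t Ht. apply Rle_trans with (l n t); [|apply HK1; lra].
    apply (rep_between _ _ _ _ _ _ _ _ _ _ H); [lia|]. apply Hr. lra. }
  apply at_left_iff in HK2. destruct HK2 as [T2 [HT2 HK2]].
  assert (HTT2 : Rmax (Rmax T T1) T2 < b) by now apply Rmax_lub_lt.
  generalize (Rmax_l (Rmax T T1) T2) (Rmax_r (Rmax T T1) T2). intros P3 P4.
  destruct (drift_lower (Rmax (Rmax T T1) T2) b (- (exp K2 * (ka * cb)))
    (fun t => exp (A 1%nat t) * l 1%nat t)
    (fun t => exp (A 1%nat t) * (ka * (r t - cb))) HTT2) as [K3 HK3].
  { intros t Ht. destruct (Hr t) as [E _]; [lra|]. eapply is_derive_eq.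
    { apply (is_derive_Rmult (fun t => exp (A 1%nat t)) (l 1%nat)).
      - apply is_derive_exp_comp. rep_use H; [lia|easy].
      - rep_use H; [lia|easy]. }
    simpl. ring. }
  { intros t Ht. destruct (Hr t) as [E1 [E2 E3]]; [lra|].
    assert (E4 : exp (A 1%nat t) <= exp K2) by (apply exp_le, HK2; lra).
    assert (E5 : 0 < exp (A 1%nat t)) by apply exp_pos.
    assert (0 <= exp (A 1%nat t) * (ka * r t)).
    { apply Rmult_le_pos; [lra|]. apply Rmult_le_pos; lra. }
    assert (exp (A 1%nat t) * (ka * cb) <= exp K2 * (ka * cb)).
    { apply Rmult_le_compat_r; [|easy]. apply Rmult_le_pos; lra. }
    lra. }
  set (K4 := Rabs K3 * exp (- c)).
  assert (HK4 : 0 <= K4) by (apply Rmult_le_pos; [apply Rabs_pos|left; apply exp_pos]).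
  exists (R0 + Rabs K1 + K4). split; [generalize (Rabs_pos K1); lra|].
  generalize (filter_and _ _ HK3 (at_left_ge b _ HTT2)). apply filter_imp.
  intros t [E1 Ht]. destruct (Hr t) as [E2 [E3 E4]]; [lra|].
  assert (E5 : l n t <= K1) by (apply HK1; lra).
  assert (E6 : - K4 <= l 1%nat t).
  { assert (P : 0 < exp (A 1%nat t)) by apply exp_pos.
    replace (l 1%nat t) with (exp (A 1%nat t) * l 1%nat t * exp (- A 1%nat t)).
    2: { rewrite exp_Ropp. field. lra. }
    assert (Q : exp (- A 1%nat t) <= exp (- c)) by (apply exp_le; lra).
    assert (Q0 : 0 < exp (- A 1%nat t)) by apply exp_pos.
    apply Rle_trans with (- Rabs K3 * exp (- A 1%nat t)).
    - unfold K4. assert (Rabs K3 * exp (- A 1%nat t) <= Rabs K3 * exp (- c)); [|lra].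
      apply Rmult_le_compat_l; [apply Rabs_pos|easy].
    - apply Rmult_le_compat_r; [lra|]. generalize (Rle_abs (- K3)). rewrite Rabs_Ropp. lra. }
  generalize (Rabs_pos K1) (Rle_abs K1). intros Q1 Q2. split.
  - rewrite Rabs_pos_eq; lra.
  - intros i Hi. assert (E7 := rep_between _ _ _ _ _ _ _ _ i t H Hi E2).
    apply Rabs_le. lra.
Qed.

(* If [u_n -> 0], then [r >= c u_n^(-n)] makes [u_n'^2 / 2 - c log u_n] nonincreasing:
   the repulsive force stops [u_n] before it vanishes. *)
Lemma rep_An_lower n ka cb b l r A dd :
  rep n ka cb b l r A dd -> exists c, at_left b (fun t => c <= A n t).
Proof.
  intros H. apply NNPP. intros Hn0.
  assert (Hnb : forall c, ~ at_left b (fun t => c <= A n t)).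
  { intros c Hc. apply Hn0. now exists c. }
  assert (Hb := rep_b H). assert (Hn := rep_n H).
  assert (Hka := rep_ka H). assert (Hcb := rep_cb H).
  assert (Hnn : (1 <= n <= n)%nat) by lia.
  assert (HA := rep_A_minf _ _ _ _ _ _ _ _ _ H Hnn Hnb).
  assert (Hl := rep_l_minf _ _ _ _ _ _ _ _ _ H Hnn Hnb).
  destruct (rep_ln_r_mono _ _ _ _ _ _ _ _ (fun t => INR n * A n t) (fun t => INR n * l n t) H)
    as [c Hc].
  { intros t Ht. apply is_derive_Rscal. now rep_use H. }
  { intros t Ht. apply (rep_sum_bounds _ _ _ _ _ _ _ _ t H Ht). }
  (* [A n < x0] gives [cb * u^2 <= exp c / 2], half of the lower bound for [r * u^2]: the background
     term then costs at most half of the repulsion. *)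
  set (x0 := ln (exp c / (2 * cb)) / 2).
  generalize (filter_and _ _ (filter_and _ _ (proj1 (to_pinf_iff _ _) Hl 0) Hc)
    (filter_and _ _ (at_left_ge b 0 Hb)
      (filter_and _ _ (proj1 (to_pinf_iff _ _) HA 0) (proj1 (to_pinf_iff _ _) HA (- x0))))).
  intros Hev. apply at_left_iff in Hev. destruct Hev as [T [HT Hev]].
  set (ga := ka * exp c / 2).
  assert (Hga : 0 < ga).
  { unfold ga. apply Rdiv_lt_0_compat; [|lra]. apply Rmult_lt_0_compat; [easy|apply exp_pos]. }
  destruct (drift_upper T b 0
    (fun t => 1 / 2 * (exp (A n t) * l n t) ^ 2 - ga * A n t)
    (fun t => (exp (A n t) * l n t) * (exp (A n t) * (ka * (r t - cb))) - ga * l n t) HT) as [K HK].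
  { intros t Ht. destruct (Hev t Ht) as [_ [Ht' _]]. apply is_derive_Rminus; [|apply is_derive_Rscal; now rep_use H].
    eapply is_derive_eq.
    { apply is_derive_Rscal, is_derive_sq, (is_derive_Rmult (fun t => exp (A n t)) (l n)).
      - apply is_derive_exp_comp. now rep_use H.
      - now rep_use H. }
    simpl. field. }
  { intros t Ht. destruct (Hev t Ht) as [[E1 E2] [Ht' [E3 E4]]].
    assert (Hr : 0 < r t) by now rep_use H.
    set (u := exp (A n t)). assert (Hu : 0 < u) by apply exp_pos.
    (* For [u < 1] and [n >= 2] the bound [r >= exp c * u^(-n)] may be weakened to the exponent 2,
       the one whose potential is logarithmic. *)
    assert (Hr1 : exp c <= r t * u ^ 2).
    { rewrite <- (exp_ln (r t)) by easy.
      replace (u ^ 2) with (exp (2 * A n t)) by (unfold u; simpl; rewrite Rmult_1_r, <- exp_plus; f_equal; ring).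
      rewrite <- exp_plus. apply exp_le.
      assert (2 <= INR n) by now apply (le_INR 2).
      assert (0 <= (INR n - 2) * (- A n t)) by (apply Rmult_le_pos; lra). lra. }
    assert (Hu2 : cb * u ^ 2 <= exp c / 2).
    { assert (Hlt : u ^ 2 <= exp c / (2 * cb)).
      { assert (Hp : 0 < exp c / (2 * cb)) by (apply Rdiv_lt_0_compat; [apply exp_pos|lra]).
        rewrite <- (exp_ln (exp c / (2 * cb))) by easy.
        replace (u ^ 2) with (exp (2 * A n t)) by (unfold u; simpl; rewrite Rmult_1_r, <- exp_plus; f_equal; ring).
        apply exp_le. unfold x0 in E4. lra. }
      apply (Rmult_le_compat_l cb) in Hlt; [|lra].
      replace (cb * (exp c / (2 * cb))) with (exp c / 2) in Hlt by (field; lra). easy. }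
    replace (u * l n t * (u * (ka * (r t - cb))) - ga * l n t) with
      (- (- l n t * (ka * (r t * u ^ 2 - cb * u ^ 2 - exp c / 2)))) by (unfold ga; field).
    assert (0 <= - l n t * (ka * (r t * u ^ 2 - cb * u ^ 2 - exp c / 2))); [|lra].
    apply Rmult_le_pos; [lra|]. apply Rmult_le_pos; lra. }
  apply (Hnb (- K / ga)). revert HK. apply filter_imp. intros t Ht.
  generalize (pow2_ge_0 (exp (A n t) * l n t)). intros Hsq.
  apply Rmult_le_reg_l with ga; [easy|]. replace (ga * (- K / ga)) with (- K) by (field; lra). lra.
Qed.

(** With equal extreme data [l n <= l 1], so [A 1 - A n] is bounded below and the lower bound for
    [A n] would pass to [A 1]. *)
Lemma rep_separation n ka cb b l r A dd :
  rep n ka cb b l r A dd -> (forall c, ~ at_left b (fun t => c <= A 1%nat t)) ->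
  dd 1%nat < dd n.
Proof.
  intros H Hnb. assert (Hb := rep_b H). assert (Hn := rep_n H).
  destruct (proj1 (rep_ord H n ltac:(lia))) as [Hlt|Heq]; [easy|]. exfalso.
  destruct (rep_An_lower _ _ _ _ _ _ _ _ H) as [c Hc].
  destruct (drift_lower 0 b 0 (fun t => A 1%nat t - A n t) (fun t => l 1%nat t - l n t) Hb) as [c1 Hc1].
  - intros t Ht. apply is_derive_Rminus; rep_use H; try lia; easy.
  - intros t Ht. assert (l n t <= l 1%nat t); [|lra].
    apply (rep_le _ _ _ _ _ _ _ _ _ _ _ H); try lia; [easy|]. rewrite Heq. apply Rle_refl.
  - apply (Hnb (c + c1)). generalize (filter_and _ _ Hc Hc1). apply filter_imp. intros t Ht. lra.
Qed.

Lemma rep_diff_eq n ka cb b l r A dd i j t :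
  rep n ka cb b l r A dd -> (1 <= i <= n)%nat -> (1 <= j <= n)%nat -> 0 < t < b ->
  l j t - l i t = (dd j - dd i) * exp (- (A i t + A j t)).
Proof.
  intros H Hi Hj Ht. rewrite <- (rep_W H i j t Hi Hj Ht). rewrite exp_Ropp.
  field. apply Rgt_not_eq, exp_pos.
Qed.

Lemma rep_ratio_pinf n ka cb b l r A dd :
  rep n ka cb b l r A dd -> (forall c, ~ at_left b (fun t => c <= A 1%nat t)) ->
  to_pinf b (fun t => A n t - A 1%nat t).
Proof.
  intros H Hnb. destruct (rep_An_lower _ _ _ _ _ _ _ _ H) as [c Hc]. assert (Hn := rep_n H).
  assert (HA := rep_A_minf _ _ _ _ _ _ _ _ 1%nat H ltac:(lia) Hnb).
  apply to_pinf_le with (fun t => 1 * (- A 1%nat t) + c).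
  - revert Hc. apply filter_imp. intros t Ht. lra.
  - apply to_pinf_affine; [lra|easy].
Qed.

(* [P = u_n' cos (w (b - t)) - w u_n sin (w (b - t))] is nondecreasing and [(u_n / cos)' = P / cos^2].
   If [P] stayed bounded then so would [u_n], and [P' >= c / u_1 >= c' (log (u_n / u_1))']
   would be non-integrable. *)
Lemma rep_ln_pinf n ka cb b l r A dd :
  rep n ka cb b l r A dd -> (forall c, ~ at_left b (fun t => c <= A 1%nat t)) ->
  to_pinf b (l n).
Proof.
  intros H Hnb. assert (Hb := rep_b H). assert (Hn := rep_n H).
  assert (Hka := rep_ka H). assert (Hcb := rep_cb H).
  assert (Hnn : (1 <= n <= n)%nat) by lia. assert (H1n : (1 <= 1 <= n)%nat) by lia.
  assert (Hsep := rep_separation _ _ _ _ _ _ _ _ H Hnb).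
  destruct (rep_An_lower _ _ _ _ _ _ _ _ H) as [c0 Hc0].
  set (w := sqrt (ka * cb)).
  assert (Hkc : 0 < ka * cb) by (apply Rmult_lt_0_compat; easy).
  assert (Hw : 0 < w) by now apply sqrt_lt_R0.
  assert (Hw2 : w ^ 2 = ka * cb) by (unfold w; apply pow2_sqrt; lra).
  assert (HPI := PI_RGT_0).
  (* After [T] the argument [w * (b - t)] is below [PI / 3], which keeps the cosine above [1/2]. *)
  set (T := Rmax 0 (b - PI / 3 / w)).
  assert (He : 0 < PI / 3 / w) by (apply Rdiv_lt_0_compat; lra).
  assert (HT : 0 <= T /\ b - PI / 3 / w <= T < b).
  { unfold T. split; [apply Rmax_l|]. split; [apply Rmax_r|]. apply Rmax_lub_lt; lra. }
  assert (Htrig : forall t, T < t < b -> 1 / 2 <= cos (w * (b - t)) <= 1 /\ 0 <= sin (w * (b - t))).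
  { intros t Ht.
    assert (Hx : 0 < w * (b - t) < PI / 3).
    { split; [apply Rmult_lt_0_compat; lra|]. apply Rlt_le_trans with (w * (PI / 3 / w)).
      - apply Rmult_lt_compat_l; lra.
      - right. field. lra. }
    split; [split|].
    - rewrite <- cos_PI3. left. apply cos_decreasing_1; lra.
    - apply COS_bound.
    - apply sin_ge_0; lra. }
  set (P := fun t => exp (A n t) * (l n t * cos (w * (b - t)) - w * sin (w * (b - t)))).
  set (v := fun t => exp (A n t) / cos (w * (b - t))).
  assert (D1 : forall t, is_derive (fun t => cos (w * (b - t))) t (w * sin (w * (b - t))))
    by (intros t; auto_derive; [easy|unfold Rminus; ring]).
  assert (D2 : forall t, is_derive (fun t => w * sin (w * (b - t))) t (- w ^ 2 * cos (w * (b - t))))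
    by (intros t; auto_derive; [easy|unfold Rminus; simpl; ring]).
  assert (HP : forall t, T < t < b ->
     is_derive P t (exp (A n t) * (ka * r t * cos (w * (b - t))))).
  { intros t Ht. assert (Ht' : 0 < t < b) by lra. eapply is_derive_eq.
    { apply (is_derive_Rmult (fun t => exp (A n t))
        (fun t => l n t * cos (w * (b - t)) - w * sin (w * (b - t)))).
      - apply is_derive_exp_comp. now rep_use H.
      - apply is_derive_Rminus; [|apply D2].
        apply (is_derive_Rmult (l n) (fun t => cos (w * (b - t)))); [now rep_use H|apply D1]. }
    simpl. replace (ka * (r t - cb)) with (ka * r t - w ^ 2) by (rewrite Hw2; ring). ring. }
  assert (Hv : forall t, T < t < b -> is_derive v t (P t / cos (w * (b - t)) ^ 2)).
  { intros t Ht. assert (Ht' : 0 < t < b) by lra. destruct (Htrig t Ht) as [E1 E2].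
    eapply is_derive_eq.
    { apply (is_derive_div (fun t => exp (A n t)) (fun t => cos (w * (b - t)))); [|apply D1|lra].
      apply is_derive_exp_comp. now rep_use H. }
    unfold P. field. lra. }
  assert (HPm : forall x y, T < x -> x <= y -> y < b -> P x <= P y).
  { apply (deriv_nonneg_le T b P _ HP). intros t Ht. destruct (Htrig t Ht) as [E1 E2].
    assert (0 < r t) by (rep_use H; lra).
    apply Rmult_le_pos; [left; apply exp_pos|]. apply Rmult_le_pos; [|lra].
    apply Rmult_le_pos; lra. }
  assert (HPi : to_pinf b P).
  { apply NNPP. intros HnP.
    assert (HK : exists K, forall t, T < t < b -> P t <= K).
    { apply NNPP. intros HnK. apply HnP. apply to_pinf_iff. intros K.
      apply NNPP. intros HnK2. apply HnK. exists K. intros t Ht. apply Rnot_lt_le. intros Hlt.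
      apply HnK2. apply (at_left_intro b t); [easy|]. intros s Hs.
      apply Rlt_le_trans with (1 := Hlt). apply HPm; lra. }
    destruct HK as [K HK].
    destruct (drift_upper T b (4 * Rabs K) v _ (proj2 (proj2 HT)) Hv) as [K1 HK1].
    { intros t Ht. destruct (Htrig t Ht) as [E1 E2]. specialize (HK t Ht).
      assert (Hc2 : 1 / 4 <= cos (w * (b - t)) ^ 2) by nra.
      assert (HPK : P t <= Rabs K) by (generalize (Rle_abs K); lra).
      apply Rmult_le_reg_r with (cos (w * (b - t)) ^ 2); [lra|].
      unfold Rdiv. rewrite Rmult_assoc, Rinv_l, Rmult_1_r by lra.
      generalize (Rabs_pos K). nra. }
    destruct (rep_ln_r_mono _ _ _ _ _ _ _ _ (fun t => A 1%nat t + (INR n - 1) * A n t)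
      (fun t => l 1%nat t + (INR n - 1) * l n t) H) as [c1 Hc1].
    { intros t Ht. apply is_derive_Rplus; [|apply is_derive_Rscal]; now rep_use H. }
    { intros t Ht. apply (rep_sum_bounds _ _ _ _ _ _ _ _ t H Ht). }
    set (K2 := ln (Rabs K1 + 1)).
    generalize (filter_and _ _ (filter_and _ _ HK1 Hc0)
      (filter_and _ _ Hc1 (at_left_ge b T (proj2 (proj2 HT))))). intros Hev.
    apply at_left_iff in Hev. destruct Hev as [T1 [HT1 Hev]].
    (* [l n - l 1] is [(dd n - dd 1) * exp (- (A 1 + A n))]; [de] collects the constants in the
       comparison of [P'] with it, [A n] lying between [c0] and [K2]. *)
    set (de := exp (c0 + c1 - (INR n - 1) * K2 + c0) * ka / 2 / (dd n - dd 1%nat)).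
    assert (Hde : 0 < de).
    { unfold de. repeat apply Rdiv_lt_0_compat; try lra.
      apply Rmult_lt_0_compat; [apply exp_pos|easy]. }
    apply HnP. apply (to_pinf_of_drift T1 b de 0 (fun t => A n t - A 1%nat t)
      (fun t => l n t - l 1%nat t) P (fun t => exp (A n t) * (ka * r t * cos (w * (b - t))))); try easy.
    - intros t Ht. destruct (Hev t Ht) as [_ [_ Ht']]. apply is_derive_Rminus; rep_use H; try easy; lra.
    - now apply (rep_ratio_pinf _ _ _ _ _ _ _ _ H).
    - intros t Ht. apply HP. now apply Hev.
    - intros t Ht. destruct (Hev t Ht) as [[E1 E2] [E3 Ht']]. destruct (Htrig t Ht') as [F1 F2].
      assert (Ht0 : 0 < t < b) by lra.
      assert (HAn : A n t <= K2).
      { unfold K2. rewrite <- (ln_exp (A n t)). apply ln_le; [apply exp_pos|].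
        apply Rle_trans with (v t); [|generalize (Rle_abs K1); lra].
        unfold v. apply Rmult_le_reg_r with (cos (w * (b - t))); [lra|].
        unfold Rdiv. rewrite Rmult_assoc, Rinv_l, Rmult_1_r by lra.
        generalize (exp_pos (A n t)). nra. }
      rewrite (rep_diff_eq _ _ _ _ _ _ _ _ 1%nat n t H) by easy.
      replace (de * ((dd n - dd 1%nat) * exp (- (A 1%nat t + A n t))) - 0) with
        (exp (c0 + c1 - (INR n - 1) * K2 + c0) * exp (- (A 1%nat t + A n t)) * (ka / 2))
        by (unfold de; field; lra).
      replace (exp (A n t) * (ka * r t * cos (w * (b - t)))) with
        (exp (A n t) * r t * (ka * cos (w * (b - t)))) by ring.
      rewrite <- exp_plus.
      assert (Hr : 0 < r t) by now rep_use H.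
      apply Rmult_le_compat; [left; apply exp_pos|lra| |nra].
      rewrite <- (exp_ln (r t)) by easy. rewrite <- exp_plus. apply exp_le.
      assert (2 <= INR n) by now apply (le_INR 2).
      assert ((INR n - 1) * A n t <= (INR n - 1) * K2) by (apply Rmult_le_compat_l; lra).
      lra. }
  (* If [l n < K] at a late time [t], then [P <= K u_n <= K v], while [v] has grown since [T2] at a
     rate of at most [4 P t]. The window [1 / (16 K)] limits this contribution to [P / 4], and
     [P > 2 K vT] gives a contradiction. *)
  apply to_pinf_iff. intros K0.
  set (K := Rabs K0 + 1). assert (HK : K0 < K /\ 0 < K).
  { unfold K. generalize (Rabs_pos K0) (Rle_abs K0). lra. }
  set (T2 := Rmax ((T + b) / 2) (b - / (16 * K))).
  assert (HiK : 0 < / (16 * K)) by (apply Rinv_0_lt_compat; lra).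
  assert (HT2 : T < T2 < b /\ b - / (16 * K) <= T2).
  { unfold T2. generalize (Rmax_l ((T + b) / 2) (b - / (16 * K))) (Rmax_r ((T + b) / 2) (b - / (16 * K))).
    assert (Rmax ((T + b) / 2) (b - / (16 * K)) < b) by (apply Rmax_lub_lt; lra). lra. }
  set (vT := v T2).
  assert (HvT : 0 < vT).
  { apply Rdiv_lt_0_compat; [apply exp_pos|]. destruct (Htrig T2); lra. }
  generalize (filter_and _ _ (proj1 (to_pinf_iff _ _) HPi (2 * K * vT)) (at_left_ge b T2 (proj2 (proj1 HT2)))).
  apply filter_imp. intros t [HPt Ht].
  assert (HtT : T < t < b) by lra. destruct (Htrig t HtT) as [F1 F2].
  assert (HP0 : 0 < P t).
  { apply Rle_lt_trans with (2 := HPt). apply Rmult_le_pos; lra. }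
  assert (Hvt : v t <= vT + 4 * P t * (t - T2)).
  { assert (v t - 4 * P t * t <= v T2 - 4 * P t * T2); [|unfold vT; lra].
    assert (E : - (v T2 - 4 * P t * T2) <= - (v t - 4 * P t * t)); [|lra].
    apply (deriv_nonneg_le_cc (fun s => - (v s - 4 * P t * s))
      (fun s => - (P s / cos (w * (b - s)) ^ 2 - 4 * P t))); [lra| |].
    - intros s Hs. apply (is_derive_opp (fun s => v s - 4 * P t * s)).
      apply is_derive_Rminus; [apply Hv; lra|]. apply is_derive_linear.
    - intros s Hs. destruct (Htrig s) as [G1 G2]; [lra|].
      assert (HPs : P s <= P t) by (apply HPm; lra).
      assert (Hc2 : 1 / 4 <= cos (w * (b - s)) ^ 2) by nra.
      assert (P s / cos (w * (b - s)) ^ 2 <= 4 * P t); [|lra].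
      apply Rmult_le_reg_r with (cos (w * (b - s)) ^ 2); [lra|].
      unfold Rdiv. rewrite Rmult_assoc, Rinv_l, Rmult_1_r by lra. nra. }
  assert (Hu : exp (A n t) <= v t).
  { unfold v. apply Rmult_le_reg_r with (cos (w * (b - t))); [lra|].
    unfold Rdiv. rewrite Rmult_assoc, Rinv_l, Rmult_1_r by lra.
    generalize (exp_pos (A n t)). nra. }
  apply Rlt_le_trans with (1 := proj1 HK). apply Rnot_lt_le. intros Hlt.
  assert (Hu0 := exp_pos (A n t)).
  assert (HPu : P t <= exp (A n t) * K).
  { unfold P. apply Rmult_le_compat_l; [lra|].
    assert (0 <= w * sin (w * (b - t))) by (apply Rmult_le_pos; lra).
    assert (l n t * cos (w * (b - t)) <= K * cos (w * (b - t))) by (apply Rmult_le_compat_r; lra).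
    nra. }
  assert (Hlast : K * (4 * P t * (t - T2)) <= P t / 4).
  { assert (t - T2 <= / (16 * K)) by lra.
    replace (K * (4 * P t * (t - T2))) with (4 * K * P t * (t - T2)) by ring.
    apply Rle_trans with (4 * K * P t * / (16 * K)); [|right; field; lra].
    apply Rmult_le_compat_l; [|easy]. apply Rmult_le_pos; lra. }
  assert (exp (A n t) * K <= K * vT + K * (4 * P t * (t - T2))).
  { rewrite <- Rmult_plus_distr_l, Rmult_comm. apply Rmult_le_compat_l; lra. }
  lra.
Qed.

(* [u_i] lies in the plane spanned by [u_1] and [u_n], so [u_i / u_n] has a positive limit. *)
Lemma rep_upper_gap n ka cb b l r A dd i :
  rep n ka cb b l r A dd -> (forall c, ~ at_left b (fun t => c <= A 1%nat t)) ->
  (1 <= i <= n)%nat -> dd 1%nat < dd i ->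
  exists C, at_left b (fun t => l n t - l i t <= C).
Proof.
  intros H Hnb Hi Hdi. assert (Hb := rep_b H). assert (Hn := rep_n H).
  assert (Hnn : (1 <= n <= n)%nat) by lia. assert (H1n : (1 <= 1 <= n)%nat) by lia.
  assert (Hsep := rep_separation _ _ _ _ _ _ _ _ H Hnb).
  destruct (rep_An_lower _ _ _ _ _ _ _ _ H) as [c0 Hc0].
  set (q := (dd i - dd 1%nat) / (dd n - dd 1%nat)).
  assert (Hq : 0 < q) by (apply Rdiv_lt_0_compat; lra).
  (* [f] is [u_i / u_1 - q u_n / u_1], constant by the Wronskian identities; as [u_n / u_1]
     diverges, [u_i >= (q / 2) u_n] near [b]. With [u_n] bounded below this bounds
     [l n - l i = (dd n - dd i) / (u_i u_n)]. *)
  set (f := fun t => exp (A i t - A 1%nat t) - q * exp (A n t - A 1%nat t)).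
  assert (Hf : forall t, 0 < t < b -> is_derive f t 0).
  { intros t Ht. eapply is_derive_eq.
    { apply is_derive_Rminus; [|apply is_derive_Rscal]; apply (is_derive_exp_comp (fun t => _ - _)), is_derive_Rminus; now rep_use H. }
    rewrite (rep_diff_eq _ _ _ _ _ _ _ _ 1%nat i t H), (rep_diff_eq _ _ _ _ _ _ _ _ 1%nat n t H) by easy.
    rewrite !Rmult_assoc, <- !exp_plus.
    replace (- (A 1%nat t + A i t) + (A i t - A 1%nat t)) with (- 2 * A 1%nat t) by ring.
    replace (- (A 1%nat t + A n t) + (A n t - A 1%nat t)) with (- 2 * A 1%nat t) by ring.
    unfold q. field. lra. }
  set (t0 := b / 2). assert (Ht0 : 0 < t0 < b) by (unfold t0; lra).
  exists ((dd n - dd i) * exp (- (c0 + (c0 + ln (q / 2))))).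
  generalize (filter_and _ _ (filter_and _ _ Hc0 (at_left_ge b 0 Hb))
    (proj1 (to_pinf_iff _ _) (rep_ratio_pinf _ _ _ _ _ _ _ _ H Hnb) (2 * - f t0 / q))).
  apply filter_imp. intros t [[E1 Ht] E2].
  rewrite (rep_diff_eq _ _ _ _ _ _ _ _ i n t H) by easy.
  apply Rmult_le_compat_l; [generalize (proj2 (rep_ord H i Hi)); lra|]. apply exp_le.
  assert (Hft : f t = f t0) by (now apply (deriv_zero_const 0 b f Hf)).
  assert (E3 : - f t0 <= q / 2 * exp (A n t - A 1%nat t)).
  { apply Rle_trans with (q / 2 * (2 * - f t0 / q)); [right; field; lra|].
    apply Rmult_le_compat_l; [lra|]. generalize (exp_ge_id (A n t - A 1%nat t)). lra. }
  assert (E4 : q / 2 * exp (A n t - A 1%nat t) <= exp (A i t - A 1%nat t)).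
  { rewrite <- Hft in E3. unfold f in E3. lra. }
  rewrite <- (exp_ln (q / 2)), <- exp_plus in E4 by lra.
  assert (E5 : ln (q / 2) + (A n t - A 1%nat t) <= A i t - A 1%nat t).
  { apply Rnot_lt_le. intros Hlt. apply exp_increasing in Hlt. lra. }
  lra.
Qed.

(** * Reduction to the planar system *)

Lemma sum_two_blocks (J n : nat) (x y : R) :
  sum_n_m (fun i => if le_lt_dec i J then x else y) 1 n = INR (Nat.min J n) * x + INR (n - J) * y.
Proof.
  induction n as [|n IH].
  - rewrite sum_n_m_zero by lia. rewrite Nat.min_0_r. simpl. change (zero : R) with 0. ring.
  - rewrite sum_n_Sm by lia. rewrite IH.
    match goal with |- plus ?a ?z = ?c => change (a + z = c) end.
    destruct (le_lt_dec (S n) J) as [Hle|Hlt].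
    + replace (Nat.min J (S n)) with (S (Nat.min J n)) by lia.
      replace (S n - J)%nat with (n - J)%nat by lia. rewrite S_INR. ring.
    + replace (Nat.min J (S n)) with (Nat.min J n) by lia.
      replace (S n - J)%nat with (S (n - J)) by lia. rewrite S_INR. ring.
Qed.

(** [gap] and [skew] are the [D] and [M] of the planar system; where the gap is nonzero,
    [l_1 = - gap * (1/2 + skew)] and [l_n = gap * (1/2 - skew)]. *)
Definition gap (n : nat) (l : nat -> R -> R) t := l n t - l 1%nat t.
Definition skew (n : nat) (l : nat -> R -> R) t := - (l 1%nat t + l n t) / (2 * gap n l t).

(** [e2] is the error made by replacing the sum of the [l i] by [J] copies of [l 1] and [n - J]
    copies of [l n]. It is bounded because the first [J] functions equal [l 1] and, by
    [rep_upper_gap], each other one stays within a constant of [l n]; [e1] is bounded because the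
    gap is eventually at least 1. The case [J = n] is ruled out by [rep_separation]. *)
Lemma rep_planar n ka cb b l r A dd (J : nat) :
  rep n ka cb b l r A dd -> (forall c, ~ at_left b (fun t => c <= A 1%nat t)) ->
  (1 <= J <= n)%nat ->
  (forall i, (1 <= i <= J)%nat -> dd i = dd 1%nat) ->
  (forall i, (J < i <= n)%nat -> dd 1%nat < dd i) ->
  (J < n)%nat /\
  exists T C e2, 0 <= T /\
    planar T b (INR J - INR n / 2) (INR n - 4) C (fun t => A n t - A 1%nat t)
      (gap n l) (skew n l) (fun t => ka * r t / gap n l t ^ 2) (fun t => ka * cb / gap n l t) e2 /\
    forall t, T < t < b -> is_derive r t
      (r t * (gap n l t * (INR J - INR n / 2 + INR n * skew n l t) + e2 t)).
Proof.
  intros H Hnb HJ Hlow Hup. assert (Hb := rep_b H). assert (Hn := rep_n H).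
  assert (Hka := rep_ka H). assert (Hcb := rep_cb H).
  assert (Hnn : (1 <= n <= n)%nat) by lia. assert (H1n : (1 <= 1 <= n)%nat) by lia.
  assert (Hsep := rep_separation _ _ _ _ _ _ _ _ H Hnb).
  assert (HJn : (J < n)%nat).
  { destruct (le_lt_dec n J) as [Hle|]; [|easy]. rewrite (Hlow n) in Hsep by lia. lra. }
  split; [easy|].
  assert (Hln := rep_ln_pinf _ _ _ _ _ _ _ _ H Hnb).
  assert (Hl1 := rep_l_minf _ _ _ _ _ _ _ _ 1%nat H H1n Hnb).
  destruct (finite_choice n (fun i C => (J < i)%nat -> at_left b (fun t => l n t - l i t <= C)))
    as [Cf HCf].
  { intros i Hi. destruct (le_lt_dec i J) as [Hle|Hlt]; [exists 0; lia|].
    destruct (rep_upper_gap _ _ _ _ _ _ _ _ i H Hnb ltac:(lia) (Hup i ltac:(lia))) as [C HC].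
    now exists C. }
  assert (Hall : at_left b (fun t => forall i, (i <= n)%nat -> (J < i)%nat -> l n t - l i t <= Cf i)).
  { apply filter_forall_le; [typeclasses eauto|]. intros i Hi.
    destruct (le_lt_dec i J) as [Hle|Hlt].
    - apply filter_forall. intros t Hi2. lia.
    - generalize (HCf i Hi Hlt). apply filter_imp. easy. }
  set (C2 := sum_n_m (fun i => Rabs (Cf i)) 1 n).
  assert (HC2 : 0 <= C2).
  { apply Rle_trans with (sum_n_m (fun _ => 0) 1 n); [rewrite sum_n_m_const_1; lra|].
    apply sum_n_m_le_loc. intros j Hj. apply Rabs_pos. }
  set (L := fun t => sum_n_m (fun i => l i t) 1 n).
  set (e2 := fun t => INR J * l 1%nat t + (INR n - INR J) * l n t - L t).
  set (C := ka * cb + C2).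
  generalize (filter_and _ _ (filter_and _ _ (proj1 (to_pinf_iff _ _) Hln 1) (proj1 (to_pinf_iff _ _) Hl1 0))
    (filter_and _ _ Hall (at_left_ge b 0 Hb))). intros Hev.
  apply at_left_iff in Hev. destruct Hev as [T0 [HT0 Hev0]].
  set (T := Rmax 0 T0). assert (HT : 0 <= T /\ T0 <= T /\ T < b).
  { unfold T. split; [apply Rmax_l|]. split; [apply Rmax_r|]. now apply Rmax_lub_lt. }
  assert (Hev : forall t, T < t < b -> (1 < l n t /\ 0 < - l 1%nat t) /\
    (forall i, (i <= n)%nat -> (J < i)%nat -> l n t - l i t <= Cf i) /\ 0 < t < b).
  { intros t Ht. apply Hev0. lra. }
  assert (He2 : forall t, T < t < b -> 0 <= e2 t <= C2).
  { intros t Ht. destruct (Hev t Ht) as [_ [E2 Ht']].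
    assert (EB : INR J * l 1%nat t + (INR n - INR J) * l n t =
      sum_n_m (fun i => if le_lt_dec i J then l 1%nat t else l n t) 1 n).
    { rewrite sum_two_blocks. rewrite Nat.min_l by lia. rewrite minus_INR by lia. easy. }
    unfold e2. rewrite EB. split.
    - assert (L t <= sum_n_m (fun i => if le_lt_dec i J then l 1%nat t else l n t) 1 n); [|lra].
      apply sum_n_m_le_loc. intros j Hj. destruct (le_lt_dec j J) as [Hle|Hlt].
      + apply (rep_le _ _ _ _ _ _ _ _ _ _ _ H); try easy. rewrite Hlow by lia. lra.
      + now apply (rep_between _ _ _ _ _ _ _ _ _ _ H).
    - assert (sum_n_m (fun i => if le_lt_dec i J then l 1%nat t else l n t) 1 n <= L t + C2); [|lra].
      unfold L, C2.
      apply Rle_trans with (sum_n_m (fun i => plus (l i t) (Rabs (Cf i))) 1 n).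
      2: { rewrite sum_n_m_plus. apply Rle_refl. }
      apply sum_n_m_le_loc. intros j Hj. change plus with Rplus.
      generalize (Rabs_pos (Cf j)) (Rle_abs (Cf j)). intros Q1 Q2.
      destruct (le_lt_dec j J) as [Hle|Hlt].
      + generalize (rep_between _ _ _ _ _ _ _ _ j t H Hj Ht'). lra.
      + specialize (E2 j ltac:(lia) Hlt). lra. }
  assert (HgD : forall t, T < t < b -> is_derive (gap n l) t (2 * skew n l t * gap n l t ^ 2)).
  { intros t Ht. destruct (Hev t Ht) as [E1 [_ Ht']]. eapply is_derive_eq.
    { apply is_derive_Rminus; now rep_use H. }
    unfold skew, gap. simpl. field. lra. }
  assert (Hrd : forall t, T < t < b -> is_derive r t
      (r t * (gap n l t * (INR J - INR n / 2 + INR n * skew n l t) + e2 t))).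
  { intros t Ht. destruct (Hev t Ht) as [E1 [_ Ht']]. apply is_derive_eq with (1 := rep_r H t Ht').
    fold (L t). unfold e2, skew, gap. field. lra. }
  exists T, C, e2. split; [easy|]. split; [|exact Hrd].
  assert (Hg1 : forall t, T < t < b -> 1 <= gap n l t).
  { intros t Ht. destruct (Hev t Ht) as [E1 _]. unfold gap. lra. }
  split.
  - easy.
  - intros t Ht. destruct (Hev t Ht) as [_ [_ Ht']]. apply is_derive_Rminus; now rep_use H.
  - easy.
  - intros t Ht. destruct (Hev t Ht) as [E1 [_ Ht']]. specialize (Hg1 t Ht).
    unfold skew at 1. eapply is_derive_eq.
    { apply (is_derive_div (fun t => - (l 1%nat t + l n t)) (fun t => 2 * gap n l t)); [| |lra].
      - apply (is_derive_opp (fun t => l 1%nat t + l n t)), is_derive_Rplus; now rep_use H.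
      - apply is_derive_Rscal. now apply HgD. }
    change opp with Ropp. unfold skew, gap in *. simpl. field. lra.
  - intros t Ht. destruct (Hev t Ht) as [E1 [_ Ht']]. specialize (Hg1 t Ht). eapply is_derive_eq.
    { apply (is_derive_div (fun t => ka * r t) (fun t => gap n l t ^ 2)).
      - apply is_derive_Rscal. now apply Hrd.
      - apply is_derive_sq. now apply HgD.
      - apply pow_nonzero. lra. }
    field. lra.
  - easy.
  - intros t Ht. destruct (Hev t Ht) as [E1 [_ Ht']]. unfold skew, gap. split.
    + apply Rmult_lt_reg_r with (2 * (l n t - l 1%nat t)); [lra|].
      unfold Rdiv. rewrite (Rmult_assoc (- (_ + _))), Rinv_l by lra. lra.
    + apply Rmult_lt_reg_r with (2 * (l n t - l 1%nat t)); [lra|].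
      unfold Rdiv. rewrite (Rmult_assoc (- (_ + _))), Rinv_l by lra. lra.
  - intros t Ht. destruct (Hev t Ht) as [E1 [_ Ht']]. specialize (Hg1 t Ht).
    assert (0 < r t) by now rep_use H. apply Rdiv_lt_0_compat; [now apply Rmult_lt_0_compat|].
    apply pow_lt. lra.
  - intros t Ht. specialize (Hg1 t Ht). assert (Hkc : 0 < ka * cb) by now apply Rmult_lt_0_compat.
    split; [apply Rdiv_le_0_compat; lra|]. unfold C.
    assert (ka * cb / gap n l t <= ka * cb); [|lra].
    apply Rle_trans with (ka * cb * 1); [|lra]. apply Rmult_le_compat_l; [lra|].
    rewrite <- Rinv_1. apply Rinv_le_contravar; lra.
  - intros t Ht. generalize (He2 t Ht). assert (Hkc : 0 < ka * cb) by now apply Rmult_lt_0_compat.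
    unfold C. lra.
  - apply to_pinf_le with (2 := Hln). apply (at_left_intro b T); [easy|].
    intros t Ht. destruct (Hev t Ht) as [E1 _]. unfold gap. lra.
  - now apply (rep_ratio_pinf _ _ _ _ _ _ _ _ H).
Qed.

(** * Primitives and conserved quantities of a solution; the lower bound on the blow-up time *)

Lemma zero_deriv_from_0 (b : R) (f : R -> R) :
  (forall t, 0 < t < b -> is_derive f t 0) -> continuous f 0 ->
  forall t, 0 < t < b -> f t = f 0.
Proof.
  intros Hd Hc t Ht. destruct (MVT_gen f 0 t (fun _ => 0)) as [c [_ Heq]].
  - intros x. rewrite Rmin_left, Rmax_right by lra. intros Hx. apply Hd. lra.
  - intros x. rewrite Rmin_left, Rmax_right by lra. intros Hx.
    destruct (Req_dec x 0) as [->|Hne]; [now apply continuity_pt_filterlim|].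
    apply (is_derive_cont_pt f x 0). apply Hd. lra.
  - lra.
Qed.

(* [fun t => f (Rmax 0 t)] repairs the two-sided continuity at the initial time. *)
Lemma continuous_extend_left (b : R) (f : R -> R) :
  0 < b -> filterlim f (at_right 0) (locally (f 0)) ->
  (forall t, 0 < t < b -> ex_derive f t) ->
  forall t, t < b -> continuous (fun s => f (Rmax 0 s)) t.
Proof.
  intros Hb H0 Hd t Ht. destruct (Rtotal_order t 0) as [Hn|[Hz|Hp]].
  - apply (continuous_ext_loc _ (fun _ => f 0) t); [|apply continuous_const].
    generalize (open_lt 0 t Hn). apply filter_imp. intros s Hs. rewrite Rmax_left; [easy|lra].
  - subst t. apply continuous_iff. intros e He.
    destruct (proj1 (filterlim_locally f (f 0)) H0 (mkposreal e He)) as [d Hd0].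
    exists d. intros s Hs. rewrite (Rmax_left 0 0) by lra. destruct (Rle_dec s 0) as [Hs0|Hs0].
    + rewrite Rmax_left by easy. now rewrite Rminus_diag, Rabs_R0.
    + rewrite Rmax_right by lra. apply (Hd0 s Hs). lra.
  - apply (continuous_ext_loc _ f t); [|apply (ex_derive_continuous f); now apply Hd].
    generalize (open_gt 0 t Hp). apply filter_imp. intros s Hs. rewrite Rmax_right; [easy|lra].
Qed.

Lemma primitive_from_0 (b : R) (f : R -> R) :
  0 < b -> filterlim f (at_right 0) (locally (f 0)) ->
  (forall t, 0 < t < b -> ex_derive f t) ->
  continuous (fun t => RInt (fun s => f (Rmax 0 s)) 0 t) 0 /\
  forall t, 0 < t < b ->
    RInt f 0 t = RInt (fun s => f (Rmax 0 s)) 0 t /\ is_derive (fun t => RInt f 0 t) t (f t).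
Proof.
  intros Hb H0 Hd. set (g := fun s => f (Rmax 0 s)).
  assert (Hg := continuous_extend_left b f Hb H0 Hd). fold g in Hg.
  assert (Heq : forall t, 0 < t -> RInt f 0 t = RInt g 0 t).
  { intros t Ht. apply RInt_ext. intros s. rewrite Rmin_left, Rmax_right by lra. intros Hs.
    unfold g. rewrite Rmax_right by lra. easy. }
  assert (HG : forall t, t < b -> is_derive (fun t => RInt g 0 t) t (g t)).
  { intros t Ht. apply (is_derive_RInt g (fun t => RInt g 0 t) 0 t); [|now apply Hg].
    generalize (open_lt b t Ht). apply filter_imp. intros s Hs.
    apply (RInt_correct g). apply (ex_RInt_continuous g). intros z Hz. apply Hg.
    unfold Rmax in Hz. destruct (Rle_dec 0 s); lra. }
  split.
  - apply (ex_derive_continuous (fun t => RInt g 0 t)). exists (g 0). now apply HG.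
  - intros t Ht. split; [now apply Heq|].
    apply is_derive_ext_loc with (fun t => RInt g 0 t).
    + generalize (open_gt 0 t (proj1 Ht)). apply filter_imp. intros s Hs. symmetry. now apply Heq.
    + apply is_derive_eq with (1 := HG t (proj2 Ht)). unfold g. rewrite Rmax_right by lra. easy.
Qed.

(** Positivity of [rho] and the Wronskian identities are conservation laws: [rho] times the
    exponential of the integrated sum keeps the value [rho0], and
    [exp (A i + A j) * (lam j - lam i)] its value at time 0. A solution is only known to be
    continuous from the right at 0, so the functions are extended by constants to negative times. *)
Lemma rep_of_solution (n : nat) (k cb rho0 b : R) (lam0 : nat -> R)
  (lam : nat -> R -> R) (rho : R -> R) :
  (2 <= n)%nat -> 0 < k -> 0 < cb -> 0 < rho0 -> 0 < b ->
  REP_solution n k cb rho0 lam0 b lam rho ->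
  (forall i, (1 <= i <= n)%nat -> lam0 1%nat <= lam0 i <= lam0 n) ->
  rep n (k / INR n) cb b lam rho (fun i t => RInt (lam i) 0 t) lam0.
Proof.
  intros Hn Hk Hcb Hr0 Hb [S1 [S2 [S3 [S4 S5]]]] Hord.
  assert (Hn0 : 0 < INR n) by (apply lt_0_INR; lia).
  set (A' := fun (i : nat) (t : R) => RInt (fun s => lam i (Rmax 0 s)) 0 t : R).
  assert (Hl0 : forall i, (1 <= i <= n)%nat -> filterlim (lam i) (at_right 0) (locally (lam i 0))).
  { intros i Hi. rewrite S2 by easy. now apply S4. }
  assert (Hld : forall i t, (1 <= i <= n)%nat -> 0 < t < b -> ex_derive (lam i) t).
  { intros i t Hi Ht. eexists. now apply (S5 t Ht). }
  assert (HlC : forall i t, (1 <= i <= n)%nat -> t < b -> continuous (fun s => lam i (Rmax 0 s)) t).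
  { intros i t Hi Ht. apply (continuous_extend_left b); auto. }
  assert (HA : forall i, (1 <= i <= n)%nat -> continuous (A' i) 0 /\ forall t, 0 < t < b ->
    RInt (lam i) 0 t = A' i t /\ is_derive (fun t => RInt (lam i) 0 t) t (lam i t)).
  { intros i Hi. apply primitive_from_0; auto. }
  assert (HA' : forall i t, (1 <= i <= n)%nat -> 0 < t < b -> is_derive (A' i) t (lam i t)).
  { intros i t Hi Ht. apply is_derive_ext_loc with (fun t => RInt (lam i) 0 t).
    - assert (Hlt : locally t (fun s => 0 < s < b)).
      { generalize (filter_and _ _ (open_gt 0 t (proj1 Ht)) (open_lt b t (proj2 Ht))).
        apply filter_imp. easy. }
      revert Hlt. apply filter_imp. intros s Hs. now apply HA.
    - now apply HA. }
  assert (HA0 : forall i, A' i 0 = 0) by (intros i; exact (RInt_point 0 (fun s => lam i (Rmax 0 s)))).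
  split; try assumption.
  - now apply Rdiv_lt_0_compat.
  - intros i t Hi Ht. now apply S5.
  - intros t Ht. now apply S5.
  - intros t Ht.
    set (Lx := fun t => lam_sum n lam t).
    assert (HL : forall t, t < b -> continuous (fun s => Lx (Rmax 0 s)) t).
    { intros s Hs. apply (continuous_sum_n_m (fun i s => lam i (Rmax 0 s))).
      intros j Hj. now apply HlC. }
    assert (HLd : forall t, t < b -> is_derive (fun t => RInt (fun s => Lx (Rmax 0 s)) 0 t) t (Lx (Rmax 0 t))).
    { intros s Hs. apply (is_derive_RInt (fun s => Lx (Rmax 0 s)) _ 0 s); [|now apply HL].
      generalize (open_lt b s Hs). apply filter_imp. intros x Hx.
      apply (RInt_correct (fun s => Lx (Rmax 0 s))).
      apply (ex_RInt_continuous (fun s => Lx (Rmax 0 s))). intros z Hz. apply HL.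
      unfold Rmax in Hz. destruct (Rle_dec 0 x); lra. }
    set (E := fun t => rho (Rmax 0 t) * exp (RInt (fun s => Lx (Rmax 0 s)) 0 t)).
    assert (HE : E t = E 0).
    { apply (zero_deriv_from_0 b); [| |easy].
      - intros s Hs. unfold E. eapply is_derive_eq.
        { apply (is_derive_Rmult (fun t => rho (Rmax 0 t)) (fun t => exp (RInt (fun s => Lx (Rmax 0 s)) 0 t))).
          - apply is_derive_ext_loc with rho.
            + generalize (open_gt 0 s (proj1 Hs)). apply filter_imp. intros x Hx.
              rewrite Rmax_right; [easy|lra].
            + now apply (S5 s Hs).
          - apply (is_derive_exp_comp (fun t => RInt (fun s => Lx (Rmax 0 s)) 0 t)). now apply HLd. }
        rewrite (Rmax_right 0 s) by lra. fold (Lx s). ring.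
      - apply (continuous_mult (fun t => rho (Rmax 0 t))).
        + apply (continuous_extend_left b); [easy| |intros s Hs; eexists; now apply (S5 s Hs)|easy].
          now rewrite S1.
        + apply (ex_derive_continuous (fun t => exp (RInt (fun s => Lx (Rmax 0 s)) 0 t))).
          eexists. apply (is_derive_exp_comp (fun t => RInt (fun s => Lx (Rmax 0 s)) 0 t)). now apply HLd. }
    assert (HE0 : E 0 = rho0).
    { unfold E. rewrite Rmax_left, RInt_point by lra. change (zero : R) with 0.
      rewrite exp_0, S1. ring. }
    rewrite HE0 in HE. unfold E in HE. rewrite Rmax_right in HE by lra.
    apply Rmult_lt_reg_r with (exp (RInt (fun s => Lx (Rmax 0 s)) 0 t)); [apply exp_pos|].
    rewrite HE. lra.
  - intros i t Hi Ht. now apply HA.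
  - intros i j t Hi Hj Ht.
    rewrite (proj1 (proj2 (HA i Hi) t Ht)), (proj1 (proj2 (HA j Hj) t Ht)).
    set (W := fun t => exp (A' i t + A' j t) * (lam j (Rmax 0 t) - lam i (Rmax 0 t))).
    assert (HW : W t = W 0).
    { apply (zero_deriv_from_0 b); [| |easy].
      - intros s Hs. assert (Hext : forall m, (1 <= m <= n)%nat -> is_derive (fun t => lam m (Rmax 0 t)) s
          (- lam m s ^ 2 + k / INR n * (rho s - cb))).
        { intros m Hm. apply is_derive_ext_loc with (lam m).
          - generalize (open_gt 0 s (proj1 Hs)). apply filter_imp. intros x Hx.
            rewrite Rmax_right; [easy|lra].
          - now apply (S5 s Hs). }
        eapply is_derive_eq.
        { apply (is_derive_Rmult (fun t => exp (A' i t + A' j t))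
            (fun t => lam j (Rmax 0 t) - lam i (Rmax 0 t))).
          - apply (is_derive_exp_comp (fun t => A' i t + A' j t)). apply is_derive_Rplus; now apply HA'.
          - apply is_derive_Rminus; now apply Hext. }
        simpl. rewrite (Rmax_right 0 s) by lra. ring.
      - apply (continuous_mult (fun t => exp (A' i t + A' j t))).
        + apply (continuous_comp (fun t => A' i t + A' j t) exp).
          * apply (continuous_plus (A' i)); now apply HA.
          * apply (ex_derive_continuous exp). auto_derive. easy.
        + apply (continuous_minus (fun t => lam j (Rmax 0 t))); now apply HlC. }
    unfold W in HW. rewrite (Rmax_right 0 t) in HW by lra.
    change (exp (A' i t + A' j t) * (lam j t - lam i t) = lam0 j - lam0 i).
    rewrite HW, (Rmax_left 0 0), 2!HA0, Rplus_0_r, exp_0, 2!S2 by (easy || lra). ring.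
Qed.

(** Letting [t] decrease to 0 in [rep_cot_bound] gives [cos (w b) + l0 / w * sin (w b) <= 0]. With
    [al = atan (l0 / w)] the left side is [cos (w b - al) / cos al], which is positive if
    [w b < al + PI / 2]; that assumption also gives [w b < PI], the range in which the comparison is
    valid. *)
Lemma blow_up_time_lower n ka cb b l r A dd w l0 :
  rep n ka cb b l r A dd -> 0 < w -> w ^ 2 = ka * cb ->
  (forall c, ~ at_left b (fun t => c <= A 1%nat t)) ->
  filterlim (l 1%nat) (at_right 0) (locally l0) ->
  1 / w * atan (l0 / w) + PI / (2 * w) <= b.
Proof.
  intros H Hw Hw2 Hnb H0. assert (Hb := rep_b H). assert (Hn := rep_n H).
  assert (HPI := PI_RGT_0). set (al := atan (l0 / w)).
  assert (Hal : - PI / 2 < al < PI / 2) by apply atan_bound.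
  assert (Hgoal : al + PI / 2 <= w * b).
  2: { apply Rmult_le_reg_l with w; [easy|]. apply Rle_trans with (2 := Hgoal).
       right. field. lra. }
  apply Rnot_lt_le. intros Hlt.
  set (x := w * b). assert (Hx : 0 < x) by (unfold x; now apply Rmult_lt_0_compat).
  assert (Hcos : 0 < cos (x - al)) by (apply cos_gt_0; unfold x in *; lra).
  assert (Hca : 0 < cos al) by (apply cos_gt_0; lra).
  assert (Hval : 0 < cos x + l0 / w * sin x).
  { assert (Htan : l0 / w = sin al / cos al).
    { rewrite <- (tan_atan (l0 / w)). fold al. easy. }
    rewrite Htan. apply Rmult_lt_reg_r with (cos al); [easy|].
    replace ((cos x + sin al / cos al * sin x) * cos al) with (cos x * cos al + sin x * sin al)
      by (field; lra).
    rewrite <- cos_minus. lra. }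
  set (c := fun t => cos (w * (b - t)) + l 1%nat t / w * sin (w * (b - t))).
  assert (Hlim : filterlim c (at_right 0) (locally (cos x + l0 / w * sin x))).
  { assert (Hcont : forall f : R -> R, continuous f 0 -> filterlim f (at_right 0) (locally (f 0))).
    { intros f Hf. apply filterlim_filter_le_1 with (2 := Hf). apply filter_le_within. }
    assert (C1 : filterlim (fun t => cos (w * (b - t))) (at_right 0) (locally (cos x))).
    { replace x with (w * (b - 0)) by (unfold x; ring). apply (Hcont (fun t => cos (w * (b - t)))).
      apply (ex_derive_continuous (fun t => cos (w * (b - t)))). auto_derive. easy. }
    assert (C2 : filterlim (fun t => / w * sin (w * (b - t))) (at_right 0) (locally (/ w * sin x))).
    { replace x with (w * (b - 0)) by (unfold x; ring). apply (Hcont (fun t => / w * sin (w * (b - t)))).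
      apply (ex_derive_continuous (fun t => / w * sin (w * (b - t)))). auto_derive. easy. }
    assert (C3 : filterlim (fun t => l 1%nat t * (/ w * sin (w * (b - t)))) (at_right 0)
      (locally (l0 * (/ w * sin x)))).
    { apply (filterlim_comp_2 (G := locally l0) (H := locally (/ w * sin x)) _ _ Rmult H0 C2).
      exact (filterlim_mult l0 (/ w * sin x)). }
    replace (cos x + l0 / w * sin x) with (cos x + l0 * (/ w * sin x)) by (unfold Rdiv; ring).
    apply (filterlim_ext (fun t => cos (w * (b - t)) + l 1%nat t * (/ w * sin (w * (b - t))))).
    { intros t. unfold c, Rdiv. ring. }
    apply (filterlim_comp_2 (G := locally (cos x)) (H := locally (l0 * (/ w * sin x))) _ _ Rplus C1 C3).
    exact (filterlim_plus (cos x) (l0 * (/ w * sin x))). }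
  destruct (proj1 (filterlim_locally _ _) Hlim (mkposreal _ Hval)) as [d Hd].
  set (t := Rmin (d / 2) (b / 2)).
  assert (Ht : 0 < t /\ t <= d / 2 /\ t <= b / 2).
  { unfold t. split; [|split; [apply Rmin_l|apply Rmin_r]].
    apply Rmin_glb_lt; [|lra]. generalize (cond_pos d). lra. }
  assert (Hball : Rabs (t - 0) < d).
  { rewrite Rminus_0_r, Rabs_pos_eq by lra. generalize (cond_pos d). lra. }
  specialize (Hd t Hball (proj1 Ht)). change (Rabs (c t - (cos x + l0 / w * sin x)) < cos x + l0 / w * sin x) in Hd.
  apply Rabs_def2 in Hd.
  assert (HB := rep_cot_bound n ka cb b l r A dd w 1%nat t H ltac:(lia) Hw Hw2 Hnb ltac:(lra)).
  assert (Hwb : w * (b - t) <= PI).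
  { apply Rle_trans with x; [unfold x; apply Rmult_le_compat_l; lra|]. unfold x. lra. }
  specialize (HB Hwb). unfold c in Hd. lra.
Qed.

Theorem theorem1p1 (n J : nat) (k cb rho0 tB : R) (lam0 : nat -> R)
  (lam : nat -> R -> R) (rho : R -> R) :
  (2 <= n)%nat -> 0 < k -> 0 < cb -> 0 < rho0 ->
  (1 <= J <= n)%nat ->
  (forall i, (1 <= i < J)%nat -> lam0 i = lam0 (S i)) ->
  ((J < n)%nat -> lam0 J < lam0 (S J)) ->
  (forall i, (J + 1 <= i < n)%nat -> lam0 i <= lam0 (S i)) ->
  0 < tB ->
  REP_maximal_solution n k cb rho0 lam0 tB lam rho ->
  let omega := sqrt (k * cb / INR n) in
  ((1 <= J)%nat /\ INR J <= INR n / 2) /\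
  tB >= 1 / omega * atan (lam0 1%nat / omega) + PI / (2 * omega) /\
  (forall i, (1 <= i <= J)%nat ->
     filterlim (lam i) (at_left tB) (Rbar_locally m_infty)) /\
  (forall i, (J < i <= n)%nat ->
     filterlim (lam i) (at_left tB) (Rbar_locally p_infty)) /\
  filterlim rho (at_left tB) (Rbar_locally p_infty) /\
  (exists p q : R, 0 <= q <= p /\
     filterlim (fun t => lam 1%nat t * exp (RInt (fun s => lam 1%nat s + lam n s) 0 t))
       (at_left tB) (locally (- p)) /\
     filterlim (fun t => lam n t * exp (RInt (fun s => lam 1%nat s + lam n s) 0 t))
       (at_left tB) (locally q)).
Proof.
  intros Hn Hk Hcb Hr0 HJ Heq Hlt Hle Hb [Hsol Hmax] omega.
  assert (Hn0 : 0 < INR n) by (apply lt_0_INR; lia).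
  assert (Hmono : forall i j, (1 <= i)%nat -> (i <= j <= n)%nat -> lam0 i <= lam0 j).
  { intros i j Hi Hj. induction j as [|j IH]; [lia|].
    destruct (Nat.eq_dec i (S j)) as [->|Hne]; [apply Rle_refl|].
    apply Rle_trans with (lam0 j); [apply IH; lia|].
    destruct (Nat.lt_trichotomy j J) as [HjJ|[HjJ|HjJ]].
    - right. apply Heq. lia.
    - subst j. left. apply Hlt. lia.
    - apply Hle. lia. }
  assert (Hlow : forall i, (1 <= i <= J)%nat -> lam0 i = lam0 1%nat).
  { intros i Hi. induction i as [|i IH]; [lia|].
    destruct (Nat.eq_dec i 0) as [->|Hne]; [easy|].
    rewrite <- (Heq i) by lia. apply IH. lia. }
  assert (Hup : forall i, (J < i <= n)%nat -> lam0 1%nat < lam0 i).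
  { intros i Hi. apply Rlt_le_trans with (lam0 (S J)).
    - rewrite <- (Hlow J) by lia. apply Hlt. lia.
    - apply Hmono; lia. }
  assert (Hord : forall i, (1 <= i <= n)%nat -> lam0 1%nat <= lam0 i <= lam0 n).
  { intros i Hi. split; apply Hmono; lia. }
  assert (H := rep_of_solution n k cb rho0 tB lam0 lam rho Hn Hk Hcb Hr0 Hb Hsol Hord).
  set (A := fun i t => RInt (lam i) 0 t) in H.
  assert (Hnb : forall c, ~ at_left tB (fun t => c <= A 1%nat t)).
  { intros c Hc. destruct (rep_bounded_of_A1 _ _ _ _ _ _ _ _ c H Hc) as [K [HK0 HK]].
    apply Hmax. now apply (bounded_solution_extends n k cb rho0 tB K lam0 lam rho). }
  assert (Homega : omega = sqrt (k / INR n * cb)) by (unfold omega; f_equal; field; lra).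
  assert (Hkc : 0 < k / INR n * cb).
  { apply Rmult_lt_0_compat; [now apply Rdiv_lt_0_compat|easy]. }
  assert (Hom : 0 < omega) by (rewrite Homega; now apply sqrt_lt_R0).
  assert (Hom2 : omega ^ 2 = k / INR n * cb) by (rewrite Homega; apply pow2_sqrt; lra).
  assert (H1n : (1 <= 1 <= n)%nat) by lia. assert (Hnn : (1 <= n <= n)%nat) by lia.
  destruct (rep_planar _ _ _ _ _ _ _ _ J H Hnb HJ Hlow Hup)
    as [HJn [T [C [e2 [HT0 [HP Hrho]]]]]].
  assert (HT := pl_T HP).
  destruct (planar_G_conv n J _ _ _ _ _ _ _ _ _ Hn HJn HP) as [g Hg].
  destruct (planar_M_conv _ _ _ _ _ _ _ _ _ _ _ g HP Hg) as [m [Hm Hm2]].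
  assert (Hsep := rep_separation _ _ _ _ _ _ _ _ H Hnb).
  assert (Hl1 := rep_l_minf _ _ _ _ _ _ _ _ 1%nat H H1n Hnb).
  assert (Hln := rep_ln_pinf _ _ _ _ _ _ _ _ H Hnb).
  split; [split; [lia|]|split; [|split; [|split; [|split]]]].
  - exact (planar_multiplicity_le n J _ _ _ _ _ _ _ _ _ Hn HJn HP).
  - apply Rle_ge.
    apply (blow_up_time_lower _ _ _ _ _ _ _ _ omega (lam0 1%nat) H Hom Hom2 Hnb).
    now apply Hsol.
  - intros i Hi. apply to_minf_iff. intros K.
    generalize (filter_and _ _ (proj1 (to_pinf_iff _ _) Hl1 (- K)) (at_left_ge tB 0 Hb)).
    apply filter_imp. intros t [E Ht].
    assert (lam i t <= lam 1%nat t); [|lra].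
    apply (rep_le _ _ _ _ _ _ _ _ _ _ _ H); try lia; [easy|]. rewrite (Hlow i Hi). apply Rle_refl.
  - intros i Hi.
    destruct (rep_upper_gap _ _ _ _ _ _ _ _ i H Hnb ltac:(lia) (Hup i Hi)) as [C' HC'].
    apply (to_pinf_le tB (fun t => 1 * lam n t + - C')).
    + revert HC'. apply filter_imp. intros t Ht. lra.
    + apply to_pinf_affine; [lra|easy].
  - apply (planar_rho_pinf n J _ _ _ _ _ _ _ _ _ rho m Hn (conj (proj1 HJ) HJn) HP Hm Hm2); [|easy].
    intros t Ht. apply (rep_pos H). lra.
  - set (d := lam0 n - lam0 1%nat) in *. assert (Hd : 0 < d) by (unfold d; lra).
    assert (Hint : forall t, 0 < t < tB ->
      RInt (fun s => lam 1%nat s + lam n s) 0 t = A 1%nat t + A n t).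
    { intros t Ht. destruct Hsol as [S1 [S2 [S3 [S4 S5]]]].
      assert (Hex : forall i, (1 <= i <= n)%nat -> ex_RInt (lam i) 0 t).
      { intros i Hi. apply (ex_RInt_ext (fun s => lam i (Rmax 0 s))).
        - intros s. rewrite Rmin_left, Rmax_right by lra. intros Hs. rewrite Rmax_right; [easy|lra].
        - apply (ex_RInt_continuous (fun s => lam i (Rmax 0 s))). intros s.
          rewrite Rmin_left, Rmax_right by lra. intros Hs.
          apply (continuous_extend_left tB); [easy| | |lra].
          + rewrite S2 by easy. now apply S4.
          + intros x Hx. eexists. now apply (S5 x Hx). }
      apply (RInt_plus (lam 1%nat) (lam n)); now apply Hex. }
    assert (HE : forall t, T < t < tB ->
      exp (A 1%nat t + A n t) = d / gap n lam t).
    { intros t Ht. assert (Hg1 := pl_D1 HP t Ht). unfold d.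
      rewrite <- (rep_W H 1%nat n t H1n Hnn) by lra. unfold gap in *. field. lra. }
    exists (d * (1 / 2 + m)), (d * (1 / 2 - m)). split; [|split].
    + split; [apply Rmult_le_pos; lra|apply Rmult_le_compat_l; lra].
    + replace (- (d * (1 / 2 + m))) with ((- d) * (1 / 2 + m)) by ring.
      apply (conv_ext tB (fun t => (- d) * (1 / 2 + skew n lam t))).
      * apply (at_left_intro tB T); [easy|]. intros t Ht.
        assert (Hg1 := pl_D1 HP t Ht).
        rewrite Hint, HE by (easy || lra). unfold skew, gap in *. field. lra.
      * apply conv_mult; [apply conv_const|]. apply conv_plus; [apply conv_const|exact Hm].
    + replace (d * (1 / 2 - m)) with (d * (1 / 2 + (-1) * m)) by ring.
      apply (conv_ext tB (fun t => d * (1 / 2 + (-1) * skew n lam t))).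
      * apply (at_left_intro tB T); [easy|]. intros t Ht.
        assert (Hg1 := pl_D1 HP t Ht).
        rewrite Hint, HE by (easy || lra). unfold skew, gap in *. field. lra.
      * apply conv_mult; [apply conv_const|]. apply conv_plus; [apply conv_const|].
        apply conv_mult; [apply conv_const|exact Hm].
Qed.
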